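(* In the setting of the context, the complex $\mathbb K^\bullet(\mathcal S^\dagger,d_{\mathcal S^\dagger})\otimes_{\mathbb Z_p}\mathbb Q_p$ is a resolution of $\widehat{\overline R}[\frac1p]$ (via the canonical homomorphism $\widehat{\overline R}\to\mathcal S^\dagger$).
   Context: (1) Base. $p$ is a prime number; $K$ is a complete discretely valued field of characteristic $0$ with perfect residue field of characteristic $p$; $\overline K$ an algebraic closure; $\mathcal O_K,\mathcal O_{\overline K}$ the valuation rings; $\mathcal O_C$ the $p$-adic completion of $\mathcal O_{\overline K}$. Compatible roots of $p$ in $\mathcal O_{\overline K}$ are fixed, defining $p^r$ for rational $r\geq 0$. $\widehat A=\varprojlim_nA/p^nA$. (2) Log scheme. Log structures are on étale sites; monoids are commutative. For a monoid $M$, $\mathbf A_M=\mathrm{Spec}\,\mathbb Z[M]$ with the log structure associated to $M\to\mathbb Z[M]$, $x\mapsto e^x$. $S=\mathrm{Spec}\,\mathcal O_K$ has the log structure $\mathcal M_S$ defined by its closed point $s$; $\pi$ is a fixed uniformizer and $\iota:\mathbb N\to\Gamma(S,\mathcal M_S)$, $1\mapsto\pi$. Given: $f:(X,\mathcal M_X)\to(S,\mathcal M_S)$, a chart $\gamma:P\to\Gamma(X,\mathcal M_X)$ (i.e. $(X,\mathcal M_X)\to\mathbf A_P$ strict) with $P$ toric (fine, saturated, $P^{gp}$ free), and $\vartheta:\mathbb N\to P$; $\lambda=\vartheta(1)$. Assumptions: (C1) $X=\mathrm{Spec}(R)$ affine connected. (C2) $X\times_Ss\ne\emptyset$. (C3)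 $\gamma\circ\vartheta=f^\flat\circ\iota$. (C4) $\vartheta$ is saturated (integral, and $M'\oplus_{\mathbb N}P$ is saturated for every saturated $M'$ and $\mathbb N\to M'$). (C5) $\vartheta^{gp}$ is injective, the torsion of $\mathrm{coker}(\vartheta^{gp})$ has order prime to $p$, and $X\to S\times_{\mathbf A_{\mathbb N}}\mathbf A_P=\mathrm{Spec}(\mathcal O_K[P]/(\pi-e^\lambda))$ is étale. (C6) With $L=\mathrm{Hom}(P^{gp},\mathbb Z)$ and $H(P)=\mathrm{Hom}(P,\mathbb N)$, there are $h_1,\dots,h_r\in H(P)$, $\mathbb Z$-linearly independent in $L$, with $\ker(\lambda:L\to\mathbb Z)\cap H(P)=\{\sum a_ih_i:a_i\in\mathbb N\}$. $X^\circ$ is the maximal open subscheme where $\mathcal M_X$ is trivial. $\widetilde\Omega^1_{R/\mathcal O_K}=\Omega^1_{(R,P)/(\mathcal O_K,\mathbb N)}$ (log differentials) $\cong(P^{gp}/\mathbb Z\lambda)\otimes_{\mathbb Z}R$, a free $R$-module of finite rank; $\widetilde\Omega^i=\wedge^i\widetilde\Omega^1$. (3) $\overline R$. $X$ is integral, $F=\mathrm{Frac}(R)$; $F^a$ is a fixed separably closed extension of $F$ containing $\overline K$; $\overline F\subset F^a$ is the union of the finite extensions $N$ of $F$ for which the integral closure of $R$ in $N$ is étale over $X^\circ$; $\overline R$ is the integral closure of $R$ in $\overline F$. (4) $\xi$. $\mathcal R_{\mathcal O_{\overline K}}=\varprojlim_{x\mapsto x^p}\mathcal O_{\overline K}/p$,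 $\theta:W(\mathcal R_{\mathcal O_{\overline K}})\to\mathcal O_C$ is Fontaine's homomorphism, $\mathcal A_2(\mathcal O_{\overline K})=W(\mathcal R_{\mathcal O_{\overline K}})/\ker(\theta)^2$, $\xi=[\underline p]-p$ with $\underline p$ given by a compatible system of $p$-power roots of $p$; $\xi\mathcal O_C=\ker(\mathcal A_2(\mathcal O_{\overline K})\to\mathcal O_C)$ is free of rank one over $\mathcal O_C$, generated by $\xi$. For an $\mathcal O_C$-module $M$, $\xi^{-i}M=M\otimes_{\mathcal O_C}((\xi\mathcal O_C)^\vee)^{\otimes i}$. (5) The algebras. For rational $r\ge0$, $\mathcal S^{(r)}=\mathrm{Sym}_{\widehat{\overline R}}(p^r\xi^{-1}\widetilde\Omega^1_{R/\mathcal O_K}\otimes_R\widehat{\overline R})$, a subalgebra of $\mathcal S=\mathcal S^{(0)}$; $\widehat{\mathcal S}^{(r)}$ is its $p$-adic completion; for $r'\ge r$ the map $\widehat{\mathcal S}^{(r')}\to\widehat{\mathcal S}^{(r)}$ is injective; $\mathcal S^\dagger=\varinjlim_{r\in\mathbb Q_{>0}}\widehat{\mathcal S}^{(r)}\subset\widehat{\mathcal S}$. $d_{\widehat{\mathcal S}}:\widehat{\mathcal S}\to\xi^{-1}\widetilde\Omega^1_{R/\mathcal O_K}\otimes_R\widehat{\mathcal S}$ is the extension to the completion of the universal $\widehat{\overline R}$-derivation of $\mathcal S$ (using $\Omega^1_{\mathcal S/\widehat{\overline R}}\cong\xi^{-1}\widetilde\Omega^1_{R/\mathcal O_K}\otimes_R\mathcal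 S$), and $d_{\mathcal S^\dagger}:\mathcal S^\dagger\to\xi^{-1}\widetilde\Omega^1_{R/\mathcal O_K}\otimes_R\mathcal S^\dagger$ is its restriction. $\mathbb K^\bullet(\mathcal S^\dagger,d_{\mathcal S^\dagger})$ is the Dolbeault complex with $i$-th term $\xi^{-i}\widetilde\Omega^i_{R/\mathcal O_K}\otimes_R\mathcal S^\dagger$ ($i\geq 0$) and differentials $m\otimes\omega\mapsto d_{\mathcal S^\dagger}(m)\wedge\omega$. *)

(* Defs.v *)
(* MathComp.  Objects that the mathematics defines up to unique isomorphism
   (completions, tensor and symmetric powers, ...) are represented by an
   arbitrary object satisfying the defining property; subrings are represented
   by injective morphisms with prescribed image.  Rings are [comPzRingType]
   whenever 1 != 0 need not be assumed. *)
From HB Require Import structures.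
From mathcomp Require Import all_boot all_order all_algebra all_field.
From mathcomp Require Import mpoly.

Set Implicit Arguments.
Unset Strict Implicit.
Unset Printing Implicit Defensive.

Import GRing.Theory.
Local Open Scope ring_scope.

(** * Commutative algebra *)

Definition subring_embedding (A B : pzRingType) (i : {rmorphism A -> B})
    (S : B -> Prop) : Prop :=
  injective i /\ forall y, S y <-> exists x, i x = y.

Definition ideal_quotient (A Q : comPzRingType) (q : {rmorphism A -> Q})
    (I : A -> Prop) : Prop :=
  (forall y, exists x, q x = y) /\ (forall x, q x = 0 <-> I x).

Definition mult_of (A : comPzRingType) (c : A) (x : A) : Prop :=
  exists y, x = c * y.

Definition ideal_square (A : comPzRingType) (I : A -> Prop) (x : A) : Prop :=
  exists n (a b : 'I_n -> A),
    [/\ forall i, I (a i), forall i, I (b i) & x = \sum_(i < n) a i * b i].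

Definition is_localization (A A' : comPzRingType) (i : {rmorphism A -> A'})
    (S : A -> Prop) : Prop :=
  [/\ forall s, S s -> exists u, i s * u = 1,
      forall x, exists a s, S s /\ x * i s = i a
    & forall a, i a = 0 <-> exists s, S s /\ s * a = 0].

(* [A^ = lim_n A/p^n A]: elements of the limit are the sequences whose n-th
   term represents a class modulo p^n, up to termwise congruence. *)
Definition padic_compatible (p : nat) (A : comPzRingType) (a : nat -> A) :=
  forall n, mult_of (p%:R ^+ n) (a n.+1 - a n).

Definition is_padic_completion (p : nat) (A A' : comPzRingType)
    (c : {rmorphism A -> A'}) : Prop :=
  exists L : (nat -> A) -> A',
  [/\ forall a b, padic_compatible p a -> padic_compatible p b ->
        L (fun n => a n + b n) = L a + L b /\
        L (fun n => a n * b n) = L a * L b,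
      forall x, exists2 a, padic_compatible p a & L a = x,
      forall a, padic_compatible p a ->
        (L a = 0 <-> forall n, mult_of (p%:R ^+ n) (a n))
    & forall x, L (fun=> x) = c x].

Definition finitely_presented (A B : comNzRingType) (g : {rmorphism A -> B}) :=
  exists n (b : 'I_n -> B) m (r : 'I_m -> {mpoly A[n]}),
    (forall y, exists q, mmap g b q = y) /\
    (forall q, mmap g b q = 0 <->
       exists c : 'I_m -> {mpoly A[n]}, q = \sum_(i < m) c i * r i).

Definition formally_etale (A B : comNzRingType) (g : {rmorphism A -> B}) :=
  forall (C D : comPzRingType) (q : {rmorphism C -> D}),
    (forall y, exists x, q x = y) ->
    (forall x y, q x = 0 -> q y = 0 -> x * y = 0) ->
  forall (a : {rmorphism A -> C}) (b : {rmorphism B -> D}),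
    (forall x, q (a x) = b (g x)) ->
  exists h : {rmorphism B -> C},
    [/\ forall y, q (h y) = b y, forall x, h (g x) = a x
      & forall h' : {rmorphism B -> C}, (forall y, q (h' y) = b y) ->
          (forall x, h' (g x) = a x) -> h' =1 h].

Definition is_etale (A B : comNzRingType) (g : {rmorphism A -> B}) : Prop :=
  finitely_presented g /\ formally_etale g.

(* Étaleness of [Spec B -> Spec A] above the open subscheme [Spec A[1/S]].
   A localization that is the zero ring is not a [comNzRingType]; the condition
   is then (rightly) void. *)
Definition etale_over_localization (A B : comNzRingType)
    (g : {rmorphism A -> B}) (S : A -> Prop) : Prop :=
  forall (A' B' : comNzRingType) (i : {rmorphism A -> A'})
    (j : {rmorphism B -> B'}) (g' : {rmorphism A' -> B'}),
  is_localization i S ->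
  is_localization j (fun y => exists2 s, S s & g s = y) ->
  (forall x, g' (i x) = j (g x)) -> is_etale g'.

(** * Modules *)

Definition semilinear (A B : pzRingType) (f : A -> B)
    (M : lmodType A) (N : lmodType B) (u : M -> N) : Prop :=
  (forall x y, u (x + y) = u x + u y) /\ (forall a x, u (a *: x) = f a *: u x).

Definition upd (I : finType) (T : Type) (v : {ffun I -> T}) (k : I) (x : T) :=
  [ffun j => if j == k then x else v j].

Definition consf (T : Type) n (x : T) (v : {ffun 'I_n -> T}) :
    {ffun 'I_n.+1 -> T} :=
  [ffun j => if unlift ord0 j is Some k then v k else x].

Definition multilinear (A : comPzRingType) (M N : lmodType A) n
    (t : {ffun 'I_n -> M} -> N) : Prop :=
  forall v k a x y, t (upd v k (a *: x + y)) = a *: t (upd v k x) + t (upd v k y).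

Definition alternating (A : comPzRingType) (M N : lmodType A) n
    (t : {ffun 'I_n -> M} -> N) : Prop :=
  multilinear t /\
  forall (v : {ffun 'I_n -> M}) (j k : 'I_n), j != k -> v j = v k -> t v = 0.

Definition is_tensor_power (A : comPzRingType) (M T : lmodType A) n
    (t : {ffun 'I_n -> M} -> T) : Prop :=
  multilinear t /\
  forall (U : lmodType A) (u : {ffun 'I_n -> M} -> U), multilinear u ->
  exists2 f : {linear T -> U}, forall v, f (t v) = u v &
    forall f' : {linear T -> U}, (forall v, f' (t v) = u v) -> f' =1 f.

Definition is_exterior_power (A : comPzRingType) (M T : lmodType A) n
    (t : {ffun 'I_n -> M} -> T) : Prop :=
  alternating t /\
  forall (U : lmodType A) (u : {ffun 'I_n -> M} -> U), alternating u ->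
  exists2 f : {linear T -> U}, forall v, f (t v) = u v &
    forall f' : {linear T -> U}, (forall v, f' (t v) = u v) -> f' =1 f.

(* [T = (B (x)_A M) (x)_C N] for ring morphisms [f : A -> B], [g : C -> B],
   with [t x y = 1 (x) x (x) y]. *)
Definition bisemilinear (A B C : comPzRingType) (f : A -> B) (g : C -> B)
    (M : lmodType A) (N : lmodType C) (T : lmodType B) (t : M -> N -> T) :=
  (forall y, semilinear f (fun x => t x y)) /\
  (forall x, semilinear g (t x)).

Definition is_mixed_tensor (A B C : comPzRingType) (f : A -> B) (g : C -> B)
    (M : lmodType A) (N : lmodType C) (T : lmodType B) (t : M -> N -> T) :=
  bisemilinear f g t /\
  forall (U : lmodType B) (u : M -> N -> U), bisemilinear f g u ->
  exists2 h : {linear T -> U}, forall x y, h (t x y) = u x y &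
    forall h' : {linear T -> U}, (forall x y, h' (t x y) = u x y) -> h' =1 h.

(* [T = M (x)_Z Q], for a [B]-module [M] and ring morphisms [Z -> B], [Z -> Q]. *)
Definition balanced (Z B Q : comPzRingType) (zB : Z -> B) (zQ : Z -> Q)
    (M : lmodType B) (T : zmodType) (t : M -> Q -> T) : Prop :=
  [/\ forall x x' q, t (x + x') q = t x q + t x' q,
      forall x q q', t x (q + q') = t x q + t x q'
    & forall z x q, t (zB z *: x) q = t x (zQ z * q)].

Definition is_scalar_extension (Z B Q : comPzRingType) (zB : Z -> B)
    (zQ : Z -> Q) (M : lmodType B) (T : zmodType) (t : M -> Q -> T) : Prop :=
  balanced zB zQ t /\
  forall (U : zmodType) (u : M -> Q -> U), balanced zB zQ u ->
  exists2 h : {additive T -> U}, forall x q, h (t x q) = u x q &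
    forall h' : {additive T -> U}, (forall x q, h' (t x q) = u x q) -> h' =1 h.

Definition is_dual (A : comPzRingType) (M D : lmodType A) (ev : D -> M -> A) :=
  [/\ forall d, semilinear idfun (ev d : M -> A^o),
      forall x, semilinear idfun (fun d => ev d x : A^o)
    & forall f : {linear M -> A^o},
        exists2 d, ev d =1 f & forall d', ev d' =1 f -> d' = d].

Definition is_symmetric_algebra (A S : comPzRingType) (M : lmodType A)
    (a : {rmorphism A -> S}) (sg : M -> S) : Prop :=
  semilinear a (sg : M -> S^o) /\
  forall (C : comPzRingType) (b : {rmorphism A -> C}) (u : M -> C),
    semilinear b (u : M -> C^o) ->
  exists h : {rmorphism S -> C},
    [/\ forall x, h (a x) = b x, forall x, h (sg x) = u x
      & forall h' : {rmorphism S -> C}, (forall x, h' (a x) = b x) ->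
          (forall x, h' (sg x) = u x) -> h' =1 h].

Definition is_derivation (A B : comPzRingType) (a : A -> B) (M : lmodType B)
    (d : B -> M) : Prop :=
  [/\ forall x y, d (x + y) = d x + d y,
      forall x y, d (x * y) = x *: d y + y *: d x
    & forall c, d (a c) = 0].

(** * Monoids (written additively) *)

Definition fg_monoid (M : nmodType) : Prop :=
  exists n (g : 'I_n -> M), forall x, exists c : 'I_n -> nat,
    x = \sum_(i < n) g i *+ c i.

Definition integral_monoid (M : nmodType) : Prop :=
  forall x y z : M, x + z = y + z -> x = y.

(* The element x - y of M^gp lies in M as soon as n(x - y) does, n > 0. *)
Definition saturated_monoid (M : nmodType) : Prop :=
  integral_monoid M /\
  forall (x y : M) n, (0 < n)%N ->
    (exists z, x *+ n = y *+ n + z) -> exists z, x = y + z.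

Definition is_group_completion (M : nmodType) (G : zmodType)
    (j : {additive M -> G}) : Prop :=
  forall (H : zmodType) (u : {additive M -> H}),
  exists2 f : {additive G -> H}, forall x, f (j x) = u x &
    forall f' : {additive G -> H}, (forall x, f' (j x) = u x) -> f' =1 f.

Definition free_abelian (G : zmodType) : Prop :=
  exists n (b : 'I_n -> G), forall x, exists2 z : {ffun 'I_n -> int},
    x = \sum_(i < n) b i *~ z i &
    forall z' : {ffun 'I_n -> int}, x = \sum_(i < n) b i *~ z' i -> z' = z.

Definition is_pushout (N P M Q : nmodType) (u : {additive N -> P})
    (v : {additive N -> M}) (i : {additive P -> Q}) (j : {additive M -> Q}) :=
  (forall n, i (u n) = j (v n)) /\
  forall (T : nmodType) (i' : {additive P -> T}) (j' : {additive M -> T}),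
    (forall n, i' (u n) = j' (v n)) ->
  exists f : {additive Q -> T},
    [/\ forall x, f (i x) = i' x, forall y, f (j y) = j' y
      & forall f' : {additive Q -> T}, (forall x, f' (i x) = i' x) ->
          (forall y, f' (j y) = j' y) -> f' =1 f].

Definition integral_morphism (N P : nmodType) (u : {additive N -> P}) : Prop :=
  forall (M Q : nmodType) (v : {additive N -> M})
    (i : {additive P -> Q}) (j : {additive M -> Q}),
  integral_monoid M -> is_pushout u v i j -> integral_monoid Q.

Definition saturated_morphism (N P : nmodType) (u : {additive N -> P}) : Prop :=
  integral_morphism u /\
  forall (M Q : nmodType) (v : {additive N -> M})
    (i : {additive P -> Q}) (j : {additive M -> Q}),
  saturated_monoid M -> is_pushout u v i j -> saturated_monoid Q.

Definition exponential (P : nmodType) (A : pzRingType) (e : P -> A) : Prop :=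
  e 0 = 1 /\ forall x y, e (x + y) = e x * e y.

(* [A = O[P]/(c - e^l)]: the ring of S x_(A_N) A_P, S = Spec O, where N -> O and
   N -> P send 1 to c and l. *)
Definition is_chart_ring (O A : comPzRingType) (P : nmodType) (c : O) (l : P)
    (o : {rmorphism O -> A}) (e : P -> A) : Prop :=
  [/\ exponential e, e l = o c &
      forall (B : comPzRingType) (b : {rmorphism O -> B}) (m : P -> B),
        exponential m -> m l = b c ->
      exists h : {rmorphism A -> B},
        [/\ forall x, h (o x) = b x, forall x, h (e x) = m x
          & forall h' : {rmorphism A -> B}, (forall x, h' (o x) = b x) ->
              (forall x, h' (e x) = m x) -> h' =1 h]].

(* Log derivations of (R,P) over (O,N), the log structure of N being generated
   by its image l in P. *)
Definition is_log_derivation (O R : comPzRingType) (P : nmodType) (l : P)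
    (o : O -> R) (al : P -> R) (M : lmodType R) (d : R -> M)
    (dlog : {additive P -> M}) : Prop :=
  [/\ is_derivation o d, forall x, d (al x) = al x *: dlog x & dlog l = 0].

Definition is_log_differentials (O R : comPzRingType) (P : nmodType) (l : P)
    (o : O -> R) (al : P -> R) (M : lmodType R) (d : R -> M)
    (dlog : {additive P -> M}) : Prop :=
  is_log_derivation l o al d dlog /\
  forall (U : lmodType R) (d' : R -> U) (dlog' : {additive P -> U}),
    is_log_derivation l o al d' dlog' ->
  exists f : {linear M -> U},
    [/\ forall x, f (d x) = d' x, forall x, f (dlog x) = dlog' x
      & forall f' : {linear M -> U}, (forall x, f' (d x) = d' x) ->
          (forall x, f' (dlog x) = dlog' x) -> f' =1 f].

(** * Witt vectors *)

Definition ghost (p : nat) (A : pzRingType) (n : nat) (x : nat -> A) : A :=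
  \sum_(i < n.+1) p%:R ^+ i * x i ^+ (p ^ (n - i)).

(* The functorial operations on A^N for which all ghost components are ring
   morphisms; they are unique by Witt's theorem. *)
Definition witt_operations (p : nat)
    (add mul : forall A : comPzRingType, (nat -> A) -> (nat -> A) -> nat -> A) :=
  [/\ forall (A B : comPzRingType) (f : {rmorphism A -> B}) x y n,
        f (add A x y n) = add B (f \o x) (f \o y) n,
      forall (A B : comPzRingType) (f : {rmorphism A -> B}) x y n,
        f (mul A x y n) = mul B (f \o x) (f \o y) n,
      forall (A : comPzRingType) x y n,
        ghost p n (add A x y) = ghost p n x + ghost p n y
    & forall (A : comPzRingType) x y n,
        ghost p n (mul A x y) = ghost p n x * ghost p n y].

Definition is_witt_ring (p : nat) (A W : comPzRingType) (co : W -> nat -> A) :=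
  (forall x : nat -> A, exists2 w, co w =1 x & forall w', co w' =1 x -> w' = w)
  /\ exists add mul, [/\ witt_operations p add mul,
       forall v w, co (v + w) =1 add A (co v) (co w)
     & forall v w, co (v * w) =1 mul A (co v) (co w)].

(** * The base *)

(* [v] is only meaningful on nonzero elements. *)
Definition val_ge (L : fieldType) (v : L -> rat) (x : L) (m : rat) : Prop :=
  x = 0 \/ m <= v x.

Record base_field (p : nat) := BaseField {
  fK : fieldType;
  Kbar : closedFieldType;
  K_Kbar : {rmorphism fK -> Kbar};
  Kbar_algebraic : forall x, algebraicOver K_Kbar x;
  K_pchar0 : [pchar fK] =i pred0;
  (* the valuation of K, normalized, and its extension to Kbar *)
  vKbar : Kbar -> rat;
  valM : forall x y, x != 0 -> y != 0 -> vKbar (x * y) = vKbar x + vKbar y;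
  valD : forall x y, x != 0 -> y != 0 -> x + y != 0 ->
    Num.min (vKbar x) (vKbar y) <= vKbar (x + y);
  val_discrete : forall x : fK, x != 0 ->
    exists n : int, vKbar (K_Kbar x) = n%:~R;
  K_complete : forall u : nat -> fK,
    (forall m, exists N, forall i j, (N <= i)%N -> (N <= j)%N ->
       val_ge vKbar (K_Kbar (u i - u j)) m%:R) ->
    exists l, forall m, exists N, forall i, (N <= i)%N ->
      val_ge vKbar (K_Kbar (u i - l)) m%:R;
  OK : comNzRingType;
  OK_K : {rmorphism OK -> fK};
  OK_subring : subring_embedding OK_K (fun x => val_ge vKbar (K_Kbar x) 0);
  unif : OK;
  unif_neq0 : OK_K unif != 0;
  val_unif : vKbar (K_Kbar (OK_K unif)) = 1;
  resK : fieldType;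
  OK_resK : {rmorphism OK -> resK};
  OK_resKP : ideal_quotient OK_resK
    (fun x => x = 0 \/ 0 < vKbar (K_Kbar (OK_K x)));
  resK_pchar : p \in [pchar resK];
  resK_perfect : forall x : resK, exists y, y ^+ p = x;
  OKb : comNzRingType;
  OKb_Kbar : {rmorphism OKb -> Kbar};
  OKb_subring : subring_embedding OKb_Kbar (fun x => val_ge vKbar x 0);
  OC : comPzRingType;
  OKb_OC : {rmorphism OKb -> OC};
  OC_completion : is_padic_completion p OKb_OC;
  (* [proot n] is p^(1/n), n > 0 *)
  proot : nat -> OKb;
  proot1 : proot 1 = p%:R;
  prootM : forall m n, (0 < m)%N -> (0 < n)%N ->
    proot (m * n)%N ^+ m = proot n
}.

Record nnrat := NNRat { nnval : rat; nnval_ge0 : 0 <= nnval }.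

Definition nn0 : nnrat := @NNRat 0 isT.

Definition ppow p (B : base_field p) (r : nnrat) : OKb B :=
  proot B `|denq (nnval r)|%N ^+ `|numq (nnval r)|%N.

(** * The log scheme *)

(* Since [X = Spec R] is affine and the log structure is the one associated with
   the chart [alpha : P -> R], the data of (X, M_X) -> (S, M_S) and its chart
   amount to an OK-algebra R and to [alpha] with alpha(lambda) = pi.  X is
   integral, hence connected. *)
Record log_chart p (B : base_field p) := LogChart {
  ringR : idomainType;
  OK_R : {rmorphism OK B -> ringR};
  R_special : ~ exists x, OK_R (unif B) * x = 1;
  monP : nmodType;
  monP_fg : fg_monoid monP;
  monP_saturated : saturated_monoid monP;
  Pgp : zmodType;
  P_Pgp : {additive monP -> Pgp};
  PgpP : is_group_completion P_Pgp;
  Pgp_free : free_abelian Pgp;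
  vartheta : {additive nat -> monP};
  vartheta_saturated : saturated_morphism vartheta;
  alpha : monP -> ringR;
  al_exp : exponential alpha;
  al_lambda : alpha (vartheta 1%N) = OK_R (unif B);
  vartheta_gp_inj : forall n : int,
    P_Pgp (vartheta 1%N) *~ n = 0 -> n = 0;
  coker_gp : zmodType;
  Pgp_coker : {additive Pgp -> coker_gp};
  Pgp_coker_surj : forall y, exists x, Pgp_coker x = y;
  Pgp_coker_ker : forall x,
    Pgp_coker x = 0 <-> exists n : int, x = P_Pgp (vartheta 1%N) *~ n;
  coker_torsion : exists s : seq coker_gp,
    [/\ uniq s, forall x, x \in s <-> exists2 n, (0 < n)%N & x *+ n = 0
      & coprime (size s) p];
  chart_ring : comNzRingType;
  OK_chart : {rmorphism OK B -> chart_ring};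
  P_chart : monP -> chart_ring;
  chart_ringP : is_chart_ring (unif B) (vartheta 1%N) OK_chart P_chart;
  chart_R : {rmorphism chart_ring -> ringR};
  chart_R_OK : forall x, chart_R (OK_chart x) = OK_R x;
  chart_R_P : forall x, chart_R (P_chart x) = alpha x;
  chart_R_etale : is_etale chart_R;
  kerH_free : exists r (h : 'I_r -> {additive monP -> nat}),
    (forall z : 'I_r -> int,
       (forall x, \sum_(i < r) z i * (h i x)%:Z = 0) -> forall i, z i = 0) /\
    (forall g : {additive monP -> nat}, g (vartheta 1%N) = 0%N <->
       exists a : 'I_r -> nat, forall x, g x = (\sum_(i < r) a i * h i x)%N);
  Omega : lmodType ringR;
  dR : ringR -> Omega;
  dlogP : {additive monP -> Omega};
  OmegaP : is_log_differentials (vartheta 1%N) OK_R alpha dR dlogP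
}.

(** * The ring Rbar *)

Section FinEtale.
Variables (R0 : idomainType) (S : R0 -> Prop).

(* The integral closure of R in N is étale over Spec R[1/S]. *)
Definition etale_extension (N : fieldExtType {fraction R0}) : Prop :=
  exists (A : comNzRingType) (a : {rmorphism R0 -> A}) (j : {rmorphism A -> N}),
  [/\ subring_embedding j (integralOver (fun x : R0 => (tofrac x)%:A : N)),
      forall x, j (a x) = (tofrac x)%:A
    & etale_over_localization a S].

Definition in_Fbar (Fa : fieldType) (f : {fraction R0} -> Fa) (x : Fa) : Prop :=
  exists (N : fieldExtType {fraction R0}) (i : {rmorphism N -> Fa}),
  [/\ forall c, i c%:A = f c, etale_extension N & exists y, i y = x].

End FinEtale.

Record galois_cover p (B : base_field p) (X : log_chart B) := GaloisCover {
  Fa : fieldType;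
  F_Fa : {rmorphism {fraction (ringR X)} -> Fa};
  Fa_sep_closed : forall q : {poly Fa}, separable_poly q -> (1 < size q)%N ->
    exists x, root q x;
  Kbar_Fa : {rmorphism Kbar B -> Fa};
  Kbar_Fa_F : forall x, Kbar_Fa (K_Kbar B (OK_K B x)) = F_Fa (tofrac (OK_R X x));
  Rb : comNzRingType;
  Rb_Fa : {rmorphism Rb -> Fa};
  (* X° is the open subscheme where the image of P is invertible *)
  Rb_subring : subring_embedding Rb_Fa (fun x =>
    in_Fbar (fun y => exists m : monP X, alpha m = y) F_Fa x /\
    integralOver (fun y : ringR X => F_Fa (tofrac y)) x);
  R_Rb : {rmorphism ringR X -> Rb};
  R_RbE : forall x, Rb_Fa (R_Rb x) = F_Fa (tofrac x);
  OKb_Rb : {rmorphism OKb B -> Rb};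
  OKb_RbE : forall x, Rb_Fa (OKb_Rb x) = Kbar_Fa (OKb_Kbar B x);
  Rh : comPzRingType;
  Rb_Rh : {rmorphism Rb -> Rh};
  Rh_completion : is_padic_completion p Rb_Rh;
  OC_Rh : {rmorphism OC B -> Rh};
  OC_RhE : forall x, OC_Rh (OKb_OC B x) = Rb_Rh (OKb_Rb x)
}.

(** * Fontaine's rings *)

Record fontaine p (B : base_field p) := Fontaine {
  OKbp : comPzRingType;
  OKb_p : {rmorphism OKb B -> OKbp};
  OKb_pP : ideal_quotient OKb_p (mult_of p%:R);
  tilt : comPzRingType;
  tilt_pr : nat -> {rmorphism tilt -> OKbp};
  tilt_prX : forall n x, tilt_pr n.+1 x ^+ p = tilt_pr n x;
  tilt_lim : forall u : nat -> OKbp, (forall n, u n.+1 ^+ p = u n) ->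
    exists2 x, forall n, tilt_pr n x = u n &
      forall x', (forall n, tilt_pr n x' = u n) -> x' = x;
  Wtilt : comPzRingType;
  witt_coord : Wtilt -> nat -> tilt;
  Wtilt_witt : is_witt_ring p witt_coord;
  theta : {rmorphism Wtilt -> OC B};
  (* theta(x_0, x_1, ...) is congruent modulo p^(n+1) to the n-th ghost
     component of lifts to O_Kbar of the n-th projections of the x_i *)
  thetaP : forall w n (u : nat -> OKb B),
    (forall i, (i <= n)%N -> OKb_p (u i) = tilt_pr n (witt_coord w i)) ->
    mult_of (p%:R ^+ n.+1) (theta w - OKb_OC B (ghost p n u));
  fA2 : comPzRingType;
  W_A2 : {rmorphism Wtilt -> fA2};
  A2P : ideal_quotient W_A2 (ideal_square (fun w => theta w = 0));
  theta2 : {rmorphism fA2 -> OC B};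
  theta2E : forall w, theta2 (W_A2 w) = theta w;
  (* xi O_C = ker (A2 -> O_C), and its dual; the twist by xi^-i only depends on
     this module, not on its generator xi *)
  xiOC : lmodType (OC B);
  xiOC_A2 : {additive xiOC -> fA2};
  xiOC_inj : injective xiOC_A2;
  xiOC_ker : forall y, theta2 y = 0 <-> exists x, xiOC_A2 x = y;
  xiOC_scale : forall a x, xiOC_A2 (theta2 a *: x) = a * xiOC_A2 x;
  xiD : lmodType (OC B);
  xi_ev : xiD -> xiOC -> OC B;
  xiDP : is_dual xi_ev
}.

(** * The algebras S^(r), their completions and S^dagger *)

(* [u] is the map id (x) g, between the modules xi^-1 Omega (x)_R A and
   xi^-1 Omega (x)_R A'. *)
Definition twist_map (A A' : comPzRingType) (g : A -> A') (M N : Type)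
    (T : lmodType A) (T' : lmodType A') (t : M -> N -> T) (t' : M -> N -> T')
    (u : T -> T') : Prop :=
  semilinear g u /\ forall x y, u (t x y) = t' x y.

Record higgs_tate p (B : base_field p) (X : log_chart B) (G : galois_cover X)
    (T : fontaine B) := HiggsTate {
  xiE : lmodType (Rh G);
  eE : Omega X -> xiD T -> xiE;
  E_tensor : is_mixed_tensor (Rb_Rh G \o R_Rb G) (OC_Rh G) eE;
  (* [Er r] is p^r xiE *)
  Er : nnrat -> lmodType (Rh G);
  Er_E : forall r, {linear Er r -> xiE};
  Er_inj : forall r, injective (Er_E r);
  Er_image : forall r y,
    (exists x, Er_E r x = y) <->
    exists x, y = Rb_Rh G (OKb_Rb G (ppow B r)) *: x;
  Sr : nnrat -> comPzRingType;
  Rh_Sr : forall r, {rmorphism Rh G -> Sr r};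
  Er_Sr : forall r, Er r -> Sr r;
  Sr_sym : forall r, is_symmetric_algebra (Rh_Sr r) (@Er_Sr r);
  Sr_le : forall r r', nnval r <= nnval r' -> {rmorphism Sr r' -> Sr r};
  Sr_le_Rh : forall r r' (h : nnval r <= nnval r') x,
    Sr_le h (Rh_Sr r' x) = Rh_Sr r x;
  Sr_le_Er : forall r r' (h : nnval r <= nnval r') x y,
    Er_E r' x = Er_E r y -> Sr_le h (Er_Sr x) = Er_Sr y;
  Sh : nnrat -> comPzRingType;
  Sr_Sh : forall r, {rmorphism Sr r -> Sh r};
  Sh_completion : forall r, is_padic_completion p (Sr_Sh r);
  Sh_le : forall r r', nnval r <= nnval r' -> {rmorphism Sh r' -> Sh r};
  Sh_leE : forall r r' (h : nnval r <= nnval r') x,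
    Sh_le h (Sr_Sh r' x) = Sr_Sh r (Sr_le h x);
  (* the direct limit of the [Sh r], r > 0 *)
  Sd : comPzRingType;
  Sh_Sd : forall r, 0 < nnval r -> {rmorphism Sh r -> Sd};
  Sh_SdE : forall r r' (h : nnval r <= nnval r') (h0 : 0 < nnval r)
    (h0' : 0 < nnval r') x, Sh_Sd h0 (Sh_le h x) = Sh_Sd h0' x;
  Sd_lim : forall x, exists r (h0 : 0 < nnval r) y, Sh_Sd h0 y = x;
  Sd_lim0 : forall r (h0 : 0 < nnval r) x, Sh_Sd h0 x = 0 ->
    exists r' (h : nnval r' <= nnval r), 0 < nnval r' /\ Sh_le h x = 0;
  Sd_Sh : {rmorphism Sd -> Sh nn0};
  Sd_ShE : forall r (h0 : 0 < nnval r) (h : nnval nn0 <= nnval r) x,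
    Sd_Sh (Sh_Sd h0 x) = Sh_le h x;
  Rh_Sd : {rmorphism Rh G -> Sd};
  Rh_SdE : forall r (h0 : 0 < nnval r) x,
    Rh_Sd x = Sh_Sd h0 (Sr_Sh r (Rh_Sr r x));
  (* the universal derivation of S = Sr 0, its extension to Sh 0, and the
     restriction of the latter to Sd *)
  ES : lmodType (Sr nn0);
  eES : Omega X -> xiD T -> ES;
  ES_tensor : is_mixed_tensor (Rh_Sr nn0 \o (Rb_Rh G \o R_Rb G))
    (Rh_Sr nn0 \o OC_Rh G) eES;
  E_ES : xiE -> ES;
  E_ESP : twist_map (Rh_Sr nn0) eE eES E_ES;
  dS : Sr nn0 -> ES;
  dS_der : is_derivation (Rh_Sr nn0) dS;
  dS_univ : forall x : Er nn0, dS (Er_Sr x) = E_ES (Er_E nn0 x);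
  ESh : lmodType (Sh nn0);
  eESh : Omega X -> xiD T -> ESh;
  ESh_tensor :
    is_mixed_tensor (Sr_Sh nn0 \o (Rh_Sr nn0 \o (Rb_Rh G \o R_Rb G)))
      (Sr_Sh nn0 \o (Rh_Sr nn0 \o OC_Rh G)) eESh;
  ES_ESh : ES -> ESh;
  ES_EShP : twist_map (Sr_Sh nn0) eES eESh ES_ESh;
  dSh : Sh nn0 -> ESh;
  dSh_der : is_derivation (Sr_Sh nn0 \o Rh_Sr nn0) dSh;
  dSh_ext : forall x, dSh (Sr_Sh nn0 x) = ES_ESh (dS x);
  ESd : lmodType Sd;
  eESd : Omega X -> xiD T -> ESd;
  ESd_tensor : is_mixed_tensor (Rh_Sd \o (Rb_Rh G \o R_Rb G))
    (Rh_Sd \o OC_Rh G) eESd;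
  ESd_ESh : ESd -> ESh;
  ESd_EShP : twist_map Sd_Sh eESd eESh ESd_ESh;
  dSd : Sd -> ESd;
  dSd_restr : forall x, ESd_ESh (dSd x) = dSh (Sd_Sh x)
}.

(** * The Dolbeault complex and its tensor product with Q_p *)

Record dolbeault p (B : base_field p) (X : log_chart B) (G : galois_cover X)
    (T : fontaine B) (S : higgs_tate G T) := Dolbeault {
  OmegaExt : nat -> lmodType (ringR X);
  ext_alt : forall i, {ffun 'I_i -> Omega X} -> OmegaExt i;
  alt_ext : forall i, is_exterior_power (@ext_alt i);
  ext_cons : forall i, Omega X -> {linear OmegaExt i -> OmegaExt i.+1};
  ext_consE : forall i w (v : {ffun 'I_i -> Omega X}),
    ext_cons i w (ext_alt v) = ext_alt (consf w v);
  xiDTens : nat -> lmodType (OC B);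
  tens_pow : forall i, {ffun 'I_i -> xiD T} -> xiDTens i;
  tens_power : forall i, is_tensor_power (@tens_pow i);
  tens_cons : forall i, xiD T -> {linear xiDTens i -> xiDTens i.+1};
  tens_consE : forall i w (v : {ffun 'I_i -> xiD T}),
    tens_cons i w (tens_pow v) = tens_pow (consf w v);
  (* KK i = xi^-i Omega^i (x)_R Sd *)
  KK : nat -> lmodType (Sd S);
  kk : forall i, OmegaExt i -> xiDTens i -> KK i;
  KK_tensor : forall i, is_mixed_tensor (Rh_Sd S \o (Rb_Rh G \o R_Rb G))
    (Rh_Sd S \o OC_Rh G) (@kk i);
  kk_wedge : forall i, OmegaExt i -> xiDTens i -> {linear ESd S -> KK i.+1};
  wedgeE : forall i (w : OmegaExt i) (x : xiDTens i) w' x',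
    kk_wedge w x (eESd S w' x') = kk (ext_cons i w' w) (tens_cons i x' x);
  dKK : forall i, {additive KK i -> KK i.+1};
  dKKE : forall i (m : Sd S) (w : OmegaExt i) (x : xiDTens i),
    dKK i (m *: kk w x) = kk_wedge w x (dSd m);
  Zp : comPzRingType;
  int_Zp : {rmorphism int -> Zp};
  Zp_completion : is_padic_completion p int_Zp;
  Zp_OC : {rmorphism Zp -> OC B};
  Qp : fieldType;
  Zp_Qp : {rmorphism Zp -> Qp};
  Zp_Qp_inj : injective Zp_Qp;
  Qp_frac : forall x, exists a b, Zp_Qp b != 0 /\ x = Zp_Qp a / Zp_Qp b;
  KKQ : nat -> zmodType;
  kkq : forall i, KK i -> Qp -> KKQ i;
  KKQ_tensor : forall i,
    is_scalar_extension (Rh_Sd S \o (OC_Rh G \o Zp_OC)) Zp_Qp (@kkq i);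
  dKKQ : forall i, {additive KKQ i -> KKQ i.+1};
  dKKQE : forall i x q, dKKQ i (kkq x q) = kkq (dKK i x) q;
  RhQ : comPzRingType;
  Rh_RhQ : {rmorphism Rh G -> RhQ};
  RhQ_loc : is_localization Rh_RhQ (fun x => exists n, x = p%:R ^+ n);
  (* RhQ -> KKQ 0, induced by Rh -> Sd = KK 0 *)
  augmQ : {additive RhQ -> KKQ 0};
  augmE : forall a (v : {ffun 'I_0 -> Omega X}) (w : {ffun 'I_0 -> xiD T}),
    augmQ (Rh_RhQ a) = kkq (Rh_Sd S a *: kk (ext_alt v) (tens_pow w)) 1
}.

Definition is_resolution (A : zmodType) (C : nat -> zmodType)
    (d : forall i, {additive C i -> C i.+1}) (e : {additive A -> C 0%N}) : Prop :=
  [/\ injective e,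
      forall x, d 0%N x = 0 <-> exists a, e a = x
    & forall i x, d i.+1 x = 0 <-> exists y, d i y = x].

(* Main.v *)
(* The log differentials are free because the chart is étale and the torsion of
   coker(vartheta^gp) has order prime to p, and xi^-1 O_C is free of rank one
   because the kernel of theta on W(tilt), for tilt perfect and W(tilt) p-adically
   complete, is generated by the nonzerodivisor [p^flat] - p.  Hence S^(r) is a
   polynomial ring, S^dagger embeds into formal power series over Rh with image
   the series of coefficients a_I = p^(|I|/m) a'_I for some m > 0, and, after
   inverting p, the Dolbeault complex becomes the de Rham complex of these
   overconvergent series.  By Cartan's formula for the Euler vector field, a
   closed form of positive degree is the differential of the contraction with
   that field of the form obtained by dividing each coefficient by its weight;
   the denominators grow logarithmically, so overconvergence is preserved. *)
Require Import Defs.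
From HB Require Import structures.
From Stdlib Require Import Classical ClassicalEpsilon FunctionalExtensionality.
From mathcomp Require Import all_boot all_order all_fingroup all_algebra all_field.
From mathcomp Require Import mpoly zify.
From mathcomp Require monalg.

Set Implicit Arguments.
Unset Strict Implicit.
Unset Printing Implicit Defensive.

Import Order.TTheory GRing.Theory Num.Theory.
Local Open Scope ring_scope.

(** * Witt vectors *)

(** Objects are known only through universal properties, so nothing can be computed in them
    directly: a basis is obtained by building coordinate maps out of the object, and identities
    follow from uniqueness of such maps. Coordinates of the q-th Dolbeault term are indexed by all
    q-tuples of basis elements instead of the increasing ones; signs become uniform, and the price
    is a factor q!, which is cancelled on coefficients and inverted rationally. For ker theta the
    work lies modulo p: in the tilt, p^flat is regular and generates the kernel of the projection to
    O_Kbar/p. This lifts to the Witt ring because that ring is p-adically complete and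
    p-torsion-free. Division by weights explains the limit over r. A fixed S^(r) need not be stable
    under it, since the valuations of the weights are unbounded; passing from r = 1/m to 1/(2m)
    gains p^(|I|/(2m)), which outweighs them. The same halving turns a family p^(|I|/m) a'_I, whose
    a'_I need not tend to 0, into an element of a completed S^(r). *)

Lemma comNz_or_trivial (A : comPzRingType) :
  (1 = 0 :> A) \/ exists A' : comNzRingType, A = A' :> comPzRingType.
Proof.
have [->|n10] := eqVneq (1 : A) 0; first by left.
right; pose N := GRing.PzSemiRing_isNonZero.Build A n10.
pose A' : comNzRingType := HB.pack_for comNzRingType A N; exists A'.
(* Once the structure is destructed both sides are the same record by conversion. Having an
   equality, not an isomorphism, allows rewriting inside statements about A. *)
case: A n10 @N @A' => T [] *; reflexivity.
Qed.

Module MonoidAdjoin1.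
Import monalg.
Section Def.
Variable A : comPzRingType.
(* The multiplicative monoid of [A] with a new unit [None]: the monoids of
   [monalg] must have no invertible element besides 1. *)
Definition adj1 := option A.
HB.instance Definition _ := Choice.on adj1.
Implicit Types x y z : adj1.
Definition adj1_mul x y : adj1 :=
  if x is Some a then if y is Some b then Some (a * b) else x else y.
Lemma adj1_mulA : associative adj1_mul.
Proof. by move=> [a|] [b|] [c|] //=; rewrite mulrA. Qed.
Lemma adj1_mulC : commutative adj1_mul.
Proof. by move=> [a|] [b|] //=; rewrite mulrC. Qed.
Lemma adj1_mul1m : left_id None adj1_mul.
Proof. by move=> [a|]. Qed.
Lemma adj1_mulm1 : right_id None adj1_mul.
Proof. by move=> [a|]. Qed.
Lemma adj1_unitm x y : adj1_mul x y = None -> x = None /\ y = None.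
Proof. by case: x y => [a|] [b|]. Qed.
HB.instance Definition _ := Choice_isMonomialDef.Build adj1
  adj1_mulA adj1_mul1m adj1_mulm1 adj1_unitm.
HB.instance Definition _ := MonomialDef_isConomialDef.Build adj1 adj1_mulC.
End Def.

Section Eval.
Variable A : comNzRingType.
Definition adj1_eval (x : adj1 A) : A := odflt 1 x.
Lemma adj1_eval_mmorphism : mmorphism adj1_eval.
Proof. by split=> // -[a|] [b|] //=; rewrite /adj1_eval /= ?mulr1 ?mul1r. Qed.
HB.instance Definition _ := isMultiplicative.Build (adj1 A) A adj1_eval
  adj1_eval_mmorphism.
End Eval.

(** The integral monoid algebra of the multiplicative monoid of A is free over Z, and evaluation
    maps it onto A. *)
Lemma torsionfree_cover_nz (A : comNzRingType) :
  exists (L : comPzRingType) (f : {rmorphism L -> A}) (s : A -> L),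
    (forall a, f (s a) = a) /\
    (forall n (x : L), (0 < n)%N -> n%:R * x = 0 -> x = 0).
Proof.
exists (malg (adj1 A) int : comPzRingType).
exists (mmap (intr : {rmorphism int -> A}) (@adj1_eval A)).
exists (fun a => mkmalgU (Some a : adj1 A) (1 : int)); split=> [a|n x n_gt0].
  by apply: (etrans (mmapU _ _)); rewrite /= mul1r.
rewrite mulr_natl => nx; apply/malgP => k; have := congr1 (mcoeff k) nx.
rewrite raddfMn raddf0 => /eqP.
by rewrite mulrn_eq0 eqn0Ngt n_gt0 => /eqP.
Qed.
End MonoidAdjoin1.

(** Witt vector identities are natural in the ring, so they can be checked on a torsion-free cover,
    where the ghost components determine the coordinates. A section of sets suffices to lift
    sequences. *)
Lemma torsionfree_cover (A : comPzRingType) :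
  exists (L : comPzRingType) (f : {rmorphism L -> A}) (s : A -> L),
    (forall a, f (s a) = a) /\
    (forall n (x : L), (0 < n)%N -> n%:R * x = 0 -> x = 0).
Proof.
have [A0|[A' ->]] := comNz_or_trivial A; last exact: MonoidAdjoin1.torsionfree_cover_nz.
have z (x : A) : x = 0 by rewrite -[x]mul1r A0 mul0r.
pose f (x : int) : A := 0.
have fD : {morph f : x y / x - y} by move=> x y; rewrite /f subr0.
have fM : monoid_morphism f by split=> [|x y]; rewrite /f ?mulr0 ?[1]z.
pose F : {rmorphism int -> A} := HB.pack f (GRing.isZmodMorphism.Build _ _ f fD)
  (GRing.isMonoidMorphism.Build _ _ f fM).
exists int, F, (fun=> 0); split=> [a|n x n_gt0]; first by rewrite [a]z [LHS]z.
by move=> /eqP; rewrite mulf_eq0 pnatr_eq0 eqn0Ngt n_gt0 => /eqP.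
Qed.

(** * Bundling functions into morphisms; divisibility *)

Definition additive_of (A B : zmodType) (f : A -> B)
  (fB : {morph f : x y / x - y}) : {additive A -> B} :=
  HB.pack f (GRing.isZmodMorphism.Build A B f fB).

(** Transparent, so that the underlying function is recovered by computation. *)
Definition additive_ofD (A B : zmodType) (f : A -> B)
    (fD : {morph f : x y / x + y}) : {additive A -> B}.
Proof.
apply: (@additive_of _ _ f) => x y.
by apply: (addIr (f y)); rewrite -fD !subrK.
Defined.

Definition nmod_additive_of (A B : nmodType) (f : A -> B) (f0 : f 0 = 0)
  (fD : {morph f : x y / x + y}) : {additive A -> B} :=
  HB.pack f (GRing.isNmodMorphism.Build A B f (f0, fD)).

Definition linear_of (R : pzRingType) (M N : lmodType R) (f : M -> N)
  (fD : {morph f : x y / x + y}) (fZ : forall a x, f (a *: x) = a *: f x) :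
    {linear M -> N} :=
  HB.pack f (GRing.isScalable.Build R M N *:%R f fZ) (GRing.isZmodMorphism.Build M N f (raddfB (additive_ofD fD))).

Definition rmorphism_of (A B : pzRingType) (f : A -> B)
  (fB : {morph f : x y / x - y}) (f1 : f 1 = 1) (fM : {morph f : x y / x * y}) :
    {rmorphism A -> B} :=
  HB.pack f (GRing.isMonoidMorphism.Build A B f (f1, fM)) (GRing.isZmodMorphism.Build A B f fB).

Definition nat_torsionfree (A : pzRingType) :=
  forall n (x : A), (0 < n)%N -> n%:R * x = 0 -> x = 0.

Lemma mult_of0 (A : comPzRingType) (c : A) : mult_of c 0.
Proof. by exists 0; rewrite mulr0. Qed.

Lemma mult_ofD (A : comPzRingType) (c x y : A) :
  mult_of c x -> mult_of c y -> mult_of c (x + y).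
Proof. by move=> [a ->] [b ->]; exists (a + b); rewrite mulrDr. Qed.

Lemma mult_ofN (A : comPzRingType) (c x : A) : mult_of c x -> mult_of c (- x).
Proof. by move=> [a ->]; exists (- a); rewrite mulrN. Qed.

Lemma mult_ofB (A : comPzRingType) (c x y : A) :
  mult_of c x -> mult_of c y -> mult_of c (x - y).
Proof. by move=> cx cy; apply: mult_ofD => //; apply: mult_ofN. Qed.

Lemma mult_ofMr (A : comPzRingType) (c x y : A) : mult_of c x -> mult_of c (x * y).
Proof. by move=> [a ->]; exists (a * y); rewrite mulrA. Qed.

Lemma mult_ofMl (A : comPzRingType) (c x y : A) : mult_of c y -> mult_of c (x * y).
Proof. by rewrite mulrC; apply: mult_ofMr. Qed.

Lemma mult_of_trans (A : comPzRingType) (b c x : A) :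
  mult_of b c -> mult_of c x -> mult_of b x.
Proof. by move=> [d ->] [e ->]; exists (d * e); rewrite mulrA. Qed.

Lemma mult_ofM2l (A : comPzRingType) (b c x : A) :
  mult_of c x -> mult_of (b * c) (b * x).
Proof. by move=> [d ->]; exists d; rewrite mulrA. Qed.

Lemma mult_of_sum (A : comPzRingType) (c : A) (I : Type) (r : seq I)
    (P : pred I) (F : I -> A) :
  (forall i, P i -> mult_of c (F i)) -> mult_of c (\sum_(i <- r | P i) F i).
Proof.
by move=> cF; elim/big_ind: _ => // [|x y]; [apply: mult_of0 | apply: mult_ofD].
Qed.

Lemma mult_of_exp (A : comPzRingType) (c : A) m n :
  (m <= n)%N -> mult_of (c ^+ m) (c ^+ n).
Proof. by move=> /subnKC <-; rewrite exprD; exists (c ^+ (n - m)). Qed.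

Lemma mult_of_rmorph (A B : comPzRingType) (f : {rmorphism A -> B}) c x :
  mult_of c x -> mult_of (f c) (f x).
Proof. by move=> [y ->]; exists (f y); rewrite rmorphM. Qed.

Lemma mult_of_subX (A : comPzRingType) (c x y : A) n :
  mult_of c (x - y) -> mult_of c (x ^+ n - y ^+ n).
Proof. by rewrite subrXX; apply: mult_ofMr. Qed.

(** The second factor of x^p - y^p = (x - y) sum_i x^(p-1-i) y^i is congruent to p x^(p-1) modulo p,
    hence divisible by p. *)
Lemma mult_of_natX (A : comPzRingType) p k (x y : A) : (0 < k)%N ->
  prime p -> mult_of (p%:R ^+ k) (x - y) ->
  mult_of (p%:R ^+ k.+1) (x ^+ p - y ^+ p).
Proof.
move=> k0 pr [z xy]; rewrite subrXX xy exprSr -!mulrA.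
apply: mult_ofM2l; apply: mult_ofMl.
suff : mult_of p%:R (\sum_(i < p) x ^+ (p.-1 - i) * y ^+ i - p%:R * x ^+ p.-1).
  by move=> [t /eqP]; rewrite subr_eq => /eqP ->; apply: mult_ofD;
    [exists t | exists (x ^+ p.-1)].
have -> : p%:R * x ^+ p.-1 = \sum_(i < p) x ^+ (p.-1 - i) * x ^+ i.
  rewrite (eq_bigr (fun=> x ^+ p.-1)) => [|i _].
    by rewrite sumr_const card_ord mulr_natl.
  by rewrite -exprD subnK // -ltnS (ltn_predK (prime_gt1 pr)).
rewrite -sumrB; apply: mult_of_sum => i _; rewrite -mulrBr; apply: mult_ofMl.
rewrite -opprB; apply: mult_ofN; apply: mult_of_subX; rewrite xy.
by apply: mult_ofMr; rewrite -[X in mult_of X _]expr1; apply: mult_of_exp.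
Qed.

Lemma mult_of_expXX (A : comPzRingType) p (x y : A) n : prime p ->
  mult_of p%:R (x - y) ->
  mult_of (p%:R ^+ n.+1) (x ^+ (p ^ n) - y ^+ (p ^ n)).
Proof.
move=> pr xy; elim: n => [|n IH]; first by rewrite expn0 !expr1.
by rewrite expnSr !exprM; apply: mult_of_natX.
Qed.

Section WittOperations.
Variables (p : nat) (p_prime : prime p).
Let p_gt0 := prime_gt0 p_prime.

Lemma ghostS (A : comPzRingType) n (x : nat -> A) :
  ghost p n x = \sum_(i < n) p%:R ^+ i * x i ^+ (p ^ (n - i)) + p%:R ^+ n * x n.
Proof. by rewrite /ghost big_ord_recr /= subnn expn0 expr1. Qed.

Lemma torsionfree_expI (A : pzRingType) n (x : A) : nat_torsionfree A ->
  p%:R ^+ n * x = 0 -> x = 0.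
Proof. by move=> tf; rewrite -natrX; apply: tf; rewrite expn_gt0 p_gt0. Qed.

Lemma ghost_inj (A : comPzRingType) N (x y : nat -> A) : nat_torsionfree A ->
  (forall n, (n < N)%N -> ghost p n x = ghost p n y) ->
  forall n, (n < N)%N -> x n = y n.
Proof.
move=> tf gxy n; elim/ltn_ind: n => n IH ltnN; apply/eqP; rewrite -subr_eq0.
apply/eqP/(torsionfree_expI (n := n)) => //; apply/eqP; rewrite mulrBr subr_eq0.
have := gxy n ltnN; rewrite !ghostS => /eqP.
rewrite (eq_bigr (fun i : 'I_n => p%:R ^+ i * y i ^+ (p ^ (n - i)))) ?(inj_eq (addrI _)) //.
by move=> i _; rewrite IH // (ltn_trans _ ltnN).
Qed.

(** By induction the terms p^i x_i^(p^(n-i)) with i < n agree modulo p^(n+1), which leaves p^n (x_n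
    - y_n) divisible by p^(n+1). *)
Lemma ghost_congr (A : comPzRingType) (x y : nat -> A) : nat_torsionfree A ->
  (forall n, mult_of (p%:R ^+ n.+1) (ghost p n x - ghost p n y)) ->
  forall n, mult_of p%:R (x n - y n).
Proof.
move=> tf gxy n; elim/ltn_ind: n => n IH.
have : mult_of (p%:R ^+ n.+1) (p%:R ^+ n * (x n - y n)).
  have := gxy n; rewrite !ghostS opprD addrACA -sumrB -mulrBr.
  set s := \sum_(i < n) _ => H.
  have {H} := mult_ofB H (_ : mult_of (p%:R ^+ n.+1) s).
  rewrite addrAC subrr add0r; apply; apply: mult_of_sum => i _; rewrite -mulrBr.
  have -> : n.+1 = (i + (n - i).+1)%N by rewrite addnS subnKC // ltnW.
  by rewrite exprD; apply: mult_ofM2l; apply: mult_of_expXX => //; apply: IH.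
move=> [z]; rewrite exprSr -mulrA => /eqP; rewrite -subr_eq0 -mulrBr => /eqP.
by move/(torsionfree_expI tf)/eqP; rewrite subr_eq0 => /eqP ->; exists z.
Qed.

Variables add mul :
  forall A : comPzRingType, (nat -> A) -> (nat -> A) -> nat -> A.
Hypothesis opP : witt_operations p add mul.

Lemma comp_section (A L : comPzRingType) (f : {rmorphism L -> A}) (s : A -> L) :
  cancel s f -> forall x : nat -> A, f \o (s \o x) = x.
Proof. by move=> fs x; apply: functional_extensionality => i /=. Qed.

(** On a torsion-free cover the coordinates below N are determined by the ghost components below N,
    which only involve coordinates below N of the summands. *)
Lemma witt_add_trunc (A : comPzRingType) N (x x' y y' : nat -> A) :
  (forall n, (n < N)%N -> x n = x' n) -> (forall n, (n < N)%N -> y n = y' n) ->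
  forall n, (n < N)%N -> add x y n = add x' y' n.
Proof.
move=> xx' yy' n ltnN; have [addN _ addG _] := opP.
have [L [f [s [fs tf]]]] := torsionfree_cover A.
have fsx := comp_section fs.
rewrite -[x]fsx -[y]fsx -[x']fsx -[y']fsx -!addN; congr (f _).
apply: (ghost_inj (N := N)) ltnN => // k ltkN; rewrite !addG.
by congr (_ + _); apply: eq_bigr => i _; rewrite /= ?xx' ?yy' //;
  apply: leq_trans ltkN.
Qed.

Definition witt_teich (A : comPzRingType) (a : A) (n : nat) : A :=
  if n is 0%N then a else 0.

Lemma ghost_teich (A : comPzRingType) (a : A) n :
  ghost p n (witt_teich a) = a ^+ (p ^ n).
Proof.
rewrite /ghost big_ord_recl big1 ?addr0 /= ?subn0 ?mul1r // => i _.
by rewrite expr0n expn_eq0 eqn0Ngt p_gt0 mulr0.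
Qed.

Lemma ghost0 (A : comPzRingType) n : ghost p n (fun=> 0 : A) = 0.
Proof.
by rewrite /ghost big1 // => i _; rewrite expr0n expn_eq0 eqn0Ngt p_gt0 mulr0.
Qed.

Lemma witt_add0 (A : comPzRingType) :
  add (fun=> 0 : A) (fun=> 0) =1 (fun=> 0).
Proof.
have [addN _ addG _] := opP.
have [L [f [s [fs tf]]]] := torsionfree_cover A => n.
have -> : (fun=> 0 : A) = f \o ((fun=> 0) : nat -> L).
  by apply: functional_extensionality => i /=; rewrite rmorph0.
rewrite -addN /= -[RHS](rmorph0 f); congr (f _).
apply: (ghost_inj (N := n.+1) (y := fun=> 0)) (ltnSn n) => // k _.
by rewrite addG ghost0 addr0.
Qed.

(* p = VF in characteristic p. *)
Lemma witt_mulp (A : comPzRingType) (x : nat -> A) : p%:R = 0 :> A ->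
  iter p.-1 (add x) x =1 (fun n => if n is m.+1 then x m ^+ p else 0).
Proof.
move=> p0; have [addN _ addG _] := opP.
have [L [f [s [fs tf]]]] := torsionfree_cover A => n.
rewrite -[x](comp_section fs); set y := s \o x.
have -> k : iter k (add (f \o y)) (f \o y) = f \o iter k (add y) y.
  elim: k => //= k ->; apply: functional_extensionality => i /=.
  by rewrite addN.
(* VF applied to the lift y. Its m-th ghost component differs from that of p y by p^(m+1) y_m, so
   [ghost_congr] identifies the two vectors modulo p. *)
pose z n := if n is m.+1 then y m ^+ p else 0.
have gp k m : ghost p m (iter k (add y) y) = ghost p m y *+ k.+1.
  by elim: k => [|k IH] //=; rewrite addG IH -mulrS.
have [m|w /(congr1 f)] := @ghost_congr _ (iter p.-1 (add y) y) z tf _ n; last first.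
  rewrite rmorphM rmorph_nat p0 mul0r rmorphB => /eqP; rewrite subr_eq0 => /eqP.
  by move=> /= ->; case: (n) => [|i] /=; rewrite ?rmorph0 ?rmorphXn.
rewrite gp prednK // -(mulr_natl (ghost p m y)) ghostS /ghost big_ord_recl /= expr0n.
rewrite expn_eq0 eqn0Ngt p_gt0 mulr0 add0r.
rewrite mulrDr addrAC mulr_sumr.
rewrite [X in X - _](_ : _ = \sum_(i < m) p%:R ^+ bump 0 i * (y i ^+ p) ^+ (p ^ (m - bump 0 i))).
  by rewrite subrr add0r mulrA -exprS; exists (y m).
apply: eq_bigr => i _; rewrite /bump /= add1n exprS -mulrA -exprM -expnS.
by rewrite subnS prednK // subn_gt0.
Qed.

End WittOperations.

(** * Completeness and successive approximation *)

Definition padic_separated (p : nat) (A : comPzRingType) :=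
  forall x : A, (forall n, mult_of (p%:R ^+ n) x) -> x = 0.

Definition padic_complete (p : nat) (A : comPzRingType) :=
  forall a : nat -> A, padic_compatible p a ->
    exists x, forall n, mult_of (p%:R ^+ n) (x - a n).

Lemma additive_natX (A B : pzRingType) (h : {additive A -> B}) p n x :
  h (p%:R ^+ n * x) = p%:R ^+ n * h x.
Proof. by rewrite -!natrX !mulr_natl raddfMn. Qed.

Lemma additive_mult_of (A B : comPzRingType) (h : {additive A -> B}) p n x :
  mult_of (p%:R ^+ n) x -> mult_of (p%:R ^+ n) (h x).
Proof. by move=> [y ->]; exists (h y); rewrite additive_natX. Qed.

(** Solving modulo p is enough when the remainder, divided by p, satisfies [K] again: the solutions
    are the digits of a convergent series. It yields surjectivity and the kernel of theta, and
    inverses of 1 + p s in Z_p. *)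
Lemma padic_successive_approx (p : nat) (A B : comPzRingType)
    (h : {additive A -> B}) (K : B -> Prop) :
  padic_complete p A -> padic_separated p B ->
  (forall y, K y -> exists x y', K y' /\ y = h x + p%:R * y') ->
  forall y, K y -> exists x, y = h x.
Proof.
move=> Ac Bs step y0 Ky0.
have step' (y : {y | K y}) : {xy : A * {y | K y} | sval y = h xy.1 + p%:R * sval xy.2}.
  apply: constructive_indefinite_description.
  by have [x [y' [Ky' e]]] := step _ (svalP y); exists (x, exist _ y' Ky').
pose u := fix u n := if n is m.+1 then (sval (step' (u m))).2 else exist _ y0 Ky0.
pose a n := (sval (step' (u n))).1.
have ua n : sval (u n) = h (a n) + p%:R * sval (u n.+1) := svalP (step' (u n)).
pose s n := \sum_(i < n) p%:R ^+ i * a i.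
have ys n : y0 = h (s n) + p%:R ^+ n * sval (u n).
  elim: n => [|n IH]; first by rewrite /s big_ord0 raddf0 mul1r add0r.
  rewrite [LHS]IH ua /s big_ord_recr /= raddfD additive_natX mulrDr addrA.
  by rewrite mulrA -exprSr.
have [n|x xs] := Ac s; first by rewrite /s big_ord_recr /= addrAC subrr add0r; exists (a n).
exists x; apply/eqP; rewrite -subr_eq0; apply/eqP/Bs => n.
rewrite {1}(ys n) addrAC -raddfB; apply: mult_ofD; last by eexists.
by apply: additive_mult_of; rewrite -opprB; apply: mult_ofN.
Qed.

Section WittRing.
Variables (p : nat) (A W : comPzRingType) (co : W -> nat -> A).
Hypotheses (p_prime : prime p) (WP : is_witt_ring p co).
Hypotheses (A_p : p%:R = 0 :> A) (A_perfect : forall x : A, exists y, y ^+ p = x).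
Hypothesis A_reduced : forall x : A, x ^+ p = 0 -> x = 0.

Lemma witt_coord_inj v w : co v =1 co w -> v = w.
Proof.
have [/(_ (co w))[w' _ uniq] _] := WP.
by move=> vw; rewrite (uniq v vw) (uniq w).
Qed.

Lemma witt_coord_ex (x : nat -> A) : exists w, co w =1 x.
Proof. by have [/(_ x)[w wx _] _] := WP; exists w. Qed.

Lemma witt_coord_trunc N v v' w w' :
  (forall n, (n < N)%N -> co v n = co v' n) ->
  (forall n, (n < N)%N -> co w n = co w' n) ->
  forall n, (n < N)%N -> co (v + w) n = co (v' + w') n.
Proof.
have [_ [add [mul [opP addE _]]]] := WP => vv' ww' n ltnN.
by rewrite !addE; apply: (witt_add_trunc p_prime opP) ltnN.
Qed.

(** The definition of a Witt ring does not name its zero; the vector z of zero coordinates satisfies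
    z + z = z, which characterises it. *)
Lemma witt_coord0 n : co 0 n = 0.
Proof.
have [_ [add [mul [opP addE _]]]] := WP.
have [z zE] := witt_coord_ex (fun=> 0); suff -> : 0 = z by [].
apply: (addrI z); rewrite addr0; apply: witt_coord_inj => m.
rewrite addE (functional_extensionality _ _ zE).
by rewrite (witt_add0 p_prime opP).
Qed.

Lemma witt_coord_subr0 N v w : (forall n, (n < N)%N -> co v n = co w n) ->
  forall n, (n < N)%N -> co (v - w) n = 0.
Proof.
move=> vw n ltnN; rewrite -(witt_coord0 n) -(subrr w).
exact: (witt_coord_trunc (N := N)).
Qed.

Lemma witt_coord0D v w : co (v + w) 0%N = co v 0%N + co w 0%N.
Proof.
have [_ [add [mul [opP addE _]]]] := WP; have [_ _ addG _] := opP.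
have := addG A (co v) (co w) 0%N.
by rewrite /ghost !big_ord1 !expr0 !subnn !expn0 !mul1r !expr1 addE.
Qed.

Lemma witt_coord0M v w : co (v * w) 0%N = co v 0%N * co w 0%N.
Proof.
have [_ [add [mul [opP _ mulE]]]] := WP; have [_ _ _ mulG] := opP.
have := mulG A (co v) (co w) 0%N.
by rewrite /ghost !big_ord1 !expr0 !subnn !expn0 !mul1r !expr1 mulE.
Qed.

Lemma witt_coord_mulp w n :
  co (p%:R * w) n = if n is m.+1 then co w m ^+ p else 0.
Proof.
have [_ [add [mul [opP addE _]]]] := WP.
rewrite mulr_natl -(witt_mulp p_prime opP (co w) A_p).
rewrite -{1}(prednK (prime_gt0 p_prime)).
suff -> k : co (w *+ k.+1) = iter k (add A (co w)) (co w) by [].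
elim: k => [|k IH] //=; rewrite -IH; apply: functional_extensionality => i.
by rewrite mulrS addE.
Qed.

Lemma witt_natX_coord N w n : (n < N)%N -> co (p%:R ^+ N * w) n = 0.
Proof.
elim: N n => // N IH n ltnN; rewrite exprS -mulrA witt_coord_mulp.
case: n ltnN => // n /IH ->.
by rewrite expr0n -(prednK (prime_gt0 p_prime)).
Qed.

(** Perfectness provides p-th roots of the shifted coordinates, and these are the coordinates of
    w/p; reducedness makes the lower ones vanish again. *)
Lemma witt_coord_natX N w :
  (forall n, (n < N)%N -> co w n = 0) -> mult_of (p%:R ^+ N) w.
Proof.
elim: N w => [|N IH] w w0; first by exists w; rewrite mul1r.
have root n : {y | y ^+ p = co w n.+1}.
  exact: constructive_indefinite_description.
have [v vE] := witt_coord_ex (fun n => sval (root n)).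
have -> : w = p%:R * v.
  apply: witt_coord_inj => n; rewrite witt_coord_mulp; case: n => [|n].
    exact: w0.
  by rewrite vE (svalP (root n)).
rewrite exprS; apply: mult_ofM2l; apply: IH => n ltnN; apply: A_reduced.
by rewrite vE (svalP (root n)) w0.
Qed.

Lemma witt_torsionfree (w : W) : p%:R * w = 0 -> w = 0.
Proof.
move=> pw; apply: witt_coord_inj => n; rewrite witt_coord0; apply: A_reduced.
by rewrite -(witt_coord0 n.+1) -pw witt_coord_mulp.
Qed.

Lemma witt_separated : padic_separated p W.
Proof.
move=> w wn; apply: witt_coord_inj => n; rewrite witt_coord0.
by have [v ->] := wn n.+1; rewrite witt_natX_coord.
Qed.

Lemma witt_complete : padic_complete p W.
Proof.
(* Adding a multiple of p^n leaves the coordinates below n unchanged, so the i-th coordinate is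
   stationary from the term of index i + 1 on. *)
move=> s sc; have [x xE] := witt_coord_ex (fun i => co (s i.+1) i).
have stable n m i : (i < n)%N -> (n <= m)%N -> co (s m) i = co (s n) i.
  move=> lt_i_n /subnKC <-; elim: (m - n)%N => [|k IH]; first by rewrite addn0.
  rewrite addnS -IH; have [z sz] := sc (n + k)%N.
  have -> : s (n + k).+1 = s (n + k)%N + p%:R ^+ (n + k) * z by rewrite -sz addrC subrK.
  rewrite -[s (n + k)%N in RHS]addr0; apply: (witt_coord_trunc (N := n)) => // j ltjn.
  by rewrite witt_coord0 witt_natX_coord // ltn_addr.
exists x => n; apply: witt_coord_natX; apply: witt_coord_subr0 => i ltin.
by rewrite xE; symmetry; apply: stable.
Qed.

Lemma witt_teichmuller : exists t : A -> W,
  (forall a, co (t a) 0%N = a) /\ (forall a n, co (t a) n = witt_teich a n).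
Proof.
have t a : {w | co w =1 witt_teich a}.
  exact/constructive_indefinite_description/witt_coord_ex.
by exists (fun a => sval (t a)); split=> a; [rewrite (svalP (t a)) | exact: (svalP (t a))].
Qed.

Section Theta.
Variables (C : comPzRingType) (th : {rmorphism W -> C}) (v : W).
Hypotheses (C_tf : forall x : C, p%:R * x = 0 -> x = 0).
Hypothesis C_sep : padic_separated p C.
Hypothesis th_dense : forall c, exists w, mult_of p%:R (c - th w).
Hypothesis th_v : th v = 0.
Hypothesis v_ker : forall w, th w = 0 -> mult_of (co v 0%N) (co w 0%N).
Hypothesis v_reg : forall a, co v 0%N * a = 0 -> a = 0.

Lemma theta_surj c : exists w, th w = c.
Proof.
have step y : True -> exists w y', True /\ y = th w + p%:R * y'.
  by move=> _; have [w [y' e]] := th_dense y; exists w, y'; split=> //; rewrite -e addrC subrK.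
have [w ->] := padic_successive_approx (h := th) (K := fun=> True) witt_complete C_sep step (y := c) I.
by exists w.
Qed.

(** Modulo p a kernel element is v times a Teichmüller lift; the difference is p z, and z is again
    in the kernel as C has no p-torsion. Iteration converges. *)
Lemma theta_ker w : th w = 0 -> mult_of v w.
Proof.
pose mv x := v * x.
pose h : {additive W -> W} := HB.pack mv (GRing.isZmodMorphism.Build _ _ mv (mulrBr v)).
move=> thw; suff step y : th y = 0 -> exists x y', th y' = 0 /\ y = h x + p%:R * y'.
  have [x ->] := padic_successive_approx (K := fun w => th w = 0) witt_complete witt_separated step thw.
  by exists x.
move=> yth; have [a ya] := v_ker yth; have [t [t0 _]] := witt_teichmuller.
have [|z yz] := @witt_coord_natX 1 (y - v * t a).
  by apply: witt_coord_subr0 => -[|//] _; rewrite witt_coord0M t0.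
exists (t a), z; split; last by rewrite -[p%:R]expr1 -yz /= addrC subrK.
by apply: C_tf; rewrite -(rmorph_nat th) -rmorphM -[p%:R]expr1 -yz rmorphB rmorphM th_v mul0r subr0.
Qed.

(** An element killed by v has zero 0-th coordinate, hence is divisible by p, and the quotient is
    still killed by v; so it is divisible by every power of p. *)
Lemma theta_gen_reg (w : W) : v * w = 0 -> w = 0.
Proof.
move=> vw; suff H n : exists w', w = p%:R ^+ n * w' /\ v * w' = 0.
  by apply: witt_separated => n; have [w' [-> _]] := H n; eexists.
elim: n => [|n [w' [-> vw']]]; first by exists w; rewrite mul1r.
have [|z] := @witt_coord_natX 1 w'.
  by move=> -[|//] _; apply: v_reg; rewrite -witt_coord0M vw' witt_coord0.
rewrite expr1 => w'z; exists z; rewrite w'z exprSr mulrA; split=> //.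
by apply: witt_torsionfree; rewrite mulrCA -w'z.
Qed.

End Theta.
End WittRing.

(** * Completions *)

Lemma padic_compatible_sub (p : nat) (A : comPzRingType) (a : nat -> A) m n :
  padic_compatible p a -> (n <= m)%N -> mult_of (p%:R ^+ n) (a m - a n).
Proof.
move=> ac /subnKC <-; elim: (m - n)%N => [|k IH].
  by rewrite addn0 subrr; apply: mult_of0.
rewrite addnS -(subrKA (a (n + k)%N)); apply: mult_ofD => //.
by apply: mult_of_trans (ac _); apply: mult_of_exp; apply: leq_addr.
Qed.

Section Completion.
Variables (p : nat) (A A' : comPzRingType) (c : {rmorphism A -> A'}).

Section Limit.
Variable L : (nat -> A) -> A'.
Hypothesis L_morph : forall a b, padic_compatible p a -> padic_compatible p b ->
  L (fun n => a n + b n) = L a + L b /\ L (fun n => a n * b n) = L a * L b.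
Hypothesis L_surj : forall x, exists2 a, padic_compatible p a & L a = x.
Hypothesis L_eq0 : forall a, padic_compatible p a ->
  (L a = 0 <-> forall n, mult_of (p%:R ^+ n) (a n)).
Hypothesis L_const : forall x, L (fun=> x) = c x.

Lemma padic_compatible_const (x : A) : padic_compatible p (fun=> x).
Proof. by move=> n; rewrite subrr; apply: mult_of0. Qed.

Lemma padic_compatibleM (x : A) a :
  padic_compatible p a -> padic_compatible p (fun n => x * a n).
Proof. by move=> ac n; rewrite -mulrBr; apply: mult_ofMl. Qed.

Lemma padic_compatibleD (a b : nat -> A) :
  padic_compatible p a -> padic_compatible p b ->
  padic_compatible p (fun n => a n + b n).
Proof. by move=> ac bc n; rewrite opprD addrACA; apply: mult_ofD. Qed.

Lemma padic_limM x a : padic_compatible p a -> L (fun n => x * a n) = c x * L a.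
Proof.
by move=> ac; have [_ ->] := L_morph (padic_compatible_const x) ac; rewrite L_const.
Qed.

Lemma padic_limB x a b : padic_compatible p a -> padic_compatible p b ->
  L (fun n => a n + x * b n) = L a + c x * L b.
Proof.
move=> ac bc; have [-> _] := L_morph ac (padic_compatibleM x bc).
by rewrite padic_limM.
Qed.

(** The shifted sequence a_(n+j) is p^n b_j, with b_j the partial sums of a series in powers of p,
    and it has the same limit as a. *)
Lemma padic_lim_mult n a : padic_compatible p a ->
  mult_of (p%:R ^+ n) (a n) -> mult_of (p%:R ^+ n) (L a).
Proof.
move=> ac [b0 ab0].
have zP j : {z | a (n + j).+1 - a (n + j)%N = p%:R ^+ (n + j) * z}.
  exact/constructive_indefinite_description/ac.
pose b j := b0 + \sum_(i < j) p%:R ^+ i * sval (zP i).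
have bc : padic_compatible p b.
  move=> j; rewrite /b big_ord_recr /= addrA [X in X - _]addrC addrK.
  by eexists.
have ab j : a (n + j)%N = p%:R ^+ n * b j.
  rewrite /b; elim: j => [|j IH]; first by rewrite big_ord0 addr0 addn0.
  rewrite big_ord_recr /= addrA mulrDr -IH mulrA -exprD -(svalP (zP j)).
  by rewrite addnS addrC subrK.
have : L (fun j => a j + (- p%:R ^+ n) * b j) = 0.
  have abc : padic_compatible p (fun j => a j + (- p%:R ^+ n) * b j).
    by apply: padic_compatibleD => //; apply: padic_compatibleM.
  apply/(L_eq0 abc) => j.
  rewrite mulNr -ab -opprB; apply: mult_ofN. apply: padic_compatible_sub => //.
  exact: leq_addl.
rewrite padic_limB // rmorphN rmorphXn rmorph_nat mulNr => /eqP.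
by rewrite subr_eq0 => /eqP ->; eexists.
Qed.

Lemma padic_lim_approx n a :
  padic_compatible p a -> mult_of (p%:R ^+ n) (L a - c (a n)).
Proof.
move=> ac; have cc := padic_compatible_const (a n).
have -> : L a - c (a n) = L (fun j => a j + (- 1) * a n).
  by rewrite (padic_limB (- 1) ac cc) L_const rmorphN rmorph1 mulN1r.
apply: padic_lim_mult; last by rewrite mulN1r subrr; apply: mult_of0.
exact: padic_compatibleD ac (padic_compatibleM _ cc).
Qed.

End Limit.

(** The form in which completions are used afterwards, free of the functional [L]: density,
    reflection of divisibility by p^n, separatedness and completeness. *)
Lemma padic_completionP : is_padic_completion p c ->
  [/\ forall n x, exists a, mult_of (p%:R ^+ n) (x - c a),
      forall n a, mult_of (p%:R ^+ n) (c a) -> mult_of (p%:R ^+ n) a,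
      padic_separated p A' & padic_complete p A'].
Proof.
move=> [L [L_morph L_surj L_eq0 L_const]].
have approx := @padic_lim_approx L L_morph L_eq0 L_const.
have dense n x : exists a, mult_of (p%:R ^+ n) (x - c a).
  by have [a ac <-] := L_surj x; exists (a n); apply: approx.
have refl n a : mult_of (p%:R ^+ n) (c a) -> mult_of (p%:R ^+ n) a.
  move=> [y cay]; have [b bc yb] := L_surj y.
  have : L (fun j => a + (- p%:R ^+ n) * b j) = 0.
    rewrite (padic_limB L_morph L_const) ?L_const ?yb //; last exact: padic_compatible_const.
    by rewrite rmorphN rmorphXn rmorph_nat mulNr cay subrr.
  have abc : padic_compatible p (fun j => a + (- p%:R ^+ n) * b j).
    by apply: padic_compatibleD; [exact: padic_compatible_const | exact: padic_compatibleM].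
  move=> /(L_eq0 _ abc)/(_ n) H.
  have := mult_ofD H (_ : mult_of (p%:R ^+ n) (p%:R ^+ n * b n)).
  by rewrite mulNr subrK; apply; exists (b n).
split=> // [x xn | x xc].
  have [a ac ax] := L_surj x; rewrite -ax; apply/(L_eq0 _ ac) => n; apply: refl.
  have := mult_ofB (xn n) (approx n _ ac).
  by rewrite ax subKr.
have aP n : {a | mult_of (p%:R ^+ n) (x n - c a)}.
  exact: constructive_indefinite_description.
pose a n := sval (aP n); have xa n : mult_of (p%:R ^+ n) (x n - c (a n)) := svalP (aP n).
have ac : padic_compatible p a.
  move=> n; apply: refl; rewrite rmorphB.
  have H := mult_ofD (mult_ofB (xc n) (mult_of_trans (mult_of_exp _ (leqnSn n)) (xa n.+1))) (xa n).
  suff <- : x n.+1 - x n - (x n.+1 - c (a n.+1)) + (x n - c (a n)) = c (a n.+1) - c (a n) by [].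
  by rewrite opprB [X in X + _ = _]addrC !subrKA.
exists (L a) => n; rewrite -(subrKA (c (a n))); apply: mult_ofD; first exact: approx.
by rewrite -opprB; apply: mult_ofN.
Qed.

Hypothesis c_dense : forall n x, exists a, mult_of (p%:R ^+ n) (x - c a).
Hypothesis c_refl : forall n a, mult_of (p%:R ^+ n) (c a) -> mult_of (p%:R ^+ n) a.

Lemma completion_torsionfree : padic_separated p A' ->
  (forall x : A, p%:R * x = 0 -> x = 0) -> forall x : A', p%:R * x = 0 -> x = 0.
Proof.
move=> sep tf x px; apply: sep => n; have [a xa] := c_dense n.+1 x.
have : mult_of (p%:R ^+ n) a.
  have : mult_of (p%:R ^+ n.+1) (p%:R * a).
    apply: c_refl; rewrite rmorphM rmorph_nat -[_ * c a]subr0 -px -mulrBr -opprB.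
    by rewrite mulrN; apply: mult_ofN; apply: mult_ofMl.
  rewrite exprS => -[b /eqP]; rewrite -mulrA -subr_eq0 -mulrBr => /eqP/tf/eqP.
  by rewrite subr_eq0 => /eqP ->; exists b.
move=> /(mult_of_rmorph c); rewrite rmorphXn rmorph_nat => ca.
rewrite -[x](subrK (c a)); apply: mult_ofD => //.
exact: mult_of_trans (mult_of_exp _ (leqnSn n)) xa.
Qed.

(** Additive maps commute with p^n and are therefore continuous. The setting is additive because it
    will be applied to coefficient functionals, which are not multiplicative. *)
Lemma completion_ext_uniq (C : comPzRingType) (f g : {additive A' -> C}) :
  padic_separated p C -> (forall a, f (c a) = g (c a)) -> f =1 g.
Proof.
move=> sep fg x; apply/eqP; rewrite -subr_eq0; apply/eqP/sep => n.
have [a xa] := c_dense n x; rewrite -(subrKA (f (c a))) -raddfB.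
apply: mult_ofD; first exact: additive_mult_of.
by rewrite fg -raddfB -opprB raddfN; apply/mult_ofN/additive_mult_of.
Qed.

Lemma completion_ext (C : comPzRingType) (f : {additive A -> C}) :
  padic_separated p C -> padic_complete p C ->
  exists g : {additive A' -> C}, forall a, g (c a) = f a.
Proof.
move=> sep compl.
have aP x n : {a | mult_of (p%:R ^+ n) (x - c a)}.
  exact: constructive_indefinite_description.
pose a x n := sval (aP x n).
have xa x n : mult_of (p%:R ^+ n) (x - c (a x n)) := svalP (aP x n).
have fsub n b b' : mult_of (p%:R ^+ n) (c b - c b') -> mult_of (p%:R ^+ n) (f b - f b').
  by rewrite -rmorphB -raddfB => /c_refl; apply: additive_mult_of.
have gP x : {y | forall n, mult_of (p%:R ^+ n) (y - f (a x n))}.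
  apply: constructive_indefinite_description; apply: compl => n; apply: fsub.
  rewrite -(subrKA x) addrC; apply: mult_ofD => //; rewrite -opprB.
  by apply/mult_ofN/(mult_of_trans (mult_of_exp _ (leqnSn n))).
pose g x := sval (gP x).
have gE x n b : mult_of (p%:R ^+ n) (x - c b) -> mult_of (p%:R ^+ n) (g x - f b).
  move=> xb; rewrite -(subrKA (f (a x n))); apply: mult_ofD.
    exact: (svalP (gP x)).
  apply: fsub; rewrite -(subrKA x) addrC; apply: mult_ofD => //.
  by rewrite -opprB; apply: mult_ofN.
have gB : {morph g : x y / x - y}.
  move=> x y; apply/eqP; rewrite -subr_eq0; apply/eqP/sep => n.
  have [[u xu] [v yv]] := (c_dense n x, c_dense n y).
  have xyuv : mult_of (p%:R ^+ n) (x - y - c (u - v)).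
    suff -> : x - y - c (u - v) = (x - c u) - (y - c v) by apply: mult_ofB.
    by rewrite rmorphB !opprB [LHS]addrACA [RHS]addrACA [- y - _]addrC.
  have := mult_ofB (gE _ _ _ xyuv) (mult_ofB (gE _ _ _ xu) (gE _ _ _ yv)).
  suff -> : g (x - y) - f (u - v) - (g x - f u - (g y - f v)) =
            g (x - y) - (g x - g y) by [].
  rewrite raddfB -[in LHS]addrA -opprD; congr (_ - _).
  by rewrite opprB addrCA !subrKA.
exists (additive_of gB) => b /=.
apply/eqP; rewrite -subr_eq0; apply/eqP/sep => n.
by apply: gE; rewrite subrr; apply: mult_of0.
Qed.

End Completion.

(** * The kernel of theta *)

(** A basis given with its dual basis: coordinates are linear maps and can be carried through
    universal properties. *)
Definition free_on (A : comPzRingType) (M : lmodType A) (I : finType) (e : I -> M)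
    (c : I -> {linear M -> A^o}) : Prop :=
  (forall i j, c i (e j) = (i == j)%:R) /\
  (forall x, x = \sum_i (c i x : A) *: e i).

Definition free_rank1 (A : comPzRingType) (M : lmodType A) (e : M)
    (c : {linear M -> A^o}) : Prop :=
  c e = 1 /\ forall x, x = (c x : A) *: e.

(** If x does not divide y then x = y w, so that y^n = y^n w^n z; either y^n = 0 or w is a unit. The
    zero ring causes the additional cases. *)
Lemma mult_of_antisym_total (A : comPzRingType) :
  (forall x y : A, x * y = 0 -> x = 0 \/ y = 0) ->
  (forall x y : A, mult_of x y \/ mult_of y x) ->
  forall n (x y : A), (0 < n)%N -> mult_of (x ^+ n) (y ^+ n) -> mult_of x y.
Proof.
move=> dom tot n x y n0 [z yxz]; have [//|[w xw]] := tot x y.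
have expf0 (u : A) k : u ^+ k = 0 -> u = 0 \/ (1 = 0 :> A).
  elim: k => [|k IH]; first by rewrite expr0; right.
  by rewrite exprS => /dom[|/IH] //; left.
have triv0 (u : A) : 1 = 0 :> A -> u = 0 by move=> e; rewrite -[u]mul1r e mul0r.
have : y ^+ n * (1 - w ^+ n * z) = 0.
  by rewrite mulrBr mulr1 mulrA -exprMn -xw -yxz subrr.
move=> /dom[/expf0[]|].
- by move=> ->; apply: mult_of0.
- by move=> /(triv0 y) ->; apply: mult_of0.
move=> /eqP; rewrite subr_eq0 => /eqP w1; exists (w ^+ n.-1 * z).
by rewrite xw -!mulrA [w * _]mulrA -exprS prednK // -w1 mulr1.
Qed.

(** * The valuation ring of Kbar *)

Section Base.
Variables (p : nat) (p_prime : prime p) (B : base_field p).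
Let v := @vKbar p B.
Let iota := OKb_Kbar B.

Lemma vKbar1 : v 1 = 0.
Proof.
have := Defs.valM (oner_neq0 (Kbar B)) (oner_neq0 _); rewrite mulr1 => /eqP.
by rewrite -subr_eq0 opprD addNKr oppr_eq0 => /eqP.
Qed.

Lemma vKbarX n x : x != 0 -> v (x ^+ n) = n%:R * v x.
Proof.
move=> x0; elim: n => [|n IH]; first by rewrite expr0 vKbar1 mul0r.
by rewrite exprS /v Defs.valM ?expf_neq0 // -/v IH -natr1 mulrDl mul1r addrC.
Qed.

Lemma vKbarV x : x != 0 -> v x^-1 = - v x.
Proof.
move=> x0; apply/eqP; rewrite -addr_eq0 addrC /v.
by rewrite -Defs.valM ?invr_neq0 // divff // -/v vKbar1.
Qed.

Lemma OKb_inj : injective iota.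
Proof. by have [] := OKb_subring B. Qed.

Lemma OKb_val x : x != 0 -> 0 <= v (iota x).
Proof.
move=> x0; have [_ /(_ (iota x))[_ /(_ (ex_intro _ x erefl))[]]] := OKb_subring B.
  by move/eqP; rewrite -(rmorph0 iota) (inj_eq OKb_inj) (negPf x0).
by [].
Qed.

Lemma OKb_lift y : 0 <= v y -> exists x, iota x = y.
Proof. by move=> y0; have [_ /(_ y)[+ _]] := OKb_subring B; apply; right. Qed.

Lemma OKb_domain (x y : OKb B) : x * y = 0 -> x = 0 \/ y = 0.
Proof.
move=> /(congr1 iota)/eqP; rewrite rmorphM rmorph0 mulf_eq0.
by rewrite -!(rmorph0 iota) !(inj_eq OKb_inj) => /orP[] /eqP; [left | right].
Qed.

Lemma OKb_total (x y : OKb B) : mult_of x y \/ mult_of y x.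
Proof.
have dvd (a b : OKb B) : a != 0 -> b != 0 -> v (iota a) <= v (iota b) -> mult_of a b.
  have nz u : u != 0 -> iota u != 0 by rewrite -(rmorph0 iota) (inj_eq OKb_inj).
  move=> a0 b0 ab; have [|c cE] := @OKb_lift (iota b / iota a).
    by rewrite /v Defs.valM ?invr_neq0 ?nz // -/v vKbarV ?nz // subr_ge0.
  by exists c; apply: OKb_inj; rewrite rmorphM cE mulrC divfK ?nz.
have [->|x0] := eqVneq x 0; first by right; apply: mult_of0.
have [->|y0] := eqVneq y 0; first by left; apply: mult_of0.
by have [xy|/ltW yx] := leP (v (iota x)) (v (iota y)); [left | right]; apply: dvd.
Qed.

Lemma OKb_dvdX n (x y : OKb B) :
  (0 < n)%N -> mult_of (x ^+ n) (y ^+ n) -> mult_of x y.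
Proof. exact: mult_of_antisym_total OKb_domain OKb_total _ _ _. Qed.

Lemma OKb_root n (x : OKb B) : (0 < n)%N -> exists y, y ^+ n = x.
Proof.
move=> n0; have [->|x0] := eqVneq x 0.
  by exists 0; rewrite expr0n eqn0Ngt n0.
have ix0 : iota x != 0 by rewrite -(rmorph0 iota) (inj_eq OKb_inj).
have [r] : exists r, root ('X^n - (iota x)%:P) r.
  by apply/closed_rootP; rewrite size_XnsubC // eqSS -lt0n.
rewrite rootE !hornerE subr_eq0 => /eqP rn.
have r0 : r != 0 by apply: contraNneq ix0 => r0; rewrite -rn r0 expr0n eqn0Ngt n0.
have [|y yr] := @OKb_lift r.
  have := OKb_val x0; rewrite -rn vKbarX //.
  by rewrite pmulr_rge0 // ltr0n.
by exists y; apply: OKb_inj; rewrite rmorphXn yr.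
Qed.

Lemma K_natr_neq0 n : (0 < n)%N -> n%:R != 0 :> fK B.
Proof.
move=> n0; apply/eqP => nK.
by have [q] := natf0_pchar n0 (introT eqP nK); rewrite K_pchar0.
Qed.

Lemma OKb_natr_neq0 n : (0 < n)%N -> n%:R != 0 :> OKb B.
Proof.
move=> n0; rewrite -(inj_eq OKb_inj) rmorph_nat rmorph0.
by rewrite -(rmorph_nat (K_Kbar B)) fmorph_eq0 K_natr_neq0.
Qed.

Lemma OKb_mulI (x y z : OKb B) : x != 0 -> x * y = x * z -> y = z.
Proof.
move=> x0 /eqP; rewrite -subr_eq0 -mulrBr => /eqP/OKb_domain[/eqP|/eqP].
  by rewrite (negPf x0).
by rewrite subr_eq0 => /eqP.
Qed.

Lemma OKb_torsionfree (x : OKb B) : p%:R * x = 0 -> x = 0.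
Proof.
move=> /OKb_domain[/eqP|//].
by rewrite (negPf (OKb_natr_neq0 (prime_gt0 p_prime))).
Qed.

Lemma proot_exp m : (0 < m)%N -> proot B m ^+ m = p%:R.
Proof. by move=> m0; rewrite -[m in proot _ m]muln1 prootM // proot1. Qed.

Lemma proot_neq0 m : (0 < m)%N -> proot B m != 0.
Proof.
move=> m0; apply/eqP => r0; have := OKb_natr_neq0 (prime_gt0 p_prime).
by rewrite -(proot_exp m0) r0 expr0n eqn0Ngt m0 eqxx.
Qed.

End Base.

(** * The tilt, p^flat and theta *)

Section Fontaine.
Variables (p : nat) (p_prime : prime p) (B : base_field p) (T : fontaine B).
Let p_gt0 := prime_gt0 p_prime.
Let q := @OKb_p p B T.
Let pr n := @tilt_pr p B T n.

Lemma OKb_p_eq x y : q x = q y <-> mult_of p%:R (x - y).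
Proof.
have [_ ker] := OKb_pP T; rewrite -ker rmorphB; split; first by move=> ->; rewrite subrr.
by move=> /eqP; rewrite subr_eq0 => /eqP.
Qed.

Lemma OKbp_p0 : p%:R = 0 :> OKbp T.
Proof.
have [_ ker] := OKb_pP T; rewrite -(rmorph_nat (OKb_p T)); apply/ker.
by exists 1; rewrite mulr1.
Qed.

Lemma tilt_inj x y : (forall n, pr n x = pr n y) -> x = y.
Proof.
move=> xy; have [n|z _ uniq] := @tilt_lim _ _ T (fun n => pr n y); first exact: tilt_prX.
by rewrite (uniq x xy) (uniq y).
Qed.

Lemma tilt_p0 : p%:R = 0 :> tilt T.
Proof. by apply: tilt_inj => n; rewrite rmorph_nat rmorph0 OKbp_p0. Qed.

Lemma tilt_perfect (x : tilt T) : exists y, y ^+ p = x.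
Proof.
have [n|y yE _] := @tilt_lim _ _ T (fun n => pr n.+1 x); first exact: tilt_prX.
by exists y; apply: tilt_inj => n; rewrite rmorphXn [pr n y]yE; apply: tilt_prX.
Qed.

Lemma tilt_reduced (x : tilt T) : x ^+ p = 0 -> x = 0.
Proof.
move=> x0; apply: tilt_inj => n.
by rewrite -[LHS]tilt_prX -rmorphXn x0 !rmorph0.
Qed.

Lemma tilt_lift x : exists u : nat -> OKb B,
  (forall n, q (u n) = pr n x) /\ forall n, mult_of p%:R (u n.+1 ^+ p - u n).
Proof.
have [surj _] := OKb_pP T.
have u n : {u | q u = pr n x} by exact/constructive_indefinite_description/surj.
exists (fun n => sval (u n)); split=> n; first exact: (svalP (u n)).
by apply/OKb_p_eq; rewrite rmorphXn !(svalP (u _)); apply: tilt_prX.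
Qed.

Lemma tilt_of_seq (u : nat -> OKb B) : (forall n, mult_of p%:R (u n.+1 ^+ p - u n)) ->
  exists x, forall n, pr n x = q (u n).
Proof.
move=> uc; have [n|x xE _] := @tilt_lim _ _ T (fun n => q (u n)); last by exists x.
by rewrite -rmorphXn; apply/OKb_p_eq.
Qed.

Lemma tilt_pr0_surj a : exists x, pr 0%N x = q a.
Proof.
have r (b : OKb B) : {c | c ^+ p = b}.
  by apply: constructive_indefinite_description; apply: OKb_root.
have [n|x xE] := @tilt_of_seq (fun n => iter n (fun b => sval (r b)) a).
  by rewrite iterS (svalP (r _)) subrr; apply: mult_of0.
by exists x; rewrite xE.
Qed.

Lemma tilt_pflat : exists x, forall n, pr n x = q (proot B (p ^ n)).
Proof.
apply: tilt_of_seq => n; rewrite expnS prootM ?expn_gt0 ?p_gt0 //.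
by rewrite subrr; apply: mult_of0.
Qed.

Lemma tilt_liftX (u : nat -> OKb B) : (forall n, mult_of p%:R (u n.+1 ^+ p - u n)) ->
  forall n, mult_of p%:R (u n ^+ (p ^ n) - u 0%N).
Proof.
move=> uc; elim=> [|n IH]; first by rewrite expr1 subrr; apply: mult_of0.
rewrite -(subrKA (u n ^+ (p ^ n))); apply: mult_ofD => //.
by rewrite expnS exprM; apply: mult_of_subX.
Qed.

Section Pflat.
Variable w : tilt T.
Hypothesis wE : forall n, pr n w = q (proot B (p ^ n)).
Let r n := proot B (p ^ n).

Let r_exp n : r n ^+ (p ^ n) = p%:R.
Proof. by rewrite /r proot_exp // expn_gt0 p_gt0. Qed.

Let r0 n : r n != 0.
Proof. by rewrite /r proot_neq0 // expn_gt0 p_gt0. Qed.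

Let rS n : r n.+1 ^+ p = r n.
Proof. by rewrite /r expnS prootM // expn_gt0 p_gt0. Qed.

(** Cancelling p^(1/p^(n+1)) from a divisibility by p still leaves divisibility by p^(1/p), and one
    p-th power restores p. Here t is r_(n+1)^(p^(n+1)-1), while p^(1/p) is r_(n+1)^(p^n). *)
Let p_div_r n : exists2 t, p%:R = r n.+1 * t & mult_of (r 1%N) t.
Proof.
have rX k m : r (k + m)%N ^+ (p ^ k) = r m.
  by rewrite /r expnD prootM // expn_gt0 p_gt0.
exists (r n.+1 ^+ (p ^ n.+1).-1).
  by rewrite -exprS prednK ?r_exp // expn_gt0 p_gt0.
rewrite -(rX n 1%N) addn1; apply: mult_of_exp.
rewrite -ltnS prednK ?expn_gt0 ?p_gt0 // expnS.
by rewrite ltn_Pmull ?prime_gt1 // expn_gt0 p_gt0.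
Qed.

(* Dividing lifts of the components of [x] by p^(1/p^n) gives [z n] with
   [z n.+1 ^ p] congruent to [z n] only modulo p / p^(1/p^n); this is enough for
   the sequence [z n.+1 ^ p] to be compatible modulo p. *)
Lemma pflat_ker x : pr 0%N x = 0 -> mult_of w x.
Proof.
move=> x0; have [u [uE uc]] := tilt_lift x.
(* u_n^(p^n) is congruent to u_0, hence to 0, modulo p = r_n^(p^n), and p^n-th roots of
   divisibilities exist in a valuation ring. *)
have ru n : mult_of (r n) (u n).
  apply: (@OKb_dvdX p B (p ^ n)); first by rewrite expn_gt0 p_gt0.
  rewrite r_exp -[_ ^+ _](subrK (u 0%N)); apply: mult_ofD; first exact: tilt_liftX.
  by rewrite -[u 0%N]subr0; apply/OKb_p_eq; rewrite uE x0 rmorph0.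
have y n : {y | u n = r n * y} by exact/constructive_indefinite_description/ru.
pose z n := sval (y n); have uz n : u n = r n * z n := svalP (y n).
have zc n : mult_of (r 1%N) (z n.+2 ^+ p - z n.+1).
  have [t pt rt] := p_div_r n; apply: mult_of_trans rt _.
  have [s] := uc n.+1; rewrite !uz exprMn rS -mulrBr pt -mulrA.
  by move/OKb_mulI => ->; [exists s | ].
have [|x' x'E] := @tilt_of_seq (fun n => z n.+1 ^+ p).
  move=> n; have [s zs] := zc n.
  have rp : r 1%N ^+ p = p%:R by rewrite rS /r expn0 proot1.
  have -> : z n.+2 ^+ p = z n.+1 + r 1%N * s by rewrite -zs addrC subrK.
  rewrite exprDn_comm ?[GRing.comm _ _]mulrC //; last exact: mulrC.
  rewrite big_ord_recl subn0 expr0 mulr1 bin0 mulr1n addrAC subrr add0r.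
  (* In the binomial expansion the middle terms are divisible by p through their coefficients, the
     last one through (p^(1/p))^p = p. *)
  apply: mult_of_sum => i _; set j : 'I_p.+1 := lift ord0 i.
  have j0 : (0 < j)%N by rewrite lift0.
  have [ltjp|lepj] := ltnP j p.
    rewrite -[X in mult_of _ X]mulr_natl; apply: mult_ofMr.
    have /dvdnP[k ->] : (p %| 'C(p, j))%N by apply: prime_dvd_bin; rewrite ?j0.
    by exists k%:R; rewrite natrM mulrC.
  have -> : nat_of_ord j = p by apply/eqP; rewrite eqn_leq lepj -ltnS ltn_ord.
  by rewrite exprMn rp subnn binn mulr1n mul1r; eexists.
exists x'; apply: tilt_inj => n; rewrite rmorphM [pr n w]wE [pr n x']x'E -rmorphM -uE.
apply/OKb_p_eq; rewrite -opprB; apply: mult_ofN.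
by have := uc n; rewrite uz exprMn rS.
Qed.

(** p divides p^(1/p^(n+1)) u_(n+1), so p^(1/p) divides u_(n+1), and u_n, congruent to u_(n+1)^p,
    vanishes modulo p. *)
Lemma pflat_reg x : w * x = 0 -> x = 0.
Proof.
move=> wx; have [u [uE uc]] := tilt_lift x.
have ru n : mult_of (r 1%N) (u n.+1).
  have [t pt rt] := p_div_r n; apply: mult_of_trans rt _.
  have : mult_of p%:R (r n.+1 * u n.+1 - 0).
    by apply/OKb_p_eq; rewrite rmorphM uE -wE -rmorphM wx !rmorph0.
  by rewrite subr0 pt => -[s]; rewrite -mulrA => /OKb_mulI ->; [exists s | ].
apply: tilt_inj => n; rewrite rmorph0 -uE -(rmorph0 q); apply/OKb_p_eq.
rewrite subr0 -[u n](subKr (u n.+1 ^+ p)); apply: mult_ofB => //.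
have [s ->] := ru n; rewrite exprMn rS /r expn0 proot1.
by exists (s ^+ p).
Qed.

End Pflat.

Lemma OKb_OCP :
  [/\ forall n x, exists a, mult_of (p%:R ^+ n) (x - OKb_OC B a),
      forall n a, mult_of (p%:R ^+ n) (OKb_OC B a) -> mult_of (p%:R ^+ n) a,
      padic_separated p (OC B) & padic_complete p (OC B)].
Proof. exact: padic_completionP (OC_completion B). Qed.

Lemma OC_torsionfree (x : OC B) : p%:R * x = 0 -> x = 0.
Proof.
have [dense refl sep _] := OKb_OCP.
exact: (completion_torsionfree dense refl sep (@OKb_torsionfree _ p_prime B)).
Qed.

Lemma theta_ghost0 w a : q a = pr 0%N (witt_coord w 0%N) ->
  mult_of p%:R (theta T w - OKb_OC B a).
Proof.
move=> wa; have := @thetaP p B T w 0 (fun=> a).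
rewrite /ghost big_ord1 mul1r subnn expn0 !expr1; apply.
by move=> i; rewrite leqn0 => /eqP ->.
Qed.

Lemma fontaine_generator : exists x : Wtilt T,
  [/\ theta T x = 0, forall w, theta T w = 0 -> mult_of x w,
      forall w, x * w = 0 -> w = 0 & forall c, exists w, theta T w = c].
Proof.
have [w wE] := tilt_pflat.
have WP := Wtilt_witt T; have tp := @tilt_perfect; have tr := @tilt_reduced.
have [t [t0 tn]] := witt_teichmuller WP.
have [dense refl sep _] := OKb_OCP.
(* For each n the lift (p^(1/p^n), 0, ...) of [p^flat] has n-th ghost component exactly p, so theta
   [p^flat] and p agree modulo all p^n. *)
have tw : theta T (t w) = p%:R.
  apply/eqP; rewrite -subr_eq0; apply/eqP/sep => n.
  apply: mult_of_trans (mult_of_exp _ (leqnSn n)) _.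
  have := @thetaP p B T (t w) n (witt_teich (proot B (p ^ n))).
  rewrite (ghost_teich p_prime) proot_exp ?expn_gt0 ?p_gt0 // rmorph_nat; apply.
  by move=> i _; rewrite tn; case: i => [|i] /=; rewrite ?rmorph0 // -[RHS]wE.
pose x : Wtilt T := t w - p%:R.
have x0 : witt_coord x 0%N = w.
  have := witt_coord0D WP x p%:R; rewrite subrK t0 -[p%:R]mulr1.
  by rewrite (witt_coord_mulp p_prime WP tilt_p0) addr0.
have thx : theta T x = 0 by rewrite rmorphB tw rmorph_nat subrr.
have thd c : exists w, mult_of p%:R (c - theta T w).
  have [a ca] := dense 1%N c; have [y yE] := tilt_pr0_surj a.
  exists (t y); rewrite -(subrKA (OKb_OC B a)); apply: mult_ofD => //.
  by rewrite -opprB; apply/mult_ofN/theta_ghost0; rewrite t0.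
(* Modulo p, theta is the 0-th projection of the 0-th coordinate; so ker theta lands in the kernel
   of that projection, which p^flat generates. *)
have thk y : theta T y = 0 -> mult_of (witt_coord x 0%N) (witt_coord y 0%N).
  move=> thy; rewrite x0; apply: pflat_ker => //.
  have [surj _] := OKb_pP T; have [a aE] := surj (pr 0%N (witt_coord y 0%N)).
  rewrite -aE -(rmorph0 q); apply/OKb_p_eq; rewrite subr0 -[p%:R]expr1.
  apply: refl; rewrite expr1.
  suff -> : OKb_OC B a = - (theta T y - OKb_OC B a) by apply/mult_ofN/theta_ghost0.
  by rewrite thy sub0r opprK.
exists x; split=> // [y|y|c].
- exact: (theta_ker p_prime WP tilt_p0 tp tr OC_torsionfree thx thk).
- by apply: (theta_gen_reg p_prime WP tilt_p0 tp tr) => a; rewrite x0; apply: pflat_reg.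
exact: (theta_surj p_prime WP tilt_p0 tp tr sep thd).
Qed.

(** With x a generator of ker theta, the module is (x)/(x^2). If theta(w) kills the class of x, then
    x^2 divides w x, so x divides w by regularity and theta(w) = 0. *)
Lemma xiOC_free : exists x0 : xiOC T,
  (forall x, exists a, x = a *: x0) /\ (forall a, a *: x0 = 0 -> a = 0).
Proof.
have [x [thx xker xreg thsurj]] := fontaine_generator.
have [A2surj A2ker] := A2P T.
have [x0 x0E] : exists x0, @xiOC_A2 _ _ T x0 = W_A2 T x.
  by apply/xiOC_ker; rewrite theta2E.
have scale w : xiOC_A2 T (theta T w *: x0) = W_A2 T (w * x).
  by rewrite -theta2E xiOC_scale x0E rmorphM.
exists x0; split=> [y|a ax].
  have [w wE] := A2surj (xiOC_A2 T y).
  have [|u wu] := xker w.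
    by rewrite -theta2E wE; apply/xiOC_ker; exists y.
  by exists (theta T u); apply: xiOC_inj; rewrite scale -wE wu mulrC.
have [w wa] := thsurj a; have : W_A2 T (w * x) = 0 by rewrite -scale wa ax raddf0.
move=> /A2ker[n [b [c [bK cK wE]]]].
have [s sE] : mult_of (x * x) (w * x).
  rewrite wE; apply: mult_of_sum => i _.
  have [[b' ->] [c' ->]] := (xker _ (bK i), xker _ (cK i)).
  by rewrite mulrACA; eexists.
rewrite -wa; suff -> : w = x * s by rewrite rmorphM thx mul0r.
apply/eqP; rewrite -subr_eq0; apply/eqP/xreg; apply/eqP.
by rewrite mulrBr subr_eq0 mulrC sE mulrA.
Qed.

(** The basis of the dual is the coordinate functional of a generator of [xiOC]; its own coordinate
    is evaluation at that generator. *)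
Lemma xiD_free : exists (e : xiD T) (c : {linear xiD T -> (OC B)^o}), free_rank1 e c.
Proof.
have [x0 [gen free]] := xiOC_free.
have aP x : {a | x = a *: x0} by exact/constructive_indefinite_description/gen.
have inj a b : a *: x0 = b *: x0 -> a = b.
  by move=> /eqP; rewrite -subr_eq0 -scalerBl => /eqP/free/eqP; rewrite subr_eq0 => /eqP.
pose f x : (OC B)^o := sval (aP x).
have fE x : x = f x *: x0 := svalP (aP x).
have fD : {morph f : x y / x + y}.
  by move=> x y; apply: inj; rewrite scalerDl -!fE.
have fZ a x : f (a *: x) = a *: f x.
  by apply: inj; rewrite -fE {1}[x]fE scalerA.
have [evl evr evu] := xiDP T.
have [e eE _] := evu (linear_of fD fZ).
pose c d : (OC B)^o := xi_ev d x0.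
have cD : {morph c : x y / x + y} by move=> x y; have [+ _] := evr x0; apply.
have cZ a x : c (a *: x) = a *: c x by have [_] := evr x0; apply.
exists e, (linear_of cD cZ); split=> [|d].
  rewrite /= /c eE /=; apply: inj; rewrite -fE.
  by rewrite scale1r.
have [dD dZ] := evl d.
have [d' _ d'u] := evu (@linear_of _ _ (OC B)^o (xi_ev d) dD dZ).
rewrite [LHS](d'u d) // [RHS]d'u // => x /=.
have [_ /= ->] := evr x; rewrite eE /= {2}[x]fE.
by rewrite dZ; apply: mulrC.
Qed.

End Fontaine.

(** * Log differentials *)

(** The square-zero extension of A by U. Ring morphisms to it above a given one are derivations, so
    lifting properties stated for rings, étaleness and that of the chart ring, become statements on
    derivations. *)
Definition dual_numbers (A : comPzRingType) (U : lmodType A) : Type := (A * U)%type.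

Section DualNumbers.
Variables (A : comPzRingType) (U : lmodType A).
Local Notation D := (dual_numbers U).
HB.instance Definition _ := GRing.Zmodule.on D.
Implicit Types x y z : D.

Definition dual_one : D := (1, 0).
Definition dual_mul x y : D := (x.1 * y.1, x.1 *: y.2 + y.1 *: x.2).

Lemma dual_mulA : associative dual_mul.
Proof.
move=> [a u] [b v] [c w]; rewrite /dual_mul /=; congr (_, _); first exact: mulrA.
by rewrite !scalerDr !scalerA addrA [c * a]mulrC [c * b]mulrC.
Qed.

Lemma dual_mulC : commutative dual_mul.
Proof. by move=> [a u] [b v]; rewrite /dual_mul /= mulrC addrC. Qed.

Lemma dual_mul1 : left_id dual_one dual_mul.
Proof. by move=> [a u]; rewrite /dual_mul /= mul1r scale1r scaler0 addr0. Qed.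

Lemma dual_mulDl : left_distributive dual_mul +%R.
Proof.
move=> [a u] [b v] [c w]; rewrite /dual_mul /=; congr (_, _); first exact: mulrDl.
by rewrite scalerDl scalerDr addrACA.
Qed.

HB.instance Definition _ := GRing.Zmodule_isComPzRing.Build D
  dual_mulA dual_mulC dual_mul1 dual_mulDl.

Lemma dual_fstB : {morph (fst : D -> A) : x y / x - y}. Proof. by []. Qed.
Definition dual_fst : {rmorphism D -> A} :=
  rmorphism_of dual_fstB (erefl _) (fun _ _ => erefl _).

End DualNumbers.

Definition derivation_along (A B : comPzRingType) (f : A -> B) (U : lmodType B)
    (D : A -> U) : Prop :=
  {morph D : x y / x - y} /\ forall x y, D (x * y) = f x *: D y + f y *: D x.

Section Derivations.
Variables (A B : comPzRingType) (f : {rmorphism A -> B}) (U : lmodType B).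

Lemma derivation1 (D : A -> U) : derivation_along f D -> D 1 = 0.
Proof.
move=> [_ DM]; have := DM 1 1; rewrite mulr1 rmorph1 !scale1r => /eqP.
by rewrite -subr_eq0 opprD addrA subrr sub0r oppr_eq0 => /eqP.
Qed.

Lemma derivation_morphism (D : A -> U) : derivation_along f D ->
  exists h : {rmorphism A -> dual_numbers U}, forall x, h x = (f x, D x).
Proof.
move=> der; have D1 := derivation1 der; have [DB DM] := der.
have hB : {morph (fun x => (f x, D x) : dual_numbers U) : x y / x - y}.
  by move=> x y; rewrite rmorphB DB.
have h1 : (f 1, D 1) = 1 :> dual_numbers U by rewrite rmorph1 D1.
have hM : {morph (fun x => (f x, D x) : dual_numbers U) : x y / x * y}.
  by move=> x y; rewrite rmorphM DM.
by exists (rmorphism_of hB h1 hM).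
Qed.

Lemma morphism_derivation (h : {rmorphism A -> dual_numbers U}) :
  (forall x, (h x).1 = f x) -> derivation_along f (fun x => (h x).2).
Proof.
move=> hf; split=> [x y|x y]; first by rewrite rmorphB.
by rewrite rmorphM -!hf.
Qed.

Lemma derivation_along0 : derivation_along f (fun=> 0 : U).
Proof. by split=> [x y|x y]; rewrite ?subr0 // !scaler0 addr0. Qed.

End Derivations.

Section EtaleDerivations.
Variables (A B : comNzRingType) (g : {rmorphism A -> B}) (U : lmodType B).
Hypothesis g_etale : formally_etale g.

Let fst_surj (y : B) : exists x, dual_fst U x = y.
Proof. by exists (y, 0). Qed.

Let fst_ker (x y : dual_numbers U) :
  dual_fst U x = 0 -> dual_fst U y = 0 -> x * y = 0.
Proof.
case: x y => [a u] [b v] /= -> ->; rewrite /GRing.mul /= /dual_mul /=.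
by rewrite mul0r !scale0r addr0.
Qed.

(** Formal étaleness is applied to the projection of the dual numbers, whose kernel has square
    zero. *)
Lemma etale_derivation_ext (D : A -> U) : derivation_along g D ->
  exists d : B -> U, derivation_along idfun d /\ forall x, d (g x) = D x.
Proof.
move=> /derivation_morphism[h hE].
have [|k [k1 kg _]] := g_etale fst_surj fst_ker (a := h) (b := idfun).
  by move=> x; rewrite hE.
exists (fun x => (k x).2); split=> [|x]; last by rewrite kg hE.
by apply: (morphism_derivation (f := idfun)) => x; apply: k1.
Qed.

Lemma etale_derivation_uniq (d : B -> U) : derivation_along idfun d ->
  (forall x, d (g x) = 0) -> forall x, d x = 0.
Proof.
move=> der dg x; have [k kE] := derivation_morphism (f := idfun) der.
have [k0 k0E] := derivation_morphism (derivation_along0 (idfun : {rmorphism B -> B}) U).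
have [|l [_ _ uniq]] := g_etale fst_surj fst_ker (a := k0 \o g) (b := idfun).
  by move=> y; rewrite /= k0E.
have kl : k x = l x.
  by apply: uniq => y /=; rewrite kE // k0E dg.
have k0l : k0 x = l x by apply: uniq => y //=; rewrite k0E.
by have := etrans kl (esym k0l); rewrite kE k0E => -[].
Qed.

End EtaleDerivations.

Section ChartDerivations.
Variables (O A : comPzRingType) (P : nmodType) (c : O) (l : P).
Variables (o : {rmorphism O -> A}) (e : P -> A).
Hypothesis chart : is_chart_ring c l o e.
Variables (B : comPzRingType) (f : {rmorphism A -> B}) (U : lmodType B).

Lemma chart_derivation_ext (u : {additive P -> U}) : u l = 0 ->
  exists D : A -> U, [/\ derivation_along f D, forall x, D (o x) = 0
    & forall x, D (e x) = f (e x) *: u x].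
Proof.
have [[e0 eD] el univ] := chart => ul.
have [b bE] := derivation_morphism (derivation_along0 (f \o o) U).
(* e^x goes to e^x (1 + eps u(x)), which is multiplicative as u is additive; u(l) = 0 makes it
   compatible with the relation e^l = c. *)
pose m x : dual_numbers U := (f (e x), f (e x) *: u x).
have [||h [ho he _]] := univ _ b m.
- split=> [|x y]; first by rewrite /m e0 rmorph1 raddf0 scaler0.
  rewrite /m eD rmorphM raddfD; congr (_, _).
  by rewrite /= scalerDr addrC !scalerA [f (e y) * _]mulrC.
- by rewrite /m ul scaler0 el bE.
exists (fun x => (h x).2); split=> [|x|x]; rewrite ?ho ?he ?bE //.
apply: morphism_derivation => x.
(* The first component of h and f solve the same universal problem, so they coincide and h lies
   above f. *)
have fexp : exponential (fun x => f (e x)).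
  by split=> [|y z]; rewrite ?e0 ?rmorph1 // eD rmorphM.
have [|k [_ _ uniq]] := univ _ (f \o o) (fun x => f (e x)) fexp; first by rewrite el.
rewrite (uniq f) // -[LHS]/((dual_fst U \o h) x); apply: uniq => y /=.
  by rewrite ho bE.
by rewrite he.
Qed.

Lemma chart_derivation_uniq (D : A -> U) : derivation_along f D ->
  (forall x, D (o x) = 0) -> (forall x, D (e x) = 0) -> forall x, D x = 0.
Proof.
have [[e0 eD] el univ] := chart => der Do De x.
have [k kE] := derivation_morphism der.
have [k0 k0E] := derivation_morphism (derivation_along0 f U).
have k0exp : exponential (fun x => k0 (e x)).
  by split=> [|y z]; rewrite ?e0 ?rmorph1 // eD rmorphM.
have [|h [_ _ uniq]] := univ _ (k0 \o o) (fun x => k0 (e x)) k0exp; first by rewrite el.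
have kh : k x = h x by apply: uniq => y /=; rewrite kE k0E ?Do ?De.
have k0h : k0 x = h x by apply: uniq.
by have := etrans kh (esym k0h); rewrite kE k0E => -[].
Qed.

End ChartDerivations.

(** * Log differentials from the chart *)

Section LogDifferentials.
Variables (p : nat) (p_prime : prime p) (B : base_field p) (X : log_chart B).
Let R := ringR X.
Let lam := vartheta X 1%N.

(** An additive map killing lambda prescribes a log derivation of the chart ring, which extends to R
    along the étale map. With the uniqueness below, this is the identification of [Omega] with R (x)
    P^gp / Z lambda. *)
Lemma log_differentials_ext (U : lmodType R) (u : {additive monP X -> U}) :
  u lam = 0 -> exists f : {linear Omega X -> U}, forall x, f (dlogP X x) = u x.
Proof.
move=> ul; have [D [Dder Do De]] := chart_derivation_ext (chart_ringP X) (chart_R X) ul.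
have [_ fet] := chart_R_etale X.
have [d [[dB dM] dD]] := etale_derivation_ext fet Dder.
have dlog : is_log_derivation lam (OK_R X) (@alpha _ _ X) d u.
  split=> //; last by move=> x; rewrite -chart_R_P dD De.
  split=> //; first exact: (raddfD (additive_of dB)).
  by move=> y; rewrite -chart_R_OK dD Do.
have [_ univ] := OmegaP X.
by have [f [_ fl _]] := univ _ _ _ dlog; exists f.
Qed.

(** The difference of the induced derivations of R kills the constants and the image of P, hence the
    chart ring, hence R by étaleness. *)
Lemma log_differentials_uniq (U : lmodType R) (f g : {linear Omega X -> U}) :
  (forall x, f (dlogP X x) = g (dlogP X x)) -> f =1 g.
Proof.
move=> fg; have [[[dD dM dO] dal dl0] univ] := OmegaP X; rewrite -/lam in dl0.
have [_ fet] := chart_R_etale X.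
pose del x := f (dR x) - g (dR x).
have delder : derivation_along idfun del.
  split=> [x y|x y]; rewrite /del.
    have -> z w : dR (z - w) = dR z - dR w :> Omega X.
      exact: (raddfB (additive_ofD dD)).
    by rewrite !raddfB /= !opprK addrACA.
  by rewrite dM !raddfD /= !linearZ /= !scalerN addrACA.
have del_al x : del (alpha x) = 0.
  by rewrite /del dal !linearZ /= fg scalerN subrr.
have del_O x : del (OK_R X x) = 0 by rewrite /del dO !raddf0 addr0.
have fdR x : f (dR x) = g (dR x).
  apply/eqP; rewrite -subr_eq0; apply/eqP.
  apply: (etale_derivation_uniq fet delder) => y.
  apply: (chart_derivation_uniq (chart_ringP X) (f := chart_R X)
    (D := fun y => del (chart_R X y))) => [|z|z].
  - have [dB dMl] := delder; split=> [z w|z w]; first by rewrite rmorphB dB.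
    by rewrite rmorphM dMl.
  - by rewrite chart_R_OK.
  by rewrite chart_R_P.
have flog : is_log_derivation lam (OK_R X) (@alpha _ _ X) (f \o @dR _ _ X)
    (f \o dlogP X : {additive monP X -> U}).
  split=> [|x|] /=; last by rewrite dl0 raddf0.
    by split=> [x y|x y|x] /=; rewrite ?dD ?dM ?dO ?raddf0 ?raddfD //= !linearZ.
  by rewrite dal linearZ.
have [h [_ _ uniq]] := univ _ _ _ flog => x.
by rewrite (uniq f) // (uniq g) // => y /=; rewrite -?fdR -?fg.
Qed.

End LogDifferentials.

(** The Smith normal form L D R of the coordinate row of l: the rows of the invertible R give the
    basis, and l is L_00 times the only invariant factor times the first of them. *)
Lemma free_abelian_adapted_basis (G : zmodType) (l : G) :
  free_abelian G -> (forall n : int, l *~ n = 0 -> n = 0) ->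
  exists d (b0 : G) (b : 'I_d -> G) (c0 : {additive G -> int})
    (c : 'I_d -> {additive G -> int}) (g : int),
  [/\ l = b0 *~ g, forall x, x = b0 *~ c0 x + \sum_i b i *~ c i x,
      c0 b0 = 1, forall i, c i b0 = 0 & forall i j, c i (b j) = (i == j)%:R].
Proof.
move=> [n [e eP]] ltf.
have l0 : l != 0 by apply/eqP => l0; have := ltf 1; rewrite l0 mulr1z => /(_ erefl).
case: n e eP => [|m] e eP.
  by have [z lz _] := eP l; move: l0; rewrite lz big_ord0 eqxx.
set n := m.+1 in e eP *.
have zP x : {z : {ffun 'I_n -> int} | x = \sum_i e i *~ z i}.
  by apply: constructive_indefinite_description; have [z] := eP x; exists z.
pose E (v : 'rV[int]_n) := \sum_i e i *~ v 0 i.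
pose zr x : 'rV[int]_n := \row_i sval (zP x) i.
have zrK x : E (zr x) = x.
  by rewrite {2}(svalP (zP x)); apply: eq_bigr => i _; rewrite mxE.
have zrE v x : E v = x -> v = zr x.
  move=> Ev; have [z _ uniq] := eP x.
  have vz : [ffun i => v 0 i] = z.
    by apply: uniq; rewrite -Ev; apply: eq_bigr => i _; rewrite ffunE.
  have xz := uniq _ (svalP (zP x)).
  by apply/rowP => i; rewrite mxE xz -vz ffunE.
have ED u v : E (u + v) = E u + E v.
  by rewrite -big_split; apply: eq_bigr => i _; rewrite mxE mulrzDr.
have EZ k v : E (k *: v) = E v *~ k.
  rewrite /E (big_morph _ (mulrzDl k) (mul0rz _ k)).
  by apply: eq_bigr => i _; rewrite mxE mulrC mulrzA.
have zrD : {morph zr : x y / x + y}.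
  by move=> x y; symmetry; apply: zrE; rewrite ED !zrK.
have [L _ [R Runit [s _ lE]]] := int_Smith_normal_form (zr l).
pose g := L 0 0 * s`_0.
have lR : zr l = g *: row 0 R.
  rewrite lE; apply/rowP => j; rewrite !mxE big_ord_recl big1 ?addr0.
    by rewrite !mxE big_ord1 !mxE eqxx.
  by move=> i _; rewrite !mxE big_ord1 !mxE /= mulr0n mulr0 mul0r.
have coD i : {morph (fun x => (zr x *m invmx R) 0 i) : x y / x + y}.
  by move=> x y; rewrite zrD mulmxDl mxE.
pose co i : {additive G -> int} := additive_ofD (coD i).
have coE i j : co i (E (row j R)) = (i == j)%:R.
  rewrite /= -(zrE (row j R)) // -row_mul mulmxV // !mxE.
  by rewrite eq_sym.
have Esum k (F : 'I_k -> 'rV_m.+1) : E (\sum_i F i) = \sum_i E (F i).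
  elim/big_ind2: _ => // [|u x v y <- <-]; last exact: ED.
  by rewrite /E big1 // => i _; rewrite mxE mulr0z.
exists m, (E (row 0 R)), (fun i => E (row (lift ord0 i) R)), (co 0),
  (fun i => co (lift ord0 i)), g; split=> [|x|||i j].
- by rewrite -EZ -lR zrK.
- rewrite -[LHS]zrK -[zr x](mulmxKV Runit) {1}mulmx_sum_row big_ord_recl ED EZ.
  by congr (_ + _); rewrite Esum; apply: eq_bigr => i _; rewrite EZ.
- by rewrite coE eqxx.
- by move=> i; rewrite coE.
by rewrite coE (inj_eq lift_inj).
Qed.

(* Translation by [y] permutes [s], so the sums of [x] and of [y + x] over [s]
   agree. *)
Lemma torsion_exponent (G : zmodType) (s : seq G) (y : G) :
  uniq s -> (forall x, x \in s <-> exists2 n, (0 < n)%N & x *+ n = 0) ->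
  y \in s -> y *+ size s = 0.
Proof.
move=> us sP ys; have sD x z : x \in s -> z \in s -> x + z \in s.
  move=> /sP[m m0 xm] /sP[n n0 zn]; apply/sP; exists (m * n)%N; first by rewrite muln_gt0 m0.
  by rewrite mulrnDl mulrnA xm mul0rn add0r mulnC mulrnA zn mul0rn.
have um : uniq [seq y + x | x <- s] by rewrite map_inj_uniq //; apply: addrI.
have e : \sum_(x <- [seq y + x | x <- s]) x = \sum_(x <- s) x.
  apply: perm_big; apply: uniq_perm => //.
  have sub : {subset [seq y + x | x <- s] <= s} by move=> _ /mapP[x xs ->]; apply: sD.
  by have [] := uniq_min_size um sub (eq_leq (esym (size_map _ s))).
move: e; rewrite big_map big_split /= big_const_seq count_predT iter_addr addr0.
by rewrite -[X in _ = X -> _]add0r => /addIr.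
Qed.

Section OmegaBasis.
Variables (p : nat) (p_prime : prime p) (B : base_field p) (X : log_chart B).

Lemma vKbar_natr_coprime n : coprime n p -> vKbar (n%:R : Kbar B) = 0.
Proof.
move=> np; have n0 : (0 < n)%N.
  by rewrite lt0n; apply: contraTneq np => ->; rewrite /coprime gcd0n neq_ltn prime_gt1 ?orbT.
have [surj ker] := OK_resKP B.
have nK : OK_K B n%:R != 0 by rewrite rmorph_nat K_natr_neq0.
apply/eqP; rewrite eq_le; apply/andP; split; last first.
  have := @OKb_val p B n%:R (OKb_natr_neq0 B n0).
  by rewrite rmorph_nat.
have := ker n%:R; rewrite rmorph_nat => -[_ H]; rewrite leNgt; apply/negP => v0.
have /H : n%:R = 0 :> OK B \/ 0 < vKbar (K_Kbar B (OK_K B n%:R)).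
  by right; rewrite !rmorph_nat.
move=> /eqP; rewrite -(dvdn_pcharf (resK_pchar B)) => pn.
by move: np; rewrite coprime_sym prime_coprime // pn.
Qed.

Lemma OK_natr_unit n : coprime n p -> exists r : OK B, n%:R * r = 1.
Proof.
move=> np; have n0 : (0 < n)%N.
  by rewrite lt0n; apply: contraTneq np => ->; rewrite /coprime gcd0n neq_ltn prime_gt1 ?orbT.
have [inj sub] := OK_subring B.
have nb : (n%:R : Kbar B) != 0.
  by rewrite -(rmorph_nat (K_Kbar B)) fmorph_eq0 K_natr_neq0.
have [r rE] : exists r, OK_K B r = n%:R^-1.
  apply/sub; right; rewrite fmorphV rmorph_nat.
  by rewrite vKbarV // vKbar_natr_coprime // oppr0.
exists r; apply: inj; rewrite rmorphM rmorph_nat rE rmorph1 divff //.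
exact: K_natr_neq0.
Qed.

Let lam := P_Pgp X (vartheta X 1%N).

(** If p divided g, then (|g|/p) b0 would have p-torsion image in the cokernel, whose torsion has
    order prime to p; the image would vanish, and g would divide |g|/p. *)
Lemma lambda_coprime (b0 : Pgp X) (c0 : {additive Pgp X -> int}) (g : int) :
  lam = b0 *~ g -> c0 b0 = 1 -> coprime `|g|%N p.
Proof.
move=> lg c1; rewrite coprime_sym prime_coprime //; apply/negP => /dvdnP[k gk].
have [s [us sP /eqP cop]] := coker_torsion X.
have kP (h : int) : Pgp_coker X b0 *~ h = 0 -> exists n : int, h = g * n.
  rewrite -raddfMz => /Pgp_coker_ker[n]; rewrite -/lam lg -mulrzA.
  move=> /(congr1 c0); rewrite !raddfMz c1 !intz => ->.
  by exists n.
have g0 : g != 0.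
  apply/eqP => g0; have := @vartheta_gp_inj _ _ X 1.
  by rewrite -/lam lg g0 mulr0z mul0rz => /(_ erefl).
have k0 : (0 < k)%N by move: g0; rewrite -absz_gt0 gk muln_gt0 => /andP[].
pose y := Pgp_coker X b0 *+ k.
have yg : y *+ p = 0.
  have [m mE] : exists m : int, (k * p)%N%:Z = g * m.
    by exists (Num.sg g); rewrite -gk abszE normrEsg mulrC.
  by rewrite /y -mulrnA pmulrn mE -raddfMz mulrzA -lg; apply/Pgp_coker_ker; exists m.
have ys : y \in s by apply/sP; exists p => //; apply: prime_gt0.
have := torsion_exponent us sP ys.
have [u v e _] := egcdnP (size s) (prime_gt0 p_prime).
move: e; rewrite [gcdn p _]gcdnC [gcdn _ _]cop => e sy.
have y0 : y = 0.
  have : y *+ (u * p) = y *+ (v * size s + 1) by rewrite e.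
  by rewrite mulnC mulrnA yg mul0rn mulrnDr mulnC mulrnA sy mul0rn add0r.
have [n kn] := kP k y0.
have : `|k%:Z|%N = (k * (p * `|n|))%N by rewrite kn abszM gk mulnA.
rewrite absz_nat -[LHS]muln1 => /eqP; rewrite eqn_pmul2l // eq_sym muln_eq1.
by move=> /andP[/eqP p1 _]; move: p_prime; rewrite p1.
Qed.

Lemma Omega_free : exists d (e : 'I_d -> Omega X) (c : 'I_d -> {linear Omega X -> (ringR X)^o}),
  free_on e c.
Proof.
have [d [b0 [b [c0 [c [g [lg expand c1 cb0 cb]]]]]]] :=
  free_abelian_adapted_basis (Pgp_free X) (@vartheta_gp_inj _ _ X).
have cop := lambda_coprime lg c1.
have [r gr] : exists r : ringR X, g%:~R * r = 1.
  have [r rE] := OK_natr_unit cop.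
  have nr : `|g|%N%:R * OK_R X r = 1 by rewrite -(rmorph_nat (OK_R X)) -rmorphM rE rmorph1.
  have [->|->] : g = `|g|%N :> int \/ g = - `|g|%N%:Z by case: (g) => n; [left|right].
    by exists (OK_R X r).
  by exists (- OK_R X r); rewrite rmorphN mulrNN.
have [dl dlE _] := PgpP (dlogP X).
(* g dlog(b0) = dlog(lambda) = 0 and g is invertible in R, so the other basis vectors generate. *)
have dl0 : dl b0 = 0.
  have : dl b0 *~ g = 0.
    rewrite -raddfMz -lg dlE; have [[_ _ //]] := OmegaP X.
  rewrite -scaler_int => gb; rewrite -[dl b0]scale1r -gr mulrC -scalerA gb.
  by rewrite scaler0.
have ciD i : {morph (fun x => (c i (P_Pgp X x))%:~R : (ringR X)^o) : x y / x + y}.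
  by move=> x y; rewrite !raddfD.
have ci0 i : (c i (P_Pgp X 0))%:~R = 0 :> (ringR X)^o by rewrite !raddf0.
pose ci i := nmod_additive_of (ci0 i) (ciD i).
have fP i : {f : {linear Omega X -> (ringR X)^o} | forall x, f (dlogP X x) = ci i x}.
  apply/constructive_indefinite_description/log_differentials_ext.
  by rewrite /= lg raddfMz cb0 mul0rz.
pose f i := sval (fP i).
have fdl i y : f i (dl y) = (c i y)%:~R.
  have [h _ uniq] := PgpP (ci i).
  have cD : {morph (fun x => (c i x)%:~R : (ringR X)^o) : x y / x + y}.
    by move=> x z; rewrite !raddfD.
  rewrite -[LHS]/((f i \o dl) y) [LHS]uniq ?[RHS](uniq (additive_ofD cD)) // => x.
  by rewrite /= dlE (svalP (fP i)).
exists d, (fun i => dl (b i)), f; split=> [i j|x].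
  by rewrite fdl cb; case: eqP.
have FD : {morph (fun x => \sum_i (f i x : ringR X) *: dl (b i)) : x y / x + y}.
  by move=> y z; rewrite -big_split; apply: eq_bigr => i _; rewrite raddfD scalerDl.
have FZ a y : \sum_i (f i (a *: y) : ringR X) *: dl (b i) =
    a *: \sum_i (f i y : ringR X) *: dl (b i).
  by rewrite scaler_sumr; apply: eq_bigr => i _; rewrite linearZ scalerA.
rewrite -[RHS]/(linear_of FD FZ x); apply: (@log_differentials_uniq _ _ _ _ idfun) => y /=.
rewrite -dlE {1}(expand (P_Pgp X y)) raddfD raddfMz dl0 mul0rz add0r raddf_sum.
by apply: eq_bigr => i _; rewrite raddfMz fdl scaler_int.
Qed.

End OmegaBasis.

(** * Exterior and tensor powers *)

Section Multilinear.
Variables (A : comPzRingType) (M N : lmodType A).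

Lemma consf0 (T : Type) n (x : T) (v : {ffun 'I_n -> T}) : consf x v ord0 = x.
Proof. by rewrite ffunE unlift_none. Qed.

Lemma consf_lift (T : Type) n (x : T) (v : {ffun 'I_n -> T}) k :
  consf x v (lift ord0 k) = v k.
Proof. by rewrite ffunE liftK. Qed.

Lemma upd_consf0 n (x y : M) (v : {ffun 'I_n -> M}) :
  upd (consf x v) ord0 y = consf y v.
Proof.
apply/ffunP => j; rewrite ffunE; have [k ->|->] := unliftP ord0 j.
  by rewrite !consf_lift -(inj_eq val_inj).
by rewrite eqxx consf0.
Qed.

Lemma upd_consfS n (x y : M) (v : {ffun 'I_n -> M}) k :
  upd (consf x v) (lift ord0 k) y = consf x (upd v k y).
Proof.
apply/ffunP => j; rewrite ffunE; have [i ->|->] := unliftP ord0 j.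
  by rewrite !consf_lift ffunE (inj_eq lift_inj).
by rewrite !consf0 -(inj_eq val_inj).
Qed.

Lemma consf_behead (T : Type) n (v : {ffun 'I_n.+1 -> T}) :
  consf (v ord0) [ffun k => v (lift ord0 k)] = v.
Proof.
apply/ffunP => j; have [k ->|->] := unliftP ord0 j; last by rewrite consf0.
by rewrite consf_lift ffunE.
Qed.

Lemma sum_consf (V : nmodType) (I : finType) n (F : {ffun 'I_n.+1 -> I} -> V) :
  \sum_J F J = \sum_i \sum_(J : {ffun 'I_n -> I}) F (consf i J).
Proof.
rewrite pair_big /= (reindex (fun iJ : I * {ffun 'I_n -> I} => consf iJ.1 iJ.2)) //.
exists (fun J : {ffun 'I_n.+1 -> I} => (J ord0, [ffun k => J (lift ord0 k)])) => [[i J] _|J _] /=.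
  by rewrite consf0; congr (_, _); apply/ffunP => k; rewrite ffunE consf_lift.
exact: consf_behead.
Qed.

Lemma multilinear_consf n (t : {ffun 'I_n.+1 -> M} -> N) x :
  multilinear t -> multilinear (fun v => t (consf x v)).
Proof. by move=> tM v k a y z; rewrite -!upd_consfS. Qed.

Lemma multilinear_sum0 n (t : {ffun 'I_n.+1 -> M} -> N) (I : finType)
    (a : I -> A) (e : I -> M) v : multilinear t ->
  t (consf (\sum_i a i *: e i) v) = \sum_i a i *: t (consf (e i) v).
Proof.
move=> tM; have t0 : t (consf 0 v) = 0.
  have := tM (consf 0 v) ord0 (-1) 0 0; rewrite !upd_consf0 scaler0 add0r.
  by rewrite scaleN1r addNr.
elim/big_rec2: _ => // i y x _ <-.
by have := tM (consf 0 v) ord0 (a i) (e i) x; rewrite !upd_consf0.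
Qed.

Lemma multilinear_expand (I : finType) (e : I -> M) (c : I -> M -> A) n
    (t : {ffun 'I_n -> M} -> N) :
  (forall x, x = \sum_i c i x *: e i) -> multilinear t ->
  forall v, t v = \sum_(J : {ffun 'I_n -> I})
    (\prod_a c (J a) (v a)) *: t [ffun a => e (J a)].
Proof.
move=> ex; elim: n t => [|n IH] t tM v.
  rewrite (eq_bigr (fun=> t v)) => [|J _].
    by rewrite sumr_const card_ffun card_ord expn0.
  by rewrite big_ord0 scale1r; congr (t _); apply/ffunP => -[].
rewrite -{1}(consf_behead v) (ex (v ord0)) multilinear_sum0 // sum_consf.
apply: eq_bigr => i _; rewrite (IH _ (multilinear_consf (e i) tM)) scaler_sumr.
apply: eq_bigr => J _; rewrite scalerA big_ord_recl consf0; congr ((_ * _) *: t _).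
  by apply: eq_bigr => a _; rewrite consf_lift ffunE.
apply/ffunP => j; rewrite [RHS]ffunE; have [k ->|->] := unliftP ord0 j.
  by rewrite !consf_lift ffunE.
by rewrite !consf0.
Qed.

Definition permf (T : Type) n (s : 'S_n) (v : {ffun 'I_n -> T}) : {ffun 'I_n -> T} :=
  [ffun i => v (s i)].

Lemma alternating_tperm n (t : {ffun 'I_n -> M} -> N) i j v :
  alternating t -> i != j -> t (permf (tperm i j) v) = - t v.
Proof.
move=> [tM tA] nij; set s := v i + v j.
have u x y : t (upd (upd v i x) j y) = t (upd (upd v j y) i x).
  congr (t _); apply/ffunP => k; rewrite !ffunE; case: (k =P j) => // ->.
  by rewrite eq_sym (negPf nij).
have D x y z : t (upd (upd v i x) j (y + z)) = t (upd (upd v i x) j y) + t (upd (upd v i x) j z).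
  by have := tM (upd v i x) j 1 y z; rewrite !scale1r.
have D' x y z : t (upd (upd v i (x + y)) j z) = t (upd (upd v i x) j z) + t (upd (upd v i y) j z).
  by rewrite !u; have := tM (upd v j z) i 1 x y; rewrite !scale1r.
have E x : t (upd (upd v i x) j x) = 0.
  by apply: (tA _ _ _ nij); rewrite !ffunE eqxx (negPf nij) eqxx.
have := E s; rewrite /s D !D' !E add0r addr0 => /eqP; rewrite addr_eq0 => /eqP.
have -> : upd (upd v i (v i)) j (v j) = v.
  by apply/ffunP => k; rewrite !ffunE; case: eqP => [->//|_]; case: eqP => [->|].
move=> <-; congr (t _); apply/ffunP => k; rewrite !ffunE.
by case: tpermP => [->|->|/eqP/negPf ki /eqP/negPf kj]; rewrite ?eqxx ?(negPf nij) ?ki ?kj // eqxx.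
Qed.

Lemma permfM (T : Type) n (s s' : 'S_n) (v : {ffun 'I_n -> T}) :
  permf (s * s') v = permf s (permf s' v).
Proof. by apply/ffunP => i; rewrite !ffunE permM. Qed.

Lemma permf1 (T : Type) n (v : {ffun 'I_n -> T}) : permf 1 v = v.
Proof. by apply/ffunP => i; rewrite !ffunE perm1. Qed.

Lemma alternating_perm n (t : {ffun 'I_n -> M} -> N) s v :
  alternating t -> t (permf s v) = (-1) ^+ (odd_perm s) *: t v.
Proof.
move=> tA; have [ts -> /allP dts] := prod_tpermP s.
elim: ts dts v => [|[i j] ts IH] dts v.
  by rewrite big_nil permf1 odd_perm1 expr0 scale1r.
have dij : i != j := dts (i, j) (mem_head _ _).
rewrite big_cons permfM alternating_tperm // IH; last first.
  by move=> x xts; apply: dts; rewrite inE xts orbT.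
by rewrite odd_permM odd_tperm dij signr_addb mulN1r scaleNr.
Qed.

End Multilinear.

Section KroneckerDet.
Variables (d : nat).

(** The generalised Kronecker delta: the sign of the permutation carrying J to J' if J has distinct
    entries and such a permutation exists, 0 otherwise. *)
Definition kronecker_det (A : comPzRingType) n (J J' : {ffun 'I_n -> 'I_d}) : A :=
  \det (\matrix_(a, b) (J b == J' a)%:R).

(** The determinant is the signed sum over s of the indicators of J' = J o s, so summing against it
    antisymmetrises. *)
Lemma kronecker_det_sum (A : comPzRingType) n J (F : {ffun 'I_n -> 'I_d} -> A) :
  \sum_J' F J' * kronecker_det A J J' =
  \sum_(s : 'S_n) (-1) ^+ (odd_perm s) * F (permf s J).
Proof.
rewrite (eq_bigr (fun J' => \sum_(s : 'S_n) (-1) ^+ (odd_perm s) * ((J' == permf s J)%:R * F J'))).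
  rewrite exchange_big; apply: eq_bigr => s _; rewrite (bigD1 (permf s J)) //= eqxx mul1r.
  by rewrite big1 ?addr0 // => J' /negPf ->; rewrite mul0r mulr0.
move=> J' _; rewrite /kronecker_det /determinant mulr_sumr; apply: eq_bigr => s _.
rewrite mulrCA; congr (_ * _); rewrite mulrC; congr (_ * _).
have [->|neq] := eqVneq.
  by apply: big1 => i _; rewrite mxE ffunE eqxx.
have /existsP[a Ja] : [exists a, J' a != J (s a)].
  apply: contraR neq; rewrite negb_exists => /forallP H; apply/eqP/ffunP => a.
  by rewrite ffunE; apply/eqP; have := H a; rewrite negbK.
by rewrite (bigD1 a) //= mxE eq_sym (negPf Ja) mul0r.
Qed.

End KroneckerDet.

Section ExteriorPower.
Variables (A : comPzRingType) (M : lmodType A) (d : nat) (e : 'I_d -> M).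
Variable c : 'I_d -> {linear M -> A^o}.
Hypothesis free : free_on e c.
Variables (n : nat) (T : lmodType A) (t : {ffun 'I_n -> M} -> T).
Hypothesis tP : is_exterior_power t.

Lemma exterior_power_uniq (U : lmodType A) (f g : {linear T -> U}) :
  (forall v, f (t v) = g (t v)) -> f =1 g.
Proof.
move=> fg; have [[tM tA] univ] := tP.
have alt : alternating (fun v => g (t v)).
  split=> [v k a x y|v j k njk vjk]; first by rewrite tM linearP.
  by rewrite (tA v j k) // raddf0.
have [h _ uniq] := univ _ _ alt => x.
by rewrite (uniq f) // (uniq g).
Qed.

Definition minor_mx (J : {ffun 'I_n -> 'I_d}) (v : {ffun 'I_n -> M}) : 'M[A]_n :=
  \matrix_(a, b) c (J b) (v a).

Lemma minor_alternating J : alternating (fun v => \det (minor_mx J v) : A^o).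
Proof.
split=> [v k a x y|v j k njk vjk].
  rewrite -[RHS]/(a * \det (minor_mx J (upd v k x)) + \det (minor_mx J (upd v k y))).
  rewrite -[\det (minor_mx J (upd v k y))]mul1r.
  apply: (determinant_multilinear (i0 := k)).
  - apply/rowP => b; rewrite !mxE !ffunE eqxx linearP mul1r.
    by [].
  - by apply/matrixP => i b; rewrite !mxE !ffunE eq_sym (negPf (neq_lift _ _)).
  - by apply/matrixP => i b; rewrite !mxE !ffunE eq_sym (negPf (neq_lift _ _)).
by apply: (determinant_alternate njk) => b; rewrite !mxE vjk.
Qed.

(* Summing over all tuples instead of the increasing ones costs the factor n!,
   which is invertible rationally. *)
Lemma exterior_power_coords : exists psi : {ffun 'I_n -> 'I_d} -> {linear T -> A^o},
  (forall J v, psi J (t v) = \det (minor_mx J v)) /\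
  (forall x, (n`!)%:R *: x = \sum_J (psi J x : A) *: t [ffun a => e (J a)]).
Proof.
have [[tM tA] univ] := tP.
have psiP J : {f : {linear T -> A^o} | forall v, f (t v) = \det (minor_mx J v)}.
  apply: constructive_indefinite_description.
  by have [f fE _] := univ _ _ (minor_alternating J); exists f.
pose psi J := sval (psiP J).
have psiE J v : psi J (t v) = \det (minor_mx J v) := svalP (psiP J) v.
exists psi; split=> // x.
have FD : {morph (fun x => \sum_J (psi J x : A) *: t [ffun a => e (J a)]) : x y / x + y}.
  by move=> y z; rewrite -big_split; apply: eq_bigr => J _; rewrite raddfD scalerDl.
have FZ a y : \sum_J (psi J (a *: y) : A) *: t [ffun b => e (J b)] =
    a *: \sum_J (psi J y : A) *: t [ffun b => e (J b)].
  by rewrite scaler_sumr; apply: eq_bigr => J _; rewrite linearZ scalerA.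
have GD : {morph (fun x : T => (n`!)%:R *: x) : x y / x + y}.
  by move=> y z; rewrite scalerDr.
have GZ a (y : T) : (n`!)%:R *: (a *: y) = a *: ((n`!)%:R *: y).
  by rewrite !scalerA mulrC.
rewrite -[LHS]/(linear_of GD GZ x) -[RHS]/(linear_of FD FZ x).
apply: exterior_power_uniq => v /=.
have [_ ex] := free.
have tv := multilinear_expand (c := fun i x => c i x) ex tM v.
rewrite (eq_bigr (fun J => \sum_(s : 'S_n)
    (\prod_a c (permf s J a) (v a)) *: t [ffun a => e (permf s J a)])) => [|J _].
  rewrite exchange_big /= (eq_bigr (fun=> t v)) => [|s _].
    by rewrite sumr_const card_Sn scaler_nat.
  rewrite [RHS]tv [RHS](reindex (fun J => permf s J)) //.
  exists (permf s^-1) => J _; rewrite -permfM ?mulVg ?mulgV permf1 //.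
rewrite psiE /determinant scaler_suml; apply: eq_bigr => s _.
have -> : [ffun a => e (permf s J a)] = permf s [ffun a => e (J a)].
  by apply/ffunP => a; rewrite !ffunE.
rewrite alternating_perm // scalerA mulrC; congr (_ * _ *: _).
by apply: eq_bigr => a _; rewrite mxE ffunE.
Qed.

Lemma minor_perm J v s :
  \det (minor_mx (permf s J) v) = (-1) ^+ (odd_perm s) * \det (minor_mx J v).
Proof.
have -> : minor_mx (permf s J) v = col_perm s (minor_mx J v).
  by apply/matrixP => a b; rewrite !mxE ffunE.
rewrite -[col_perm _ _]trmxK tr_col_perm row_permE det_tr det_mulmx det_perm.
by rewrite det_tr.
Qed.

Lemma minor_basis J (J' : {ffun 'I_n -> 'I_d}) : \det (minor_mx J [ffun a => e (J' a)]) = kronecker_det A J J'.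
Proof.
by have [ce _] := free; congr (\det _); apply/matrixP => a b; rewrite !mxE ffunE ce.
Qed.

End ExteriorPower.

Definition omitf (T : Type) n (s : 'I_n.+1) (J : {ffun 'I_n.+1 -> T}) :
  {ffun 'I_n -> T} := [ffun k => J (lift s k)].

Lemma omitfE (T : Type) n s (J : {ffun 'I_n.+1 -> T}) k : omitf s J k = J (lift s k).
Proof. by rewrite ffunE. Qed.

(** Laplace expansion along the row of e_k, which consists of Kronecker deltas. It expresses left
    multiplication by e_k in coordinates and is the source of the signs in [form_d]. *)
Lemma minor_consf (A : comPzRingType) (M : lmodType A) (d : nat) (e : 'I_d -> M)
    (c : 'I_d -> {linear M -> A^o}) n (J : {ffun 'I_n.+1 -> 'I_d}) k v :
  free_on e c ->
  \det (minor_mx c J (consf (e k) v)) =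
  \sum_(s < n.+1) (-1) ^+ s * (J s == k)%:R * \det (minor_mx c (omitf s J) v).
Proof.
move=> [ce _]; rewrite (expand_det_row _ ord0); apply: eq_bigr => s _.
rewrite mxE consf0 ce /cofactor add0n mulrCA mulrA; congr (_ * \det _).
by apply/matrixP => a b; rewrite !mxE consf_lift ffunE.
Qed.

Lemma tensor_power_rank1 (A : comPzRingType) (M T : lmodType A) (e : M)
    (c : {linear M -> A^o}) n (t : {ffun 'I_n -> M} -> T) :
  free_rank1 e c -> is_tensor_power t ->
  exists C : {linear T -> A^o}, (forall v, C (t v) = \prod_i (c (v i) : A)) /\
    forall x, x = (C x : A) *: t [ffun=> e].
Proof.
move=> [ce ex] [tM univ].
have ML : multilinear (fun v : {ffun 'I_n -> M} => \prod_i (c (v i) : A) : A^o).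
  move=> v k a x y.
  have pU z : \prod_i (c (upd v k z i) : A) = c z * \prod_(i | i != k) (c (v i) : A).
    rewrite (bigD1 k) //= ffunE eqxx; congr (_ * _).
    by apply: eq_bigr => i ik; rewrite ffunE (negPf ik).
  by rewrite !pU linearP mulrDl -mulrA.
have [C CE _] := univ _ _ ML; exists C; split=> // x.
have [h _ uniq] := univ _ _ tM.
have FD : {morph (fun x => (C x : A) *: t [ffun=> e]) : x y / x + y}.
  by move=> y z; rewrite raddfD scalerDl.
have FZ a y : (C (a *: y) : A) *: t [ffun=> e] = a *: ((C y : A) *: t [ffun=> e]).
  by rewrite linearZ scalerA.
rewrite -[RHS]/(linear_of FD FZ x) [RHS]uniq; last first.
  move=> v /=; rewrite CE.
  have ex1 y : y = \sum_(i < 1) (c y : A) *: e by rewrite big_ord1 -ex.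
  rewrite (multilinear_expand (I := 'I_1) ex1 tM v).
  rewrite (eq_bigr (fun=> (\prod_i (c (v i) : A)) *: t [ffun=> e])) => [|J _ //].
  by rewrite sumr_const card_ffun !card_ord exp1n.
by rewrite -(uniq idfun).
Qed.

(** * Tensor products over two rings *)

Section MixedTensor.
Variables (A B C : comPzRingType) (f : {rmorphism A -> B}) (g : {rmorphism C -> B}).
Variables (M : lmodType A) (N : lmodType C) (T : lmodType B) (t : M -> N -> T).
Hypothesis tP : is_mixed_tensor f g t.

Lemma mixed_tensor_uniq (U : lmodType B) (h h' : {linear T -> U}) :
  (forall x y, h (t x y) = h' (t x y)) -> h =1 h'.
Proof.
move=> hh'; have [[tl tr] univ] := tP.
have bi : bisemilinear f g (fun x y => h' (t x y)).
  split=> [y|x]; split.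
  - by move=> x x'; have [-> _] := tl y; rewrite raddfD.
  - by move=> a x; have [_ ->] := tl y; rewrite linearZ.
  - by move=> y y'; have [-> _] := tr x; rewrite raddfD.
  - by move=> a y; have [_ ->] := tr x; rewrite linearZ.
by have [k _ uniq] := univ _ _ bi => x; rewrite (uniq h) // (uniq h').
Qed.

Lemma mixed_tensor_coord (phi : {linear M -> A^o}) (chi : {linear N -> C^o}) :
  exists h : {linear T -> B^o}, forall x y, h (t x y) = f (phi x) * g (chi y).
Proof.
have [_ univ] := tP.
have bi : bisemilinear f g (fun x y => f (phi x) * g (chi y) : B^o).
  split=> [y|x]; split.
  - by move=> x x'; rewrite raddfD rmorphD mulrDl.
  - by move=> a x; rewrite linearZ rmorphM -mulrA.
  - by move=> y y'; rewrite raddfD rmorphD mulrDr.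
  - by move=> a y; rewrite linearZ rmorphM mulrCA.
by have [h hE _] := univ _ _ bi; exists h.
Qed.

(** The scalar m accommodates the factor q! in expansions of exterior powers over all tuples; m = 1
    gives freeness. *)
Lemma mixed_tensor_expand (U : finType) (m : B) (phi : U -> {linear M -> A^o})
    (e : U -> M) (e0 : N) (c0 : {linear N -> C^o}) (h : U -> {linear T -> B^o}) :
  (forall x, exists2 m', f m' = m & m' *: x = \sum_i (phi i x : A) *: e i) ->
  (forall y, y = (c0 y : C) *: e0) ->
  (forall i x y, h i (t x y) = f (phi i x) * g (c0 y)) ->
  forall z, m *: z = \sum_i (h i z : B) *: t (e i) e0.
Proof.
move=> ex ex0 hE z; have [[tl tr] univ] := tP.
have FD : {morph (fun z => \sum_i (h i z : B) *: t (e i) e0) : x y / x + y}.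
  by move=> x y; rewrite -big_split; apply: eq_bigr => i _; rewrite raddfD scalerDl.
have FZ a x : \sum_i (h i (a *: x) : B) *: t (e i) e0 = a *: \sum_i (h i x : B) *: t (e i) e0.
  by rewrite scaler_sumr; apply: eq_bigr => i _; rewrite linearZ scalerA.
have GD : {morph (fun z : T => m *: z) : x y / x + y} by move=> x y; rewrite scalerDr.
have GZ a (x : T) : m *: (a *: x) = a *: (m *: x) by rewrite !scalerA mulrC.
rewrite -[LHS]/(linear_of GD GZ z) -[RHS]/(linear_of FD FZ z).
apply: mixed_tensor_uniq => x y /=.
have [m' <- m'x] := ex x; have [tyD tyZ] := tl y.
rewrite -tyZ m'x.
have ty0 : t 0 y = 0 by apply: (addrI (t 0 y)); rewrite -tyD !addr0.
rewrite (big_morph _ tyD ty0); apply: eq_bigr => i _; rewrite tyZ hE -scalerA.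
by rewrite {1}(ex0 y); have [_ ->] := tr (e i).
Qed.

Lemma mixed_tensor_free (d : nat) (e : 'I_d -> M) (c : 'I_d -> {linear M -> A^o})
    (e0 : N) (c0 : {linear N -> C^o}) : free_on e c -> free_rank1 e0 c0 ->
  exists h : 'I_d -> {linear T -> B^o}, free_on (fun i => t (e i) e0) h.
Proof.
move=> [ce ex] [ce0 ex0].
have hP i : {h : {linear T -> B^o} | forall x y, h (t x y) = f (c i x) * g (c0 y)}.
  exact/constructive_indefinite_description/mixed_tensor_coord.
exists (fun i => sval (hP i)); split=> [i j|z].
  by rewrite (svalP (hP i)) ce ce0 rmorph_nat rmorph1 mulr1.
rewrite -[LHS]scale1r.
apply: (mixed_tensor_expand (phi := c) (c0 := c0)) => // [x|i x y].
  by exists 1; rewrite ?rmorph1 // scale1r -ex.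
exact: (svalP (hP i)).
Qed.

End MixedTensor.

(** * Coefficients of elements of S^dagger *)

Definition monomial (S : comPzRingType) d (y : 'I_d -> S) (J : 'X_{1..d}) : S :=
  \prod_i y i ^+ J i.

(** S is the polynomial algebra on y, expressed by additive coefficient functionals because these
    are what [completion_ext] extends to the completion. *)
Definition monomial_basis (A S : comPzRingType) (a : {rmorphism A -> S}) d
    (y : 'I_d -> S) (coef : 'X_{1..d} -> {additive S -> A}) : Prop :=
  (forall I J x, coef I (a x * monomial y J) = x * (I == J)%:R) /\
  (forall s, exists2 r : seq 'X_{1..d}, uniq r &
     s = \sum_(J <- r) a (coef J s) * monomial y J).

(** The universal property gives a map from S to A[X_1, ..., X_d], of which evaluation at y is a
    left inverse by uniqueness; coefficients are read off in the polynomial ring. *)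
Lemma symmetric_algebra_basis_nz (A S : comNzRingType) (M : lmodType A) d
    (e : 'I_d -> M) (c : 'I_d -> {linear M -> A^o}) (a : {rmorphism A -> S})
    (sg : M -> S) :
  free_on e c -> is_symmetric_algebra a sg ->
  exists coef, monomial_basis a (fun i => sg (e i)) coef.
Proof.
move=> [ce ex] [[sgD sgZ] univ].
pose u x : {mpoly A[d]} := \sum_i (c i x)%:MP * 'X_i.
have uL : Defs.semilinear (fun x : A => x%:MP_[d]) (u : M -> {mpoly A[d]}^o).
  split=> [x y|b x]; rewrite /u.
    by rewrite -big_split; apply: eq_bigr => i _; rewrite raddfD mpolyCD mulrDl.
  rewrite -[RHS]/(_ * _) mulr_sumr; apply: eq_bigr => i _.
  by rewrite linearZ mpolyCM mulrA.
have [al [ala alu _]] := univ _ (@mpolyC d A) u uL.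
pose y i := sg (e i).
pose be : {rmorphism {mpoly A[d]} -> S} := mmap a y.
have sg_sum x : sg x = \sum_i a (c i x) * y i.
  rewrite {1}(ex x) (big_morph sg sgD (_ : sg 0 = 0)); last first.
    by apply: (addrI (sg 0)); rewrite -sgD !addr0.
  by apply: eq_bigr => i _; rewrite sgZ.
have [h [_ _ uniq]] := univ _ a sg (conj sgD sgZ).
have beal s : be (al s) = s.
  transitivity (h s); last by symmetry; apply: (uniq idfun).
  rewrite -[be (al s)]/((be \o al) s); apply: uniq => x /=.
    by rewrite ala /= mmapC.
  rewrite alu sg_sum /u rmorph_sum; apply: eq_bigr => i _.
  by rewrite rmorphM /= mmapC mmapX mmap1U.
exists (fun I => (mcoeff I \o al : {additive S -> A})); split=> [I J x|s] /=.
  rewrite rmorphM ala rmorph_prod /=.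
  have -> : \prod_i al (sg (e i) ^+ J i) = 'X_[J].
    rewrite mpolyXE_id; apply: eq_bigr => i _; rewrite rmorphXn alu; congr (_ ^+ _).
    rewrite /u (bigD1 i) //= ce eqxx mpolyC1 mul1r big1 ?addr0 // => j ji.
    by rewrite ce (negPf ji) mpolyC0 mul0r.
  by rewrite mcoeffCM mcoeffX eq_sym.
exists (msupp (al s)); first exact: msupp_uniq.
by rewrite -{1}(beal s).
Qed.

Lemma symmetric_algebra_basis (A S : comPzRingType) (M : lmodType A) d
    (e : 'I_d -> M) (c : 'I_d -> {linear M -> A^o}) (a : {rmorphism A -> S})
    (sg : M -> S) :
  1 <> 0 :> A -> free_on e c -> is_symmetric_algebra a sg ->
  exists coef, monomial_basis a (fun i => sg (e i)) coef.
Proof.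
have [//|[A' EA]] := comNz_or_trivial A; move: M e c a sg; rewrite {}EA.
move=> M e c a sg _ ec sym.
have [S0|[S' ES]] := comNz_or_trivial S; last first.
  by move: a sg sym; rewrite {}ES => a sg sym; apply: symmetric_algebra_basis_nz ec sym.
(* S is not the zero ring: sending the module to 0 gives a morphism from S to a nonzero polynomial
   ring. *)
have [_ univ] := sym.
have [|h _] := univ _ (@mpolyC d A') (fun=> 0).
  by split=> *; rewrite ?addr0 ?scaler0.
by have /eqP := congr1 h S0; rewrite rmorph1 rmorph0 oner_eq0.
Qed.

Section MonomialBasis.
Variables (A S : comPzRingType) (a : {rmorphism A -> S}) (d : nat) (y : 'I_d -> S).
Variable coef : 'X_{1..d} -> {additive S -> A}.
Hypothesis basis : monomial_basis a y coef.

Lemma monomial0 : monomial y 0%MM = 1.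
Proof. by apply: big1 => i _; rewrite mnm0E. Qed.

Lemma monomialU (J : 'X_{1..d}) k : monomial y (U_(k) + J)%MM = y k * monomial y J.
Proof.
rewrite /monomial [in LHS](bigD1 k) //= [in RHS](bigD1 k) //= mnmDE mnm1E eqxx.
rewrite exprS -mulrA; congr (_ * (_ * _)); apply: eq_bigr => i ik.
by rewrite mnmDE mnm1E eq_sym (negPf ik).
Qed.

Lemma coef_lin I x s : coef I (a x * s) = x * coef I s.
Proof.
have [cm cs] := basis; have [r _ ->] := cs s.
rewrite mulr_sumr !raddf_sum mulr_sumr; apply: eq_bigr => J _.
by rewrite mulrA -rmorphM !cm mulrA.
Qed.

Lemma coef_sum (r : seq 'X_{1..d}) (F : 'X_{1..d} -> A) I : uniq r ->
  coef I (\sum_(J <- r) a (F J) * monomial y J) = if I \in r then F I else 0.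
Proof.
have [cm _] := basis; rewrite raddf_sum; elim: r => [|J r IH] /=.
  by rewrite big_nil.
case/andP=> nJ ur; rewrite big_cons IH // cm inE.
by have [->|] := eqVneq; rewrite ?(negPf nJ) ?mulr1 ?addr0 // mulr0 add0r.
Qed.

Lemma coef_mult b s : (forall I, mult_of b (coef I s)) -> mult_of (a b) s.
Proof.
move=> bs; have [_ /(_ s)[r _ ->]] := basis; apply: mult_of_sum => J _.
exact/mult_ofMr/mult_of_rmorph.
Qed.

Lemma coef_additive_ext (V : zmodType) (f g : {additive S -> V}) :
  (forall x J, f (a x * monomial y J) = g (a x * monomial y J)) -> f =1 g.
Proof.
move=> fg s; have [_ /(_ s)[r _ ->]] := basis.
by rewrite !raddf_sum; apply: eq_bigr => J _.
Qed.

Lemma mnm_ind (P : 'X_{1..d} -> Prop) :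
  P 0%MM -> (forall J k, P J -> P (U_(k) + J)%MM) -> forall J, P J.
Proof.
move=> P0 PU J; move: {2}(mdeg J) (erefl (mdeg J)) => n.
elim: n J => [|n IH] J Jn; first by move/eqP: Jn; rewrite mdeg_eq0 => /eqP ->.
have [k Jk] : exists k, (0 < J k)%N.
  apply/existsP; apply: contra_eqT Jn; rewrite negb_exists => /forallP J0.
  suff -> : J = 0%MM by rewrite mdeg0.
  by apply/mnmP => i; have := J0 i; rewrite -eqn0Ngt mnm0E => /eqP.
have JE : J = (U_(k) + (J - U_(k)))%MM by rewrite addmC submK // lep1mP -lt0n.
rewrite JE; apply: PU; apply: IH; apply: succn_inj.
by rewrite -Jn {2}JE mdegD mdeg1.
Qed.

Section Derivation.
Variables (k : 'I_d) (D : {additive S -> S}).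
Hypothesis DM : forall s t, D (s * t) = s * D t + t * D s.
Hypothesis Da : forall x, D (a x) = 0.
Hypothesis Dy : forall l, D (y l) = (l == k)%:R.

Lemma derivation_monomial J : D (monomial y J) = (J k)%:R * monomial y (J - U_(k))%MM.
Proof.
elim/mnm_ind: J => [|J l IH].
  by rewrite monomial0 -(rmorph1 a) Da mnm0E mul0r.
rewrite monomialU DM IH Dy mnmDE mnm1E; have [->|lk] := eqVneq l k.
  have -> : (U_(k) + J - U_(k))%MM = J by rewrite addmC addmK.
  rewrite mulr1 natrD mulrDl mul1r addrC; congr (_ + _).
  have [->|Jk] := eqVneq (J k) 0%N; first by rewrite !mul0r mulr0.
  rewrite mulrCA -monomialU; congr (_ * monomial y _).
  by rewrite addmC submK // lep1mP.
rewrite mulr0 addr0 add0n mulrCA -monomialU; have [->|Jk] := eqVneq (J k) 0%N.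
  by rewrite !mul0r.
congr (_ * monomial y _); apply/mnmP => i; rewrite !(mnmDE, mnmBE, mnm1E).
by have [<-|] := eqVneq k i; rewrite ?(negPf lk) ?subn0.
Qed.

Lemma coef_derivation I s : coef I (D s) = (I k).+1%:R * coef (I + U_(k))%MM s.
Proof.
have [cm _] := basis.
have gB : {morph (fun s => (I k).+1%:R * coef (I + U_(k))%MM s) : s t / s - t}.
  by move=> s' t; rewrite raddfB mulrBr.
rewrite -[LHS]/((coef I \o D) s) -[RHS]/(additive_of gB s).
apply: coef_additive_ext => x J /=.
rewrite DM Da mulr0 addr0 derivation_monomial -[(J k)%:R](rmorph_nat a) mulrA -rmorphM !cm.
have [<-|IJ] := eqVneq (I + U_(k))%MM J.
  by rewrite addmK eqxx !mulr1 mnmDE mnm1E eqxx addn1 mulrC.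
rewrite !mulr0; have [E|] := eqVneq; last by rewrite mulr0.
have [->|Jk] := eqVneq (J k) 0%N; first by rewrite mulr0 mul0r.
by move: IJ; rewrite E submK ?lep1mP // eqxx.
Qed.

End Derivation.

Section BaseChange.
Variables (S' : comPzRingType) (a' : {rmorphism A -> S'}) (y' : 'I_d -> S').
Variable coef' : 'X_{1..d} -> {additive S' -> A}.
Hypothesis basis' : monomial_basis a' y' coef'.
Variables (h : {rmorphism S -> S'}) (w : A).
Hypothesis ha : forall x, h (a x) = a' x.
Hypothesis hy : forall i, h (y i) = a' w * y' i.

(** With w = p^(1/m) and h the map from S^(1/m) to S, this is the origin of the factor p^(|I|/m) in
    overconvergence. *)
Lemma coef_rescale I s : coef' I (h s) = w ^+ mdeg I * coef I s.
Proof.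
have [cm _] := basis; have [cm' _] := basis'.
have gB : {morph (fun s => w ^+ mdeg I * coef I s) : s t / s - t}.
  by move=> s' t; rewrite raddfB mulrBr.
rewrite -[LHS]/((coef' I \o h) s) -[RHS]/(additive_of gB s).
apply: coef_additive_ext => x J /=; rewrite rmorphM ha.
have -> : h (monomial y J) = a' (w ^+ mdeg J) * monomial y' J.
  rewrite rmorph_prod mdegE expr_sum rmorph_prod -big_split.
  by apply: eq_bigr => i _; rewrite !rmorphXn hy exprMn.
rewrite mulrA -rmorphM cm' cm mulrA [w ^+ mdeg I * _]mulrC.
by have [->|] := eqVneq; rewrite ?mulr0.
Qed.

End BaseChange.

Section CompletedCoefficients.
Variables (p : nat) (Sh : comPzRingType) (c : {rmorphism S -> Sh}).
Hypothesis cP : is_padic_completion p c.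
Hypothesis A_sep : padic_separated p A.
Hypothesis A_compl : padic_complete p A.

(** The functionals extend by continuity and stay jointly injective; a family tending to 0 in the
    degree is realised as the limit of its truncations. *)
Lemma completed_coef : exists coefh : 'X_{1..d} -> {additive Sh -> A},
  [/\ forall I s, coefh I (c s) = coef I s,
      forall x, (forall I, coefh I x = 0) -> x = 0,
      forall I x s, coefh I (c (a x) * s) = x * coefh I s &
      forall F : 'X_{1..d} -> A,
        (forall n, exists N, forall I, (N <= mdeg I)%N -> mult_of (p%:R ^+ n) (F I)) ->
        exists x, forall I, coefh I x = F I].
Proof.
have [dense refl sep compl] := padic_completionP cP.
have chP I : {f : {additive Sh -> A} | forall s, f (c s) = coef I s}.
  exact/constructive_indefinite_description/(completion_ext dense refl).
pose ch I := sval (chP I); have chE I s : ch I (c s) = coef I s := svalP (chP I) s.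
exists ch; split=> // [x x0|I x s|F F0].
- apply: sep => n; have [s xs] := dense n x.
  rewrite -[x](subrK (c s)); apply: mult_ofD => //.
  rewrite -(rmorph_nat c) -rmorphXn -(rmorph_nat a) -rmorphXn.
  apply/mult_of_rmorph/coef_mult => I; rewrite -chE.
  rewrite -[c s](subKr x) raddfB /= x0 sub0r; apply: mult_ofN.
  exact: additive_mult_of.
- have fB : {morph (fun s => ch I (c (a x) * s)) : s t / s - t}.
    by move=> u v; rewrite mulrBr raddfB.
  have gB : {morph (fun s => x * ch I s) : s t / s - t}.
    by move=> u v; rewrite raddfB mulrBr.
  apply: (completion_ext_uniq dense (f := additive_of fB) (g := additive_of gB)) => // t /=.
  by rewrite -rmorphM !chE coef_lin.
have NP n : {N | forall I, (N <= mdeg I)%N -> mult_of (p%:R ^+ n) (F I)}.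
  exact/constructive_indefinite_description/F0.
(* Running maxima make the truncation degrees increase, so that consecutive truncations are
   congruent modulo p^n. *)
pose M n := (\max_(i < n.+1) sval (NP i))%N.
have MP n I : (M n <= mdeg I)%N -> mult_of (p%:R ^+ n) (F I).
  move=> leM; apply: (svalP (NP n)); apply: leq_trans leM.
  exact: (leq_bigmax (ord_max : 'I_n.+1)).
have Mle n : (M n <= M n.+1)%N.
  apply/bigmax_leqP => i _; exact: (leq_bigmax (widen_ord (leqnSn n.+1) i)).
pose r n : seq 'X_{1..d} := [seq val i | i <- enum {: 'X_{1..d < M n}}].
have ur n : uniq (r n) by rewrite map_inj_uniq ?enum_uniq //; apply: val_inj.
have rP n I : (I \in r n) = (mdeg I < M n)%N.
  apply/mapP/idP => [[i _ ->]|lt]; first exact: bmdeg.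
  by exists (BMultinom lt); rewrite ?mem_enum.
pose s n := \sum_(J <- r n) a (F J) * monomial y J.
have sE n I : coef I (s n) = if (mdeg I < M n)%N then F I else 0.
  by rewrite coef_sum // rP.
have [n|x xs] := compl (fun n => c (s n)).
  rewrite -rmorphB -(rmorph_nat c) -rmorphXn -(rmorph_nat a) -rmorphXn.
  apply/mult_of_rmorph/coef_mult => I; rewrite raddfB /= !sE.
  case: (ltnP (mdeg I) (M n)) => [lt|le].
    by rewrite (leq_trans lt) // subrr; apply: mult_of0.
  by rewrite subr0; case: ifP => _; [apply: MP | apply: mult_of0].
exists x => I; apply/eqP; rewrite -subr_eq0; apply/eqP/A_sep => n.
rewrite -(subrKA (ch I (c (s n)))) -raddfB; apply: mult_ofD.
  exact: additive_mult_of.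
rewrite chE sE; case: ltnP => [_|le]; first by rewrite subrr; apply: mult_of0.
by rewrite sub0r; apply/mult_ofN/MP.
Qed.

End CompletedCoefficients.
End MonomialBasis.

Lemma scaled_submodule_free (A : comPzRingType) (E E' : lmodType A) d
    (e : 'I_d -> E) (c : 'I_d -> {linear E -> A^o}) (w : A)
    (i : {linear E' -> E}) :
  free_on e c -> (forall a : A, w * a = 0 -> a = 0) -> injective i ->
  (forall y, (exists x, i x = y) <-> exists x, y = w *: x) ->
  exists (e' : 'I_d -> E') (c' : 'I_d -> {linear E' -> A^o}),
    free_on e' c' /\ forall k, i (e' k) = w *: e k.
Proof.
move=> [ce ex] w_reg i_inj im.
have wI a b : w * a = w * b -> a = b.
  by move=> /eqP; rewrite -subr_eq0 -mulrBr => /eqP/w_reg/eqP; rewrite subr_eq0 => /eqP.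
have eP k : {x | i x = w *: e k}.
  by apply/constructive_indefinite_description/im; exists (e k).
have yP x : {y | i x = w *: y}.
  by apply: constructive_indefinite_description; apply/im; exists x.
pose f k x : A^o := c k (sval (yP x)).
have fE k x : w * f k x = c k (i x) by rewrite (svalP (yP x)) linearZ.
have fD k : {morph f k : x y / x + y}.
  by move=> x y; apply: wI; rewrite fE raddfD raddfD mulrDr !fE.
have fZ k a x : f k (a *: x) = a *: f k x.
  by apply: wI; rewrite fE !linearZ /= -fE -[RHS]/(w * (a * f k x)) mulrCA.
exists (fun k => sval (eP k)), (fun k => linear_of (fD k) (fZ k)).
split=> [|k]; last exact: (svalP (eP k)).
split=> [k l|x] /=.
  by apply: wI; rewrite fE (svalP (eP l)) linearZ -ce.
apply: i_inj; rewrite {1}(svalP (yP x)) [sval (yP x)]ex scaler_sumr raddf_sum.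
by apply: eq_bigr => k _; rewrite [RHS]linearZ /= (svalP (eP k)) !scalerA mulrC.
Qed.

(** * Power series coefficients of the completed S^(r) *)

Section HiggsTate.
Variables (p : nat) (p_prime : prime p) (B : base_field p) (X : log_chart B).
Variables (G : galois_cover X) (T : fontaine B) (S : higgs_tate G T).

Lemma Rb_torsionfree (x : Rb G) : p%:R * x = 0 -> x = 0.
Proof.
have [inj _] := Rb_subring G.
have nz : (p%:R : Fa G) != 0.
  rewrite -(rmorph_nat (Kbar_Fa G)) fmorph_eq0 -(rmorph_nat (K_Kbar B)) fmorph_eq0.
  exact/K_natr_neq0/prime_gt0.
move=> px; apply: inj; rewrite rmorph0; apply/eqP.
have /eqP := congr1 (Rb_Fa G) px; rewrite rmorphM rmorph_nat rmorph0 mulf_eq0.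
by rewrite (negPf nz).
Qed.

Lemma Rh_separated : padic_separated p (Rh G).
Proof. by have [] := padic_completionP (Rh_completion G). Qed.

Lemma Rh_complete : padic_complete p (Rh G).
Proof. by have [] := padic_completionP (Rh_completion G). Qed.

Lemma Rh_torsionfree (x : Rh G) : p%:R * x = 0 -> x = 0.
Proof.
have [dense refl sep _] := padic_completionP (Rh_completion G).
exact: (completion_torsionfree dense refl sep Rb_torsionfree).
Qed.

Definition Rh_root m : Rh G := Rb_Rh G (OKb_Rb G (proot B m)).

Lemma Rh_rootX k m : (0 < k)%N -> (0 < m)%N -> Rh_root (k * m) ^+ k = Rh_root m.
Proof. by move=> k0 m0; rewrite /Rh_root -!rmorphXn prootM. Qed.

Lemma Rh_root_exp m : (0 < m)%N -> Rh_root m ^+ m = p%:R.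
Proof. by move=> m0; rewrite /Rh_root -!rmorphXn proot_exp // !rmorph_nat. Qed.

Lemma Rh_root_reg m (x : Rh G) : (0 < m)%N -> Rh_root m * x = 0 -> x = 0.
Proof.
case: m => // m m0 mx; apply: Rh_torsionfree.
by rewrite -(Rh_root_exp m0) exprSr -mulrA mx mulr0.
Qed.

Lemma Rh_root_regX m n (x : Rh G) : (0 < m)%N -> Rh_root m ^+ n * x = 0 -> x = 0.
Proof.
move=> m0; elim: n => [|n IH]; first by rewrite mul1r.
by rewrite exprS -mulrA => /(Rh_root_reg m0).
Qed.

Fact inv_natr_ge0 (m : nat) : 0 <= (m%:R^-1 : rat).
Proof. by rewrite invr_ge0 ler0n. Qed.

(** Every positive r is at least 1/m for m its denominator, so the limit over r > 0 can be taken
    over these exponents, for which p^r is the single root [proot m]. *)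
Definition nnrat_inv (m : nat) : nnrat := NNRat (inv_natr_ge0 m).

Lemma nnrat_inv_gt0 m : (0 < m)%N -> 0 < nnval (nnrat_inv m).
Proof. by move=> m0; rewrite invr_gt0 ltr0n. Qed.

Lemma nnrat_inv_ge0 m : nnval nn0 <= nnval (nnrat_inv m).
Proof. exact: inv_natr_ge0. Qed.

Lemma ppow_nnrat_inv m : (0 < m)%N -> ppow B (nnrat_inv m) = proot B m.
Proof.
move=> m0; rewrite /ppow /=.
have -> : (m%:R^-1 : rat) = 1%:~R / m%:Z%:~R by rewrite mul1r.
rewrite coprimeq_num ?coprimeq_den ?coprime1n //.
by rewrite eqz_nat eqn0Ngt m0 gtr0_sg ?ltz_nat // mulr1 expr1.
Qed.

Lemma ppow_nn0 : ppow B nn0 = 1.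
Proof. by []. Qed.

Lemma nnrat_inv_le (r : nnrat) : 0 < nnval r ->
  exists2 m, (0 < m)%N & nnval (nnrat_inv m) <= nnval r.
Proof.
case: r => r r_ge0 /= r0; exists `|denq r|%N; first by rewrite absz_gt0 denq_neq0.
rewrite -[X in _ <= X]divq_num_den natr_absz ger0_norm ?denq_ge0 //.
rewrite -[X in X <= _]mul1r ler_pM2r ?invr_gt0 ?ltr0z ?denq_gt0 //.
by rewrite ler1z -gtz0_ge1 numq_gt0.
Qed.

Hypothesis Rh_nz : 1 <> 0 :> Rh G.
Variables (d : nat) (om : 'I_d -> Omega X) (com : 'I_d -> {linear Omega X -> (ringR X)^o}).
Hypothesis om_free : free_on om com.
Variables (de : xiD T) (cde : {linear xiD T -> (OC B)^o}).
Hypothesis de_free : free_rank1 de cde.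

Lemma Er_free r : (forall x : Rh G, Rb_Rh G (OKb_Rb G (ppow B r)) * x = 0 -> x = 0) ->
  exists (e : 'I_d -> Er S r) (c : 'I_d -> {linear Er S r -> (Rh G)^o}),
    free_on e c /\ forall k, Er_E S r (e k) = Rb_Rh G (OKb_Rb G (ppow B r)) *: eE S (om k) de.
Proof.
move=> reg; have [c cP] := mixed_tensor_free (E_tensor S) om_free de_free.
exact: scaled_submodule_free cP reg (@Er_inj _ _ _ _ _ S r) (@Er_image _ _ _ _ _ S r).
Qed.

Lemma Sh0_coef : exists coef : 'X_{1..d} -> {additive Sh S nn0 -> Rh G},
  [/\ forall x, (forall I, coef I x = 0) -> x = 0,
      forall I x s, coef I (Sr_Sh S nn0 (Rh_Sr S nn0 x) * s) = x * coef I s,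
      forall I x, coef I (Sr_Sh S nn0 (Rh_Sr S nn0 x)) = x * (I == 0%MM)%:R,
      forall (h : 'I_d -> {linear ESh S -> (Sh S nn0)^o}),
        free_on (fun k => eESh S (om k) de) h ->
        forall I k x, coef I (h k (dSh x)) = (I k).+1%:R * coef (I + U_(k))%MM x
    & forall m, (0 < m)%N ->
      exists coefm : 'X_{1..d} -> {additive Sh S (nnrat_inv m) -> Rh G},
      [/\ forall h I x, coef I (Sh_le S (r := nn0) h x) = Rh_root m ^+ mdeg I * coefm I x,
        forall x, (forall I, coefm I x = 0) -> x = 0 &
        forall F : 'X_{1..d} -> Rh G,
        (forall n, exists N, forall I, (N <= mdeg I)%N -> mult_of (p%:R ^+ n) (F I)) ->
        exists x, forall I, coefm I x = F I]].
Proof.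
have reg0 (x : Rh G) : Rb_Rh G (OKb_Rb G (ppow B nn0)) * x = 0 -> x = 0.
  by rewrite ppow_nn0 !rmorph1 mul1r.
have [e [c [ec eE0]]] := Er_free reg0.
have [coef basis] := symmetric_algebra_basis Rh_nz ec (Sr_sym S nn0).
have [coefh [chE ch_inj ch_lin _]] := completed_coef basis (Sh_completion S nn0) Rh_separated Rh_complete.
exists coefh; split=> //.
- move=> I x; rewrite chE -[Rh_Sr S nn0 x]mulr1 -(monomial0 (fun i => Er_Sr (e i))).
  by have [-> _] := basis.
- move=> h hP I k x.
  have [hS hSP] := mixed_tensor_free (ES_tensor S) om_free de_free.
  have [dSD dSM dSc] := dS_der S.
  have [shD shM shc] := dSh_der S.
  have [[uD uZ] uE] := ES_EShP S.
  have fB : {morph (fun x => coefh I (h k (dSh x))) : s t / s - t}.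
    move=> s t; have -> : dSh (s - t) = dSh s - dSh t :> ESh S by exact: (raddfB (additive_ofD shD)).
    by rewrite !raddfB.
  have gB : {morph (fun x => (I k).+1%:R * coefh (I + U_(k))%MM x) : s t / s - t}.
    by move=> s t; rewrite raddfB mulrBr.
  have [dense _ _ _] := padic_completionP (Sh_completion S nn0).
  apply: (completion_ext_uniq dense (f := additive_of fB) (g := additive_of gB)) => [|s /=].
    exact: Rh_separated.
  have [hh hE] := hP; have [hhS hSE] := hSP.
  have u0 : @ES_ESh _ _ _ _ _ S 0 = 0 by apply: (addrI (@ES_ESh _ _ _ _ _ S 0)); rewrite -uD !addr0.
  have -> : h k (dSh (Sr_Sh S nn0 s)) = Sr_Sh S nn0 (hS k (dS s)).
    rewrite dSh_ext {1}(hSE (dS s)) (big_morph _ uD u0) raddf_sum (bigD1 k) //=.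
    rewrite uZ uE linearZ /= hh eqxx big1 ?addr0 => [|i ik].
      exact: mulr1.
    by rewrite uZ uE linearZ /= hh eq_sym (negPf ik); apply: mulr0.
  rewrite !chE.
  have DB : {morph (fun s => hS k (dS s) : Sr S nn0) : s t / s + t}.
    by move=> s' t; rewrite dSD raddfD.
  apply: (coef_derivation basis (k := k) (D := additive_ofD DB)) => [s' t|x'|l] /=.
  - by rewrite dSM raddfD /= !linearZ.
  - by rewrite dSc raddf0.
  rewrite dS_univ eE0 ppow_nn0 !rmorph1 scale1r.
  by have [_ ->] := E_ESP S; rewrite hhS eq_sym.
move=> m m0.
have regm (x : Rh G) : Rb_Rh G (OKb_Rb G (ppow B (nnrat_inv m))) * x = 0 -> x = 0.
  by rewrite ppow_nnrat_inv //; apply: Rh_root_reg.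
have [em [cm [ecm eEm]]] := Er_free regm.
have [coefm basism] := symmetric_algebra_basis Rh_nz ecm (Sr_sym S (nnrat_inv m)).
have [coefmh [cmhE cmh_inj cmh_lin cmh_surj]] :=
  completed_coef basism (Sh_completion S (nnrat_inv m)) Rh_separated Rh_complete.
exists coefmh; split=> // h I x.
have fB : {morph (fun x => coefh I (Sh_le S h x)) : s t / s - t}.
  by move=> s t; rewrite rmorphB raddfB.
have gB : {morph (fun x => Rh_root m ^+ mdeg I * coefmh I x) : s t / s - t}.
  by move=> s t; rewrite raddfB mulrBr.
have [dense _ _ _] := padic_completionP (Sh_completion S (nnrat_inv m)).
apply: (completion_ext_uniq dense (f := additive_of fB) (g := additive_of gB)) => [|s /=].
  exact: Rh_separated.
rewrite Sh_leE chE cmhE.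
apply: (coef_rescale basism basis) => [y|i]; first exact: Sr_le_Rh.
have [_ sgZ] := (Sr_sym S nn0).1.
rewrite (@Sr_le_Er _ _ _ _ _ S _ _ h _ (Rh_root m *: e i)) ?sgZ //.
by rewrite eEm ppow_nnrat_inv // linearZ /= eE0 ppow_nn0 !rmorph1 scale1r.
Qed.

End HiggsTate.

Section OverconvergentCoefficients.
Variables (p : nat) (p_prime : prime p) (B : base_field p) (X : log_chart B).
Variables (G : galois_cover X) (T : fontaine B) (S : higgs_tate G T).
Hypothesis Rh_nz : 1 <> 0 :> Rh G.
Variables (d : nat) (om : 'I_d -> Omega X) (com : 'I_d -> {linear Omega X -> (ringR X)^o}).
Hypothesis om_free : free_on om com.
Variables (de : xiD T) (cde : {linear xiD T -> (OC B)^o}).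
Hypothesis de_free : free_rank1 de cde.

Lemma Sd_coef : exists coef : 'X_{1..d} -> {additive Sd S -> Rh G},
  [/\ forall x, (forall I, coef I x = 0) -> x = 0,
      forall I a x, coef I (Rh_Sd S a * x) = a * coef I x,
      forall I a, coef I (Rh_Sd S a) = a * (I == 0%MM)%:R,
      forall (h : 'I_d -> {linear ESd S -> (Sd S)^o}),
        free_on (fun k => eESd S (om k) de) h ->
        forall I k x, coef I (h k (dSd x)) = (I k).+1%:R * coef (I + U_(k))%MM x
    & forall F : 'X_{1..d} -> Rh G,
        (exists x, forall I, coef I x = F I) <->
        (exists m F', (0 < m)%N /\ forall I, F I = Rh_root G m ^+ mdeg I * F' I)].
Proof.
have [ch [ch_inj ch_lin ch_const ch_der ch_le]] :=
  Sh0_coef p_prime S Rh_nz om_free de_free.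
have r1 := nnrat_inv_gt0 (ltn0Sn 0).
have Sd_Rh a : Sd_Sh S (Rh_Sd S a) = Sr_Sh S nn0 (Rh_Sr S nn0 a).
  by rewrite (Rh_SdE S r1) (Sd_ShE r1 (nnrat_inv_ge0 1)) Sh_leE Sr_le_Rh.
have Sd_inv x : exists2 m, (0 < m)%N &
    exists h (y : Sh S (nnrat_inv m)), Sh_Sd S h y = x.
  have [r [h0 [y <-]]] := Sd_lim x; have [m m0 mr] := nnrat_inv_le h0.
  exists m => //; exists (nnrat_inv_gt0 m0), (Sh_le S mr y).
  exact: Sh_SdE.
(* An element of level 1/m has its coefficients multiplied by the regular elements p^(|I|/m) at
   level 0, so a nonzero one cannot die there. *)
have Sd_inj x : Sd_Sh S x = 0 -> x = 0.
  have [m m0 [h [y <-]]] := Sd_inv x; have [cm [cmE cm_inj _]] := ch_le m m0.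
  rewrite (Sd_ShE h (nnrat_inv_ge0 m)) => y0.
  suff -> : y = 0 by rewrite rmorph0.
  apply: cm_inj => I; apply: (Rh_root_regX p_prime (n := mdeg I) m0).
  by rewrite -(cmE (nnrat_inv_ge0 m)) y0 raddf0.
exists (fun I => (ch I \o Sd_Sh S : {additive Sd S -> Rh G})); split=> /=.
- by move=> x x0; apply/Sd_inj/ch_inj.
- by move=> I a x; rewrite rmorphM Sd_Rh ch_lin.
- by move=> I a; rewrite Sd_Rh ch_const.
- move=> h [hh hE] I k x.
  have [h' h'P] := mixed_tensor_free (ESh_tensor S) om_free de_free.
  have [h'h h'E] := h'P.
  rewrite -(ch_der h' h'P) -dSd_restr {2}(hE (dSd x)).
  have [[uD uZ] uE] := ESd_EShP S.
  have u0 : ESd_ESh (0 : ESd S) = 0 by apply: (addrI (ESd_ESh (0 : ESd S))); rewrite -uD !addr0.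
  rewrite (big_morph _ uD u0) raddf_sum (bigD1 k) //= uZ uE linearZ /= h'h eqxx.
  rewrite big1 ?addr0 => [|i ik].
    by congr (ch I _); symmetry; apply: mulr1.
  by rewrite uZ uE linearZ /= h'h eq_sym (negPf ik); apply: mulr0.
move=> F; split=> [[x xF]|[m [F' [m0 FE]]]].
  have [m m0 [h [y yx]]] := Sd_inv x; have [cm [cmE _ _]] := ch_le m m0.
  exists m, (fun I => cm I y); split=> // I.
  by rewrite -xF -yx (Sd_ShE h (nnrat_inv_ge0 m)) cmE.
(* Level 1/m would need F' to tend to 0. At level 1/(2m) the coefficients to realise are
   p^(|I|/(2m)) F'_I, which do. *)
have m2 : (0 < 2 * m)%N by rewrite muln_gt0.
have [cm [cmE _ cm_surj]] := ch_le (2 * m)%N m2.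
have [n|y yF] := cm_surj (fun I => Rh_root G (2 * m) ^+ mdeg I * F' I).
  exists (2 * m * n)%N => I leI; apply: mult_ofMr.
  by rewrite -(Rh_root_exp G m2) -exprM; apply: mult_of_exp.
exists (Sh_Sd S (nnrat_inv_gt0 m2) y) => I.
rewrite (Sd_ShE _ (nnrat_inv_ge0 _)) cmE yF mulrA -exprD addnn -mul2n exprM.
by rewrite Rh_rootX.
Qed.

End OverconvergentCoefficients.

(** As images of integers these minors can be moved through additive maps, in particular derivations
    and coefficient functionals. *)
Lemma kronecker_det_intr (A : comPzRingType) d n (J J' : {ffun 'I_n -> 'I_d}) :
  kronecker_det A J J' = (kronecker_det int J J')%:~R.
Proof.
rewrite /kronecker_det -det_map_mx; congr (\det _); apply/matrixP => a b.
by rewrite !mxE rmorph_nat.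
Qed.

(** * Coordinates of the Dolbeault complex *)

Section DolbeaultCoordinates.
Variables (p : nat) (p_prime : prime p) (B : base_field p) (X : log_chart B).
Variables (G : galois_cover X) (T : fontaine B) (S : higgs_tate G T) (D : dolbeault S).
Variables (d : nat) (om : 'I_d -> Omega X) (com : 'I_d -> {linear Omega X -> (ringR X)^o}).
Hypothesis om_free : free_on om com.
Variables (de : xiD T) (cde : {linear xiD T -> (OC B)^o}).
Hypothesis de_free : free_rank1 de cde.
Variable h : 'I_d -> {linear ESd S -> (Sd S)^o}.
Hypothesis h_free : free_on (fun k => eESd S (om k) de) h.
Hypothesis h_additive : forall k, {morph (fun x => h k (dSd x) : Sd S) : x y / x + y}.

Definition KK_base q (J : {ffun 'I_q -> 'I_d}) : KK D q :=
  kk (ext_alt D [ffun a => om (J a)]) (tens_pow D [ffun=> de]).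

(** Products of minors on [OmegaExt] and the coordinate of the twist. The factor q! stays on both
    sides of the last formula and is cancelled later on coefficients, which lie in a torsion-free
    ring. *)
Lemma KK_coords : exists phi : forall q, {ffun 'I_q -> 'I_d} -> {linear KK D q -> (Sd S)^o},
  [/\ forall q x, (q`!)%:R *: x = \sum_J (phi q J x : Sd S) *: KK_base J,
      forall q J J', phi q J (KK_base J') = kronecker_det (Sd S) J J',
      forall q J s x, phi q (permf s J) x = (-1) ^+ (odd_perm s) * (phi q J x : Sd S)
    & forall q J x, (q`!)%:R * (phi q.+1 J (dKK D q x) : Sd S) = (q`!)%:R *
        \sum_(s < q.+1) (-1) ^+ s * (h (J s) (dSd (phi q (omitf s J) x : Sd S)) : Sd S)].
Proof.
pose f := Rh_Sd S \o (Rb_Rh G \o R_Rb G) : {rmorphism ringR X -> Sd S}.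
pose g := Rh_Sd S \o OC_Rh G : {rmorphism OC B -> Sd S}.
have psiP q : {psi : {ffun 'I_q -> 'I_d} -> {linear OmegaExt D q -> (ringR X)^o} |
    (forall J v, psi J (ext_alt D v) = \det (minor_mx com J v)) /\
    (forall x, (q`!)%:R *: x = \sum_J (psi J x : ringR X) *: ext_alt D [ffun a => om (J a)])}.
  exact/constructive_indefinite_description/(exterior_power_coords om_free)/alt_ext.
have CP q : {C : {linear xiDTens D q -> (OC B)^o} |
    (forall v, C (tens_pow D v) = \prod_i (cde (v i) : OC B)) /\
    forall x, x = (C x : OC B) *: tens_pow D [ffun=> de]}.
  exact/constructive_indefinite_description/(tensor_power_rank1 de_free)/tens_power.
have phiP q J : {phi : {linear KK D q -> (Sd S)^o} |
    forall x y, phi (kk x y) = f (sval (psiP q) J x) * g (sval (CP q) y)}.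
  exact/constructive_indefinite_description/(mixed_tensor_coord (f := f) (g := g))/KK_tensor.
pose phi q J := sval (phiP q J).
have phiE q J x y : phi q J (kk x y) = f (sval (psiP q) J x) * g (sval (CP q) y) :=
  svalP (phiP q J) x y.
have C1 q : sval (CP q) (tens_pow D [ffun=> de]) = 1.
  have [CE _] := svalP (CP q); rewrite CE big1 // => i _; rewrite ffunE.
  by have [] := de_free.
have expand q (x : KK D q) : (q`!)%:R *: x = \sum_J (phi q J x : Sd S) *: KK_base J.
  have [psiE psi_ex] := svalP (psiP q); have [_ C_ex] := svalP (CP q).
  apply: (mixed_tensor_expand (f := f) (g := g) (KK_tensor D q)
    (phi := sval (psiP q)) (c0 := sval (CP q))) => //.
  by move=> w; exists (q`!)%:R; rewrite ?rmorph_nat.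
have base q J J' : phi q J (KK_base J') = kronecker_det (Sd S) J J'.
  rewrite phiE C1 rmorph1 mulr1; have [-> _] := svalP (psiP q).
  by rewrite (minor_basis om_free) kronecker_det_intr rmorph_int -kronecker_det_intr.
exists phi; split=> // [q J s x|q J x].
  have LD : {morph (fun x => (-1) ^+ (odd_perm s) * (phi q J x : Sd S) : (Sd S)^o) : x y / x + y}.
    by move=> y z; rewrite raddfD mulrDr.
  have LZ a y : (-1) ^+ (odd_perm s) * (phi q J (a *: y) : Sd S) =
      a *: ((-1) ^+ (odd_perm s) * (phi q J y : Sd S) : (Sd S)^o).
    by rewrite linearZ; apply: mulrCA.
  rewrite -[RHS]/(linear_of LD LZ x).
  apply: (mixed_tensor_uniq (f := f) (g := g) (KK_tensor D q)) => w y /=.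
  rewrite !phiE mulrA; congr (_ * _); have [psiE _] := svalP (psiP q).
  rewrite -(rmorph1 f) -rmorphN -rmorphXn -rmorphM; congr (f _).
  have MD : {morph (fun x => (-1) ^+ (odd_perm s) * (sval (psiP q) J x : ringR X) : (ringR X)^o) : x y / x + y}.
    by move=> y' z; rewrite raddfD mulrDr.
  have MZ a y' : (-1) ^+ (odd_perm s) * (sval (psiP q) J (a *: y') : ringR X) =
      a *: ((-1) ^+ (odd_perm s) * (sval (psiP q) J y' : ringR X) : (ringR X)^o).
    by rewrite linearZ; apply: mulrCA.
  rewrite -[RHS]/(linear_of MD MZ w); apply: (exterior_power_uniq (alt_ext D q) (f := sval (psiP q) (permf s J)) (g := linear_of MD MZ)) => v /=.
  by rewrite !psiE minor_perm.
have hD k : {additive Sd S -> Sd S} := additive_ofD (h_additive k).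
have hE k y : h k (dSd y) = additive_ofD (h_additive k) y by [].
have C1S : sval (CP q.+1) (tens_cons D q de (tens_pow D [ffun=> de])) = 1.
  rewrite tens_consE; have [-> _] := svalP (CP q.+1).
  apply: big1 => i _; rewrite ffunE; have [c1 _] := de_free.
  by case: unliftP => [j _|_]; rewrite ?ffunE.
have [psiE _] := svalP (psiP q.+1).
have phi_cons k (J' : {ffun 'I_q -> 'I_d}) : phi q.+1 J (kk (ext_cons D q (om k) (ext_alt D [ffun a => om (J' a)]))
      (tens_cons D q de (tens_pow D [ffun=> de]))) =
    \sum_(s < q.+1) (-1) ^+ s * (J s == k)%:R * kronecker_det (Sd S) (omitf s J) J'.
  rewrite phiE C1S rmorph1 mulr1 ext_consE psiE (minor_consf _ _ _ om_free) rmorph_sum.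
  apply: eq_bigr => s _; rewrite !rmorphM rmorphXn rmorphN rmorph1 rmorph_nat.
  by rewrite (minor_basis om_free) kronecker_det_intr rmorph_int -kronecker_det_intr.
(* [dKK] is given on scalar multiples of pure tensors, so it is evaluated on the expansion of q!
   x. *)
transitivity (phi q.+1 J (\sum_(J' : {ffun 'I_q -> 'I_d}) kk_wedge (ext_alt D [ffun a => om (J' a)])
    (tens_pow D [ffun=> de]) (dSd (phi q J' x : Sd S)))).
  rewrite -[LHS]/((q`!)%:R *: (phi q.+1 J (dKK D q x))) -linearZ /=; congr (phi _ _ _).
  rewrite scaler_nat -raddfMn -scaler_nat expand raddf_sum; apply: eq_bigr => J' _.
  exact: dKKE.
rewrite raddf_sum mulr_sumr.
have wedge (J' : {ffun 'I_q -> 'I_d}) : phi q.+1 J (kk_wedge (ext_alt D [ffun a => om (J' a)])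
    (tens_pow D [ffun=> de]) (dSd (phi q J' x : Sd S))) =
  \sum_(s < q.+1) (-1) ^+ s * (h (J s) (dSd (phi q J' x : Sd S)) : Sd S) *
    kronecker_det (Sd S) (omitf s J) J'.
  have [_ h_ex] := h_free.
  rewrite {1}(h_ex (dSd _)) !raddf_sum /=.
  transitivity (\sum_k \sum_(s < q.+1) (h k (dSd (phi q J' x : Sd S)) : Sd S) *
     ((-1) ^+ s * (J s == k)%:R * kronecker_det (Sd S) (omitf s J) J')).
    apply: eq_bigr => k _; rewrite -mulr_sumr -phi_cons linearZ linearZ /= wedgeE.
    by [].
  rewrite exchange_big; apply: eq_bigr => s _; rewrite (bigD1 (J s)) //= eqxx mulr1.
  rewrite big1 ?addr0 => [|k kJ]; last by rewrite eq_sym (negPf kJ) mulr0 mul0r mulr0.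
  by rewrite mulrA [_ * (-1) ^+ s]mulrC.
rewrite (eq_bigr _ (fun J' _ => wedge J')) exchange_big; apply: eq_bigr => s _.
rewrite mulrCA (eq_bigr (fun J' => (-1) ^+ s * ((h (J s) (dSd (phi q J' x : Sd S)) : Sd S) *
    kronecker_det (Sd S) (omitf s J) J'))) => [|J' _]; last by rewrite mulrA.
rewrite -mulr_sumr; congr (_ * _); rewrite hE mulr_natl -raddfMn.
(* Applying the coordinate at [omitf s J] to the expansion of q! x; the minors that appear are
   integers and pass through the derivation. *)
have -> : (phi q (omitf s J) x : Sd S) *+ q`! =
    \sum_(J' : {ffun 'I_q -> 'I_d}) (phi q J' x : Sd S) * kronecker_det (Sd S) (omitf s J) J'.
  transitivity (phi q (omitf s J) ((q`!)%:R *: x) : Sd S).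
    by rewrite linearZ /=; apply: esym (mulr_natl _ _).
  rewrite expand linear_sum; apply: eq_bigr => J' _.
  by rewrite linearZ /= base.
rewrite raddf_sum; apply: eq_bigr => J' _.
by rewrite kronecker_det_intr mulrzr hE -raddfMz mulrzr.
Qed.

End DolbeaultCoordinates.

(** * The Poincaré lemma *)

Section FormalForms.
Variables (d : nat) (Q : comPzRingType).
Implicit Types (I : 'X_{1..d}) (a : 'X_{1..d} -> Q).

Definition pderiv k a I : Q := (I k).+1%:R * a (I + U_(k))%MM.
Definition pmulX k a I : Q := if (0 < I k)%N then a (I - U_(k))%MM else 0.

Lemma pderivC j k a I : pderiv j (pderiv k a) I = pderiv k (pderiv j a) I.
Proof.
rewrite /pderiv !mulrA !mnmDE !mnm1E -!addmA [(U_(j) + _)%MM]addmC; congr (_ * _).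
by have [->|jk] := eqVneq j k; rewrite ?(eq_sym k j) ?(negPf jk) ?addn0 // mulrC.
Qed.

Lemma pderivX j k a I :
  pderiv j (pmulX k a) I = (j == k)%:R * a I + pmulX k (pderiv j a) I.
Proof.
rewrite /pderiv /pmulX mnmDE mnm1E; have [<-|jk] := eqVneq j k.
  rewrite addn1 /= addmK mul1r; case: ifP => Ij.
    rewrite submK ?lep1mP -?lt0n // mnmBE mnm1E eqxx subn1 prednK //.
    by rewrite -natr1 mulrDl mul1r addrC.
  by move: Ij; rewrite lt0n => /negbFE/eqP ->; rewrite mul1r addr0.
rewrite addn0 mul0r add0r; case: ifP => Ik; last by rewrite mulr0.
rewrite mnmBE mnm1E eq_sym (negPf jk) subn0; congr (_ * a _).
by apply/mnmP => i; rewrite !(mnmDE, mnmBE, mnm1E) addnBAC //;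
   have [<-|//] := eqVneq k i.
Qed.

Lemma pmulX_pderiv k a I : pmulX k (pderiv k a) I = (I k)%:R * a I.
Proof.
rewrite /pmulX /pderiv; case: ifP => Ik.
  by rewrite submK ?lep1mP -?lt0n // mnmBE mnm1E eqxx subn1 prednK.
by move: Ik; rewrite lt0n => /negbFE/eqP ->; rewrite mul0r.
Qed.

Lemma pmulX_sum k (T : finType) (F : T -> 'X_{1..d} -> Q) I :
  pmulX k (fun I => \sum_t F t I) I = \sum_t pmulX k (F t) I.
Proof. by rewrite /pmulX; case: ifP => // _; rewrite big1. Qed.

Lemma pmulX_scale k (u : Q) a I : pmulX k (fun I => u * a I) I = u * pmulX k a I.
Proof. by rewrite /pmulX; case: ifP => // _; rewrite mulr0. Qed.

Lemma pderiv_sum k (T : finType) (F : T -> 'X_{1..d} -> Q) I :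
  pderiv k (fun I => \sum_t F t I) I = \sum_t pderiv k (F t) I.
Proof. by rewrite /pderiv mulr_sumr. Qed.

Lemma pderiv_scale k (u : Q) a I : pderiv k (fun I => u * a I) I = u * pderiv k a I.
Proof. by rewrite /pderiv mulrCA. Qed.

(* [c J I] is the coefficient of [y^I] in the component of the form [c] on the
   basis elements indexed by [J]. *)
Definition ps_form q := {ffun 'I_q -> 'I_d} -> 'X_{1..d} -> Q.

Definition form_d q (c : ps_form q) : ps_form q.+1 := fun J I =>
  \sum_(s < q.+1) (-1) ^+ s * pderiv (J s) (c (omitf s J)) I.

Definition form_alt q (c : ps_form q) : Prop :=
  forall J s I, c (permf s J) I = (-1) ^+ (odd_perm s) * c J I.

Definition form_euler q (c : ps_form q.+1) : ps_form q := fun J I =>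
  \sum_k pmulX k (c (consf k J)) I.

Hypothesis Q_tf : nat_torsionfree Q.

(** Exchanging the order of the two omissions preserves the second derivative and reverses the sign,
    so the double sum is its own negative; 2 is cancelled by torsion-freeness. *)
Lemma form_dd q (c : ps_form q) J I : form_d (form_d c) J I = 0.
Proof.
pose Om := {: 'I_q.+2 * 'I_q.+1}.
pose H (x : Om) := pderiv (J x.1) (pderiv (J (lift x.1 x.2)) (c (omitf x.2 (omitf x.1 J)))) I.
pose F (x : Om) := (-1) ^+ (x.1 + x.2) * H x.
have -> : form_d (form_d c) J I = \sum_x F x.
  rewrite (eq_bigr (fun x : Om => F (x.1, x.2))) => [|[] //].
  rewrite -(pair_bigA _ (fun s t => F (s, t))) /=; apply: eq_bigr => s _.
  rewrite pderiv_sum mulr_sumr; apply: eq_bigr => t _.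
  by rewrite pderiv_scale mulrA /F exprD /H [omitf s J t]ffunE.
(* Omits the same two positions in the other order. The default value is never taken, since lift s t
   differs from s. *)
pose rho (x : Om) : Om := (lift x.1 x.2, odflt x.2 (unlift (lift x.1 x.2) x.1)).
have rhoE x : lift (rho x).1 (rho x).2 = x.1.
  by rewrite /rho /=; case: unliftP => [j //|/eqP]; rewrite (negPf (neq_lift _ _)).
have rhoK : involutive rho.
  move=> x; have e1 : (rho (rho x)).1 = x.1 := rhoE x.
  have := rhoE (rho x); rewrite e1 => /lift_inj e2.
  by rewrite [LHS]surjective_pairing e1 e2 -surjective_pairing.
have val_rho x : ((rho x).1 + (rho x).2 = x.1 + x.2 + 1 \/
    (rho x).1 + (rho x).2 + 1 = x.1 + x.2)%N.
  have := congr1 val (rhoE x); rewrite /= /bump; case: x => [s t] /=.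
  by rewrite /bump; lia.
have FN x : F (rho x) = - F x.
  have -> : F (rho x) = (-1) ^+ ((rho x).1 + (rho x).2) * H x.
    congr (_ * _); rewrite /H rhoE pderivC /=; congr (pderiv _ (pderiv _ (c _)) _).
    apply/ffunP => k; rewrite !ffunE; congr (J _); apply: val_inj => /=.
    have := congr1 val (rhoE x); rewrite /=; set t' := odflt _ _.
    by case: x @t' => [s t] t' /=; rewrite /bump; lia.
  rewrite /F; have [->|<-] := val_rho x.
    by rewrite addn1 exprS mulN1r mulNr.
  by rewrite addn1 exprS mulN1r mulNr opprK.
have e : \sum_x F x = - \sum_x F x.
  by rewrite [LHS](reindex_inj (inv_inj rhoK)) -sumrN; apply: eq_bigr => x _; apply: FN.
by apply: (Q_tf (n := 2)) => //; rewrite mulr_natl mulr2n {1}e addNr.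
Qed.

(** Bringing the entry at position s to the front is a cycle of sign (-1)^s. *)
Lemma form_alt_front q (c : ps_form q.+1) (J : {ffun 'I_q.+1 -> 'I_d}) (s : 'I_q.+1) I : form_alt c ->
  (-1) ^+ s * c (consf (J s) (omitf s J)) I = c J I.
Proof.
move=> c_alt; have -> : consf (J s) (omitf s J) = permf (lift_perm ord0 s 1) J.
  apply/ffunP => k; rewrite [RHS]ffunE; have [j ->|->] := unliftP ord0 k.
    by rewrite consf_lift ffunE lift_perm_lift perm1.
  by rewrite consf0 lift_perm_id.
rewrite c_alt odd_lift_perm odd_perm1 addbF addFb signr_odd mulrA -exprD addnn.
by rewrite -signr_odd odd_double mul1r.
Qed.

Lemma form_euler_alt q (c : ps_form q.+1) : form_alt c -> form_alt (form_euler c).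
Proof.
move=> c_alt J s I; rewrite /form_euler mulr_sumr; apply: eq_bigr => k _.
have -> : consf k (permf s J) = permf (lift_perm ord0 ord0 s) (consf k J).
  apply/ffunP => i; rewrite [RHS]ffunE; have [j ->|->] := unliftP ord0 i.
    by rewrite lift_perm_lift !consf_lift ffunE.
  by rewrite lift_perm_id !consf0.
rewrite /pmulX; case: ifP => _; last by rewrite mulr0.
by rewrite c_alt odd_lift_perm.
Qed.

(* Cartan's formula for the Euler vector field, whose Lie derivative multiplies
   the coefficients of total weight [n] by [n]. *)
Lemma form_cartan q (g : ps_form q.+1) J I : form_alt g ->
  form_d (form_euler g) J I + form_euler (form_d g) J I = (mdeg I + q.+1)%:R * g J I.
Proof.
move=> g_alt; rewrite /form_d /form_euler.
(* Leibniz rule for y_k g: differentiating y_k contributes only for k = J s and gives g J back, q +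
   1 times in all. *)
rewrite (eq_bigr (fun s : 'I_q.+1 => g J I + \sum_k (-1) ^+ s *
    pmulX k (pderiv (J s) (g (consf k (omitf s J)))) I)) => [|s _]; last first.
  rewrite pderiv_sum mulr_sumr.
  rewrite (eq_bigr (fun k => (-1) ^+ s * ((J s == k)%:R * g (consf k (omitf s J)) I) +
      (-1) ^+ s * pmulX k (pderiv (J s) (g (consf k (omitf s J)))) I)) => [|k _]; last first.
    by rewrite pderivX mulrDr.
  rewrite big_split /= (bigD1 (J s)) //= eqxx mul1r form_alt_front //.
  by rewrite [X in _ + X + _]big1 ?addr0 // => k kJ; rewrite eq_sym (negPf kJ) mul0r mulr0.
rewrite big_split /= sumr_const card_ord -addrA exchange_big -big_split /=.
rewrite natrD mulrDl addrC [RHS]addrC [in RHS]addrC -[g J I *+ _]mulr_natl; congr (_ + _).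
rewrite mdegE natr_sum mulr_suml; apply: eq_bigr => k _.
rewrite -pmulX_pderiv (pmulX_sum k (fun (s : 'I_q.+2) I =>
  (-1) ^+ s * pderiv (consf k J s) (g (omitf s (consf k J))) I)) [X in _ + X = _]big_ord_recl /=.
(* Omitting the inserted k leaves y_k d/dy_k g, whose sum over k is |I| g; the other omissions
   cancel against the remaining Leibniz terms. *)
have om0 : omitf ord0 (consf k J) = J by apply/ffunP => i; rewrite ffunE consf_lift.
rewrite pmulX_scale mul1r consf0 om0 addrCA -big_split big1 ?addr0 // => s _.
rewrite pmulX_scale consf_lift /=.
have -> : omitf (lift ord0 s) (consf k J) = consf k (omitf s J).
  apply/ffunP => i; rewrite omitfE; have [j ->|->] := unliftP ord0 i.
    rewrite consf_lift omitfE.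
    have -> : lift (lift ord0 s) (lift ord0 j) = lift ord0 (lift s j).
      by apply: val_inj; rewrite /= /bump; lia.
    by rewrite consf_lift.
  have -> : lift (lift ord0 s) ord0 = ord0 by apply: val_inj.
  by rewrite !consf0.
by rewrite exprS mulN1r mulNr addrN.
Qed.

(* The primitive is the contraction with the Euler field of the form whose
   coefficients are divided by their weight. *)
Lemma form_poincare q (c g : ps_form q.+1) : form_alt c ->
  (forall J I, form_d c J I = 0) ->
  (forall J I, (mdeg I + q.+1)%:R * g J I = c J I) ->
  form_alt (form_euler g) /\ forall J I, form_d (form_euler g) J I = c J I.
Proof.
move=> c_alt dc gE; have regI n (x y : Q) : (0 < n)%N -> n%:R * x = n%:R * y -> x = y.
  move=> n0 /eqP; rewrite -subr_eq0 -mulrBr => /eqP/(Q_tf n0)/eqP.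
  by rewrite subr_eq0 => /eqP.
have g_alt : form_alt g.
  move=> J s I; apply: (regI (mdeg I + q.+1)%N); first by rewrite addnS.
  by rewrite gE c_alt mulrCA gE.
split=> [|J I]; first exact: form_euler_alt.
rewrite -gE -form_cartan // [form_euler (form_d g) J I]big1 ?addr0 // => k _.
(* g is closed too: a derivative lowers the degree in y by one and raises the form degree by one, so
   all terms of d g carry the same weight and d c = 0 can be divided by it. *)
rewrite /pmulX; case: ifP => // _; apply: (regI (mdeg (I - U_(k))%MM + q.+2)%N).
  by rewrite addnS.
rewrite mulr0 -(dc (consf k J) (I - U_(k))%MM) /form_d mulr_sumr.
apply: eq_bigr => s _; rewrite mulrCA; congr (_ * _).
rewrite /pderiv mulrCA -gE mdegD mdeg1; congr (_ * (_%:R * _)).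
by rewrite addn1 addSnnS.
Qed.

End FormalForms.

(** * Growth conditions on coefficients *)

Section Overconvergence.
Variables (p : nat) (p_prime : prime p) (R Q : comPzRingType) (w : nat -> R).
Variables (iota : {rmorphism R -> Q}) (d : nat).
Hypothesis R_tf : forall x : R, p%:R * x = 0 -> x = 0.
Hypothesis R_unit : forall n, coprime n p -> exists r : R, n%:R * r = 1.
Hypothesis w_exp : forall m, (0 < m)%N -> w m ^+ m = p%:R.
Hypothesis w_mul : forall k m, (0 < k)%N -> (0 < m)%N -> w (k * m) ^+ k = w m.
Hypothesis iotaP : is_localization iota (fun x => exists n, x = p%:R ^+ n).

Lemma natr_torsionfree_unit (A : comPzRingType) n (x : A) (f : {rmorphism R -> A}) :
  (forall y : A, p%:R * y = 0 -> y = 0) -> (0 < n)%N -> n%:R * x = 0 -> x = 0.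
Proof.
move=> tf n0; have [u pu ->] := pfactor_coprime p_prime n0.
have [r ur] : exists r : R, u%:R * r = 1 by apply: R_unit; rewrite coprime_sym.
rewrite natrM natrX -mulrA => H.
have pX k (y : A) : p%:R ^+ k * y = 0 -> y = 0.
  by elim: k => [|k IH]; rewrite ?mul1r // exprS -mulrA => /tf.
apply: (pX (logn p n)); have : f r * (u%:R * (p%:R ^+ logn p n * x)) = 0.
  by rewrite H mulr0.
by rewrite mulrA -(rmorph_nat f) -rmorphM [r * _]mulrC ur rmorph1 mul1r.
Qed.

Lemma R_nat_torsionfree : nat_torsionfree R.
Proof. by move=> n x; apply: (natr_torsionfree_unit idfun). Qed.

Lemma loc_p_unit k : exists u : Q, p%:R ^+ k * u = 1.
Proof.
have [loc _ _] := iotaP; have [|u] := loc (p%:R ^+ k); first by exists k.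
by rewrite rmorphXn rmorph_nat; exists u.
Qed.

Lemma loc_p_reg k (x y : Q) : p%:R ^+ k * x = p%:R ^+ k * y -> x = y.
Proof.
have [u pu] := loc_p_unit k => /(congr1 (fun z => u * z)).
by rewrite !mulrA [u * _]mulrC pu !mul1r.
Qed.

Lemma loc_nat_torsionfree : nat_torsionfree Q.
Proof.
move=> n x; apply: (natr_torsionfree_unit iota) => y py.
by apply: (loc_p_reg (k := 1)); rewrite expr1 py mulr0.
Qed.

Lemma loc_inj x : iota x = 0 -> x = 0.
Proof.
have [_ _ loc] := iotaP => /loc[_ [[n ->] H]].
by elim: n H => [|n IH]; rewrite ?mul1r // exprS -mulrA => /R_tf.
Qed.

Lemma loc_div (x : Q) : exists k a, p%:R ^+ k * x = iota a.
Proof.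
have [_ loc _] := iotaP; have [a [_ [[k ->]]]] := loc x.
by rewrite rmorphXn rmorph_nat mulrC => e; exists k, a.
Qed.

(** The coefficient families of S^dagger[1/p]: a single p^k clears the denominators of all
    coefficients. *)
Definition overconvergent (a : 'X_{1..d} -> Q) : Prop :=
  exists k m (a' : 'X_{1..d} -> R), (0 < m)%N /\
    forall I, p%:R ^+ k * a I = iota (w m ^+ mdeg I * a' I).

Lemma overconvergent_ext a b : (forall I, a I = b I) -> overconvergent a -> overconvergent b.
Proof.
by move=> ab [k [m [a' [m0 aE]]]]; exists k, m, a'; split=> // I; rewrite -ab.
Qed.

(** Brings two families to common constants: p^(1/m) is the m'-th power of p^(1/(m'm)), and the m' -
    1 spare factors per degree go into the new coefficients. *)
Lemma overconvergentM k m (a : 'X_{1..d} -> Q) (a' : 'X_{1..d} -> R) k' m' :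
  (0 < m)%N -> (0 < m')%N ->
  (forall I, p%:R ^+ k * a I = iota (w m ^+ mdeg I * a' I)) ->
  exists a'', forall I, p%:R ^+ (k' + k) * a I = iota (w (m' * m) ^+ mdeg I * a'' I).
Proof.
move=> m0 m'0 aE.
exists (fun I => w (m' * m) ^+ (m'.-1 * mdeg I) * (p%:R ^+ k' * a' I)) => I.
rewrite exprD -mulrA aE mulrA -exprD -mulSn prednK // exprM w_mul //.
by rewrite !rmorphM !rmorphXn rmorph_nat mulrCA.
Qed.

Lemma overconvergentD a b : overconvergent a -> overconvergent b ->
  overconvergent (fun I => a I + b I).
Proof.
move=> [k [m [a' [m0 aE]]]] [l [n [b' [n0 bE]]]].
have [a2 a2E] := overconvergentM l m0 n0 aE.
have [b2 b2E] := overconvergentM k n0 m0 bE.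
exists (l + k)%N, (n * m)%N, (fun I => a2 I + b2 I); split=> [|I].
  by rewrite muln_gt0 n0.
by rewrite mulrDr a2E addnC b2E -rmorphD [(m * n)%N]mulnC mulrDr.
Qed.

Lemma overconvergent0 : overconvergent (fun=> 0).
Proof. by exists 0%N, 1%N, (fun=> 0); split=> // I; rewrite !mulr0 rmorph0. Qed.

Lemma overconvergent_sum (J : finType) (F : J -> 'X_{1..d} -> Q) :
  (forall j, overconvergent (F j)) -> overconvergent (fun I => \sum_j F j I).
Proof.
move=> Fo; suff H (r : seq J) : overconvergent (fun I => \sum_(j <- r) F j I) by [].
elim: r => [|j r IH].
  by apply: overconvergent_ext overconvergent0 => I; rewrite big_nil.
apply: overconvergent_ext (overconvergentD (Fo j) IH) => I.
by rewrite big_cons.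
Qed.

(** The degree rises by one; the missing p^(1/m) is taken from one more p in the denominator, of
    which p^((m-1)/m) is left over. *)
Lemma overconvergent_mulX k a : overconvergent a -> overconvergent (pmulX k a).
Proof.
move=> [l [m [a' [m0 aE]]]].
exists l.+1, m, (fun I : 'X_{1..d} => if (0 < I k)%N then w m ^+ m.-1 * a' (I - U_(k))%MM else 0).
split=> // I; rewrite /pmulX; case: ifP => Ik; last by rewrite !mulr0 rmorph0.
rewrite exprS -mulrA aE -[p%:R](rmorph_nat iota) -rmorphM mulrA -(w_exp m0).
congr (iota _); rewrite mulrA -!exprD; congr (w m ^+ _ * _).
have : mdeg I = (mdeg (I - U_(k))%MM).+1.
  by rewrite -addn1 -(mdeg1 k) -mdegD submK // lep1mP -lt0n.
move=> ->; rewrite addSnnS prednK //; exact: addnC.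
Qed.

(** With f the integer part of s/m: 2^v <= s + n <= (f + 1)(m + n) <= 2^f 2^(m+n), by k < 2^k. *)
Lemma logn_linear_bound m n s : (0 < m)%N ->
  (logn p (s + n) <= s %/ m + (m + n))%N.
Proof.
move=> m0; have [->|sn0] := posnP (s + n)%N; first by rewrite logn0.
rewrite -(leq_exp2l _ _ (ltnSn 1)); set v := logn p _.
have le1 : (2 ^ v <= s + n)%N.
  apply: leq_trans (dvdn_leq sn0 (pfactor_dvdnn p (s + n))).
  by have [->|v0] := posnP v; rewrite ?leq_exp2r ?prime_gt1.
apply: leq_trans le1 _; rewrite expnD.
apply: leq_trans (_ : (s %/ m).+1 * (m + n) <= _)%N; last first.
  by apply: leq_mul; [apply: ltn_expl | apply/ltnW/ltn_expl].
rewrite mulnDr leq_add //; first by apply/ltnW; rewrite -ltn_divLR.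
by rewrite leq_pmull.
Qed.

(* Half of the radius of convergence absorbs the p-part of [mdeg I + n], whose
   valuation grows logarithmically. *)
Lemma overconvergent_div n a : (0 < n)%N -> overconvergent a ->
  exists2 g, overconvergent g & forall I, (mdeg I + n)%:R * g I = a I.
Proof.
move=> n0 [k [m [a' [m0 aE]]]].
have m2 : (0 < 2 * m)%N by rewrite muln_gt0.
(* The additive constant of [logn_linear_bound] at 2m: p^N p^(s/(2m)) is then divisible by s + n,
   whose part prime to p is a unit. *)
pose N := (2 * m + n)%N.
have eP s : {e : R | (s + n)%:R * e = p%:R ^+ N * w (2 * m) ^+ s}.
  apply: constructive_indefinite_description.
  have sn0 : (0 < s + n)%N by rewrite addn_gt0 n0 orbT.
  have [u pu uE] := pfactor_coprime p_prime sn0.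
  have [r ur] : exists r : R, u%:R * r = 1 by apply: R_unit; rewrite coprime_sym.
  have := logn_linear_bound n s m2; move: uE; set l := logn p (s + n) => uE bound.
  exists (r * p%:R ^+ (N + s %/ (2 * m) - l) * w (2 * m) ^+ (s %% (2 * m))).
  rewrite [in LHS]uE natrM natrX {1}/N.
  have -> : u%:R * p%:R ^+ l *
      (r * p%:R ^+ (N + s %/ (2 * m) - l) * w (2 * m) ^+ (s %% (2 * m))) =
      (u%:R * r) * (p%:R ^+ l * p%:R ^+ (N + s %/ (2 * m) - l)) *
      w (2 * m) ^+ (s %% (2 * m)).
    by rewrite !mulrA; congr (_ * _ * _); rewrite mulrAC.
  rewrite ur mul1r -exprD subnKC; last by rewrite addnC.
  rewrite exprD -mulrA; congr (_ * _).
  by rewrite [in RHS](divn_eq s (2 * m)) exprD [(_ %/ _ * _)%N]mulnC exprM w_exp.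
have [u pu] := loc_p_unit (k + N).
exists (fun I => u * iota (w (2 * m) ^+ mdeg I * (sval (eP (mdeg I)) * a' I))).
  exists (k + N)%N, (2 * m)%N, (fun I => sval (eP (mdeg I)) * a' I); split=> // I.
  by rewrite mulrA pu mul1r.
move=> I; apply: (loc_p_reg (k := (k + N)%N)).
rewrite mulrCA [X in _ * X = _]mulrA pu mul1r [(k + N)%N]addnC exprD -mulrA aE.
rewrite -(rmorph_nat iota) -(rmorph_nat iota p) -rmorphXn -!rmorphM; congr (iota _).
rewrite mulrCA [X in _ * X]mulrA (svalP (eP (mdeg I))) mulrCA -!mulrA; congr (_ * _).
by rewrite mulrA -exprD addnn -mul2n exprM w_mul.
Qed.

End Overconvergence.

(** * The rational Dolbeault complex *)

(* The map to the subgroup [P] given by the universal property is a retraction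
   of its inclusion. *)
Lemma scalar_extension_ind (Z B Q : comPzRingType) (zB : Z -> B) (zQ : Z -> Q)
    (M : lmodType B) (U : zmodType) (t : M -> Q -> U) (P : U -> Prop) :
  is_scalar_extension zB zQ t -> (forall x q, P (t x q)) ->
  (forall y z, P y -> P z -> P (y - z)) -> forall z, P z.
Proof.
move=> [[tD tQ tZ] univ] Pt PB.
have P0 : P 0 by rewrite -(subrr (t 0 0)); apply: PB.
have PN y : P y -> P (- y) by rewrite -sub0r; apply: PB.
have PD y z : P y -> P z -> P (y + z) by move=> Py Pz; rewrite -[z]opprK; apply/PB/PN.
(* A boolean version of [P] makes the subgroup a subtype with the choice structure that a [zmodType]
   requires. *)
pose b y : bool := excluded_middle_informative (P y).
have bP y : P y <-> b y by rewrite /b; case: excluded_middle_informative.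
pose V := {y | b y}; pose mk y (Py : P y) : V := exist _ y ((bP y).1 Py).
have VP (v : V) : P (val v) by apply/bP; exact: (valP v).
pose zV : V := mk 0 P0; pose nV (v : V) : V := mk (- val v) (PN _ (VP v)).
pose aV (v w : V) : V := mk (val v + val w) (PD _ _ (VP v) (VP w)).
have aVA : associative aV by move=> u v w; apply: val_inj; apply: addrA.
have aVC : commutative aV by move=> u v; apply: val_inj; apply: addrC.
have aV0 : left_id zV aV by move=> u; apply: val_inj; apply: add0r.
have aVN : left_inverse zV nV aV by move=> u; apply: val_inj; apply: addNr.
pose Vz : zmodType := HB.pack_for zmodType V (GRing.isZmodule.Build V aVA aVC aV0 aVN).
pose u x q : Vz := mk (t x q) (Pt x q).
have [|h hE _] := univ Vz u.
  by split=> [x x' q|x q q'|z x q]; apply: val_inj; [apply: tD | apply: tQ | apply: tZ].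
have vB : {morph (fun z => val (h z : V)) : x y / x - y} by move=> x y; rewrite raddfB.
have [|k _ uniq] := univ U t; first by [].
move=> z; suff -> : z = val (h z : V) by apply: VP.
rewrite -[LHS]/(idfun z) (uniq idfun) // -[RHS]/(additive_of vB z) (uniq (additive_of vB)) //.
by move=> x q /=; rewrite hE.
Qed.

(** * Denominators in Q_p *)

Section PadicIntegers.
Variables (p : nat) (p_prime : prime p) (Z : comPzRingType) (c : {rmorphism int -> Z}).
Hypothesis cP : is_padic_completion p c.

Lemma Zp_nat_neq0 n : (0 < n)%N -> n%:R != 0 :> Z.
Proof.
have [_ refl _ _] := padic_completionP cP => n0; apply/eqP => nZ.
(* If n vanished in Z_p, it would be divisible by p^n > n. *)
have [|z] := refl n n%:R; first by rewrite rmorph_nat nZ; apply: mult_of0.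
move=> /(congr1 absz); rewrite abszM abszX !natz !absz_nat => e.
have : (p ^ n <= n)%N by apply: dvdn_leq => //; apply/dvdnP; exists `|z|%N; rewrite mulnC.
by rewrite leqNgt ltn_expl // prime_gt1.
Qed.

(** An integer a approximates b beyond its own valuation k. A Bézout inverse modulo p of the
    prime-to-p part of a turns b into p^k (1 + p s), and 1 + p s is inverted by successive
    approximation. *)
Lemma Zp_dvd_natX (b : Z) : b != 0 -> exists k b', b * b' = p%:R ^+ k.
Proof.
have [dense refl sep compl] := padic_completionP cP => b0.
have [n nb] : exists n, ~ mult_of (p%:R ^+ n) b.
  apply: NNPP => H; move/eqP: b0; apply; apply: sep => n; apply: NNPP => Hn.
  by apply: H; exists n.
have [a [z baz]] := dense n b.
have bE : b = c a + p%:R ^+ n * z by rewrite -baz addrC subrK.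
have na : ~ mult_of (p%:R ^+ n) a.
  move=> [y ay]; apply: nb; rewrite bE ay rmorphM rmorphXn rmorph_nat -mulrDr.
  by eexists.
have a0 : (0 < `|a|)%N.
  by rewrite absz_gt0; apply/eqP => a0; apply: na; rewrite a0; apply: mult_of0.
have [u pu aE] := pfactor_coprime p_prime a0.
set k := logn p `|a| in aE.
have ltkn : (k < n)%N.
  rewrite ltnNge; apply/negP => lenk; apply: na.
  exists (Num.sg a * (u * p ^ (k - n))%N%:Z).
  rewrite [LHS]intEsg aE [RHS]mulrCA; congr (_ * _).
  by rewrite -!natz -!natrX -!natrM mulnCA -expnD subnKC.
pose m := Num.sg a * u%:Z.
have am : a = p%:R ^+ k * m.
  by rewrite [LHS]intEsg aE /m mulrCA -!natz -natrX -natrM mulnC.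
have u0 : (0 < u)%N by move: a0; rewrite aE muln_gt0 => /andP[].
have [x y xy _] := egcdnP p u0.
have {}xy : (x * u = y * p + 1)%N by rewrite xy gcdnC; move/eqP: pu => ->.
have sg2 : Num.sg a * Num.sg a = 1 by rewrite -expr2 sqr_sg -absz_gt0 a0.
pose s := p%:R ^+ (n - k.+1) * z * c (Num.sg a * x%:Z) + c y%:Z.
have bs : b * c (Num.sg a * x%:Z) = p%:R ^+ k * (1 + p%:R * s).
  have -> : b = p%:R ^+ k * (c m + p%:R * (p%:R ^+ (n - k.+1) * z)).
    rewrite bE am rmorphM rmorphXn rmorph_nat mulrDr; congr (_ + _).
    by rewrite !mulrA -exprSr -exprD subnKC.
  rewrite -mulrA; congr (_ * _); rewrite mulrDl -rmorphM.
  have -> : m * (Num.sg a * x%:Z) = 1 + p%:Z * y%:Z.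
    by rewrite /m mulrACA sg2 mul1r; lia.
  rewrite /s mulrDr rmorphD rmorph1 -addrA; congr (_ + _).
  by rewrite [c (p%:Z * _)]rmorphM -[p%:Z]natz [c p%:R]rmorph_nat addrC !mulrA.
pose h : {additive Z -> Z} := additive_of (mulrBr (1 + p%:R * s)).
have [|t] := padic_successive_approx (h := h) (K := fun=> True) compl sep _ (y := 1) I.
  move=> w _; exists w, (- (s * w)); split=> //=.
  by rewrite mulrDl mul1r mulrN mulrA addrK.
move=> /= t1; exists k, (c (Num.sg a * x%:Z) * t).
by rewrite mulrA bs -mulrA -t1 mulr1.
Qed.

End PadicIntegers.

(** * The rational complex as overconvergent forms *)

Section Resolution.
Variables (p : nat) (p_prime : prime p) (B : base_field p) (X : log_chart B).
Variables (G : galois_cover X) (T : fontaine B) (S : higgs_tate G T) (D : dolbeault S).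

Lemma Rh_natr_unit n : coprime n p -> exists r : Rh G, n%:R * r = 1.
Proof.
move=> /(OK_natr_unit p_prime B)[r rE]; exists (Rb_Rh G (R_Rb G (OK_R X r))).
by have := congr1 (Rb_Rh G \o (R_Rb G \o OK_R X)) rE; rewrite rmorphM rmorph_nat rmorph1.
Qed.

Lemma Zp_Qp_nat_neq0 n : (0 < n)%N -> n%:R != 0 :> Qp D.
Proof.
move=> n0; rewrite -(rmorph_nat (Zp_Qp D)) -(rmorph0 (Zp_Qp D)).
rewrite (inj_eq (@Zp_Qp_inj _ _ _ _ _ _ D)).
exact: (Zp_nat_neq0 p_prime (Zp_completion D) n0).
Qed.

Let pQ k : (p%:R ^+ k : Qp D) != 0.
Proof. by rewrite expf_neq0 // Zp_Qp_nat_neq0 ?prime_gt0. Qed.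

Lemma Qp_denominator (q : Qp D) : exists k a, p%:R ^+ k * q = Zp_Qp D a.
Proof.
have [a [b [b0 ->]]] := Qp_frac q.
have bn : b != 0 by apply: contraNneq b0 => ->; rewrite rmorph0.
have [k [b' e]] := Zp_dvd_natX p_prime (Zp_completion D) bn.
exists k, (b' * a); rewrite -(rmorph_nat (Zp_Qp D)) -rmorphXn -e !rmorphM.
rewrite [Zp_Qp D b * _]mulrC -mulrA [Zp_Qp D b * _]mulrC. by rewrite divfK.
Qed.

Lemma kkq_natr q (x : KK D q) n (u : Qp D) : kkq (n%:R *: x) u = kkq x (n%:R * u).
Proof.
have [[_ _ tZ] _] := KKQ_tensor D q; have := tZ n%:R x u.
by rewrite /= !rmorph_nat.
Qed.

(** Tensoring with Q_p over Z_p amounts to inverting p: a common denominator reduces any sum to one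
    tensor. *)
Lemma KKQ_denominator q (z : KKQ D q) : exists k (x : KK D q), z = kkq x (p%:R ^+ k)^-1.
Proof.
have [[tD tQ tZ] _] := KKQ_tensor D q.
have kkq_expand k j (x : KK D q) :
    kkq x (p%:R ^+ k)^-1 = kkq (p%:R ^+ j *: x) (p%:R ^+ (j + k))^-1.
  have := kkq_natr x (p ^ j) (p%:R ^+ (j + k))^-1; rewrite !natrX => ->.
  by rewrite exprD invfM mulrA divff // mul1r.
apply: (scalar_extension_ind (KKQ_tensor D q)
  (P := fun z => exists k x, z = kkq x (p%:R ^+ k)^-1)) z => [x u|y z].
  have [k [a e]] := Qp_denominator u.
  exists k, ((Rh_Sd S \o (OC_Rh G \o Zp_OC D)) a *: x).
  by rewrite tZ -e mulrAC divff // mul1r.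
move=> [k [x ->]] [j [x' ->]].
exists (j + k)%N, (p%:R ^+ j *: x - p%:R ^+ k *: x').
rewrite (kkq_expand k j) (kkq_expand j k) addnC.
apply/eqP; rewrite subr_eq -tD [(k + j)%N]addnC subrK.
by [].
Qed.

Let Q := RhQ D.
Let io : {rmorphism Rh G -> Q} := Rh_RhQ D.
Let zQ z : Q := io (OC_Rh G (Zp_OC D z)).

Let Q_reg k (x y : Q) : p%:R ^+ k * x = p%:R ^+ k * y -> x = y.
Proof. exact: (loc_p_reg (RhQ_loc D)). Qed.

Let Q_tf : nat_torsionfree Q.
Proof. exact: (loc_nat_torsionfree p_prime Rh_natr_unit (RhQ_loc D)). Qed.

(** If p^k x = a with a in Z_p, then x goes to a/p^k; the choice of k and a is immaterial because
    powers of p are cancellable in the target. It makes the coordinates balanced maps on [KK] x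
    [Qp]. *)
Lemma Qp_to_RhQ : exists mu : Qp D -> Q,
  [/\ forall x y, mu (x + y) = mu x + mu y, forall z x, mu (Zp_Qp D z * x) = zQ z * mu x
    & mu 1 = 1].
Proof.
have kaP x : {ka : nat * Defs.Zp D | p%:R ^+ ka.1 * x = Zp_Qp D ka.2}.
  apply: constructive_indefinite_description.
  by have [k [a e]] := Qp_denominator x; exists (k, a).
have uP k : {u : Q | p%:R ^+ k * u = 1}.
  exact/constructive_indefinite_description/(loc_p_unit (RhQ_loc D)).
pose mu x : Q := sval (uP (sval (kaP x)).1) * zQ (sval (kaP x)).2.
have zQM a b : zQ (a * b) = zQ a * zQ b by rewrite /zQ !rmorphM.
have zQp k : zQ (p%:R ^+ k) = p%:R ^+ k by rewrite /zQ !rmorphXn !rmorph_nat.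
have muE k a x : p%:R ^+ k * x = Zp_Qp D a -> p%:R ^+ k * mu x = zQ a.
  move=> kx; rewrite /mu; case: (kaP x) => -[j b] /= jx; case: (uP j) => u /= ju.
  apply: (Q_reg (k := j)); rewrite mulrCA [X in _ * X]mulrA ju mul1r -!zQp -!zQM.
  congr zQ; apply: (@Zp_Qp_inj _ _ _ _ _ _ D).
  by rewrite !rmorphM -kx -jx !rmorphXn !rmorph_nat mulrCA.
exists mu; split=> [x y|z x|].
- have [[j [a ja]] [k [b kb]]] := (Qp_denominator x, Qp_denominator y).
  apply: (Q_reg (k := (j + k)%N)); rewrite mulrDr.
  have -> : p%:R ^+ (j + k) * mu x = zQ (p%:R ^+ k * a).
    by rewrite zQM -(muE _ _ _ ja) zQp addnC exprD mulrA.
  have -> : p%:R ^+ (j + k) * mu y = zQ (p%:R ^+ j * b).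
    by rewrite zQM -(muE _ _ _ kb) zQp exprD mulrA.
  rewrite (muE _ (p%:R ^+ k * a + p%:R ^+ j * b)); first by rewrite /zQ !rmorphD.
  rewrite mulrDr rmorphD !rmorphM !rmorphXn !rmorph_nat -ja -kb exprD.
  by rewrite !mulrA [p%:R ^+ k * p%:R ^+ j]mulrC.
- have [k [a ka]] := Qp_denominator x; apply: (Q_reg (k := k)).
  rewrite (muE _ (z * a)); first by rewrite zQM -(muE _ _ _ ka) mulrCA.
  by rewrite mulrCA ka rmorphM.
rewrite -[LHS]mul1r -(expr0 p%:R) (muE 0%N 1) ?mul1r ?rmorph1 //.
by rewrite /zQ !rmorph1.
Qed.

Section Coordinates.
Hypothesis Rh_nz : 1 <> 0 :> Rh G.
Variables (d : nat) (om : 'I_d -> Omega X) (com : 'I_d -> {linear Omega X -> (ringR X)^o}).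
Hypothesis om_free : free_on om com.
Variables (de : xiD T) (cde : {linear xiD T -> (OC B)^o}).
Hypothesis de_free : free_rank1 de cde.

Let overconv : ('X_{1..d} -> Q) -> Prop := @overconvergent p _ _ (Rh_root G) io d.

(** Moves exactness to coefficient families: injectivity and the formula for the differential
    transfer equations, and the description of the image lifts a primitive back to the complex. *)
Lemma KKQ_forms : exists Psi : forall q, KKQ D q -> ps_form d Q q,
  [/\ forall q z y J I, Psi q (z - y) J I = Psi q z J I - Psi q y J I,
      forall q z, (forall J I, Psi q z J I = 0) -> z = 0,
      forall q z J I, Psi q.+1 (dKKQ D q z) J I = form_d (Psi q z) J I,
      forall x J I, Psi 0%N (augmQ D x) J I = x * (I == 0%MM)%:R
    & forall q (a : ps_form d Q q),
        (form_alt a /\ forall J, overconv (a J)) <->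
        exists z, forall J I, Psi q z J I = a J I].
Proof.
have [coef [coef_inj coef_lin coef_const coef_der coef_im]] :=
  Sd_coef p_prime S Rh_nz om_free de_free.
have [h hP] := mixed_tensor_free (ESd_tensor S) om_free de_free.
have Rh_tf := R_nat_torsionfree p_prime (Rh_torsionfree p_prime (G := G)) Rh_natr_unit.
have coefM n I x : coef I (n%:R * x) = n%:R * coef I x.
  by rewrite !mulr_natl raddfMn.
have Sd_sign k : (-1) ^+ k = Rh_Sd S ((-1) ^+ k) by rewrite rmorphXn rmorphN rmorph1.
(* [dSd] is given through its composite with the map to [ESh], so additivity is read off from its
   coefficients. *)
have hD k : {morph (fun x => h k (dSd x) : Sd S) : x y / x + y}.
  move=> x y; apply/eqP; rewrite -subr_eq0; apply/eqP/coef_inj => I.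
  by rewrite raddfB raddfD !(coef_der h hP) raddfD mulrDr subrr.
have [phi [phi_ex phi_base phi_alt phi_d]] := KK_coords D om_free de_free hP hD.
have [mu [muD muZ mu1]] := Qp_to_RhQ.
have mu_nat n x : mu (n%:R * x) = n%:R * mu x.
  by rewrite -(rmorph_nat (Zp_Qp D)) muZ /zQ !rmorph_nat.
have bal q J I : balanced (Rh_Sd S \o (OC_Rh G \o Zp_OC D)) (Zp_Qp D)
    (fun (x : KK D q) u => io (coef I (phi q J x)) * mu u : Q).
  split=> [x x' u|x u u'|z x u].
  - by rewrite !raddfD mulrDl.
  - by rewrite muD mulrDr.
  by rewrite linearZ /= coef_lin muZ rmorphM mulrCA mulrA.
have PsiP q J I : {P : {additive KKQ D q -> Q} |
    forall x u, P (kkq x u) = io (coef I (phi q J x)) * mu u}.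
  apply: constructive_indefinite_description; have [_ univ] := KKQ_tensor D q.
  by have [P PE _] := univ _ _ (bal q J I); exists P.
pose Psi q z : ps_form d Q q := fun J I => sval (PsiP q J I) z.
have PsiE q x u J I : Psi q (kkq x u) J I = io (coef I (phi q J x)) * mu u :=
  svalP (PsiP q J I) x u.
have PsiMn q z n J I : Psi q (z *+ n) J I = n%:R * Psi q z J I.
  by rewrite /Psi raddfMn mulr_natl.
have mu_inv n : (0 < n)%N -> n%:R * mu n%:R^-1 = 1.
  by move=> n0; rewrite -mu_nat divff ?mu1 // Zp_Qp_nat_neq0.
have pn0 k : (0 < p ^ k)%N by rewrite expn_gt0 prime_gt0.
have Psi_inj q z : (forall J I, Psi q z J I = 0) -> z = 0.
  have [k [x ->]] := KKQ_denominator z => z0.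
  have phi0 J : phi q J x = 0.
    apply: coef_inj => I; apply: (loc_inj (Rh_torsionfree p_prime (G := G)) (RhQ_loc D)).
    rewrite -[LHS]mulr1 -(mu_inv (p ^ k)%N) // mulrCA !natrX -PsiE.
    by rewrite z0 mulr0.
  (* Moves q! across the tensor, because q! x is what has an expansion in the coordinates. *)
  have -> : (p%:R ^+ k)^-1 = (q`!)%:R * ((q`!)%:R^-1 * (p%:R ^+ k)^-1) :> Qp D.
    by rewrite mulrA divff ?mul1r // Zp_Qp_nat_neq0 // fact_gt0.
  rewrite -kkq_natr phi_ex big1 => [|J _]; last by rewrite phi0 scale0r.
  have [[tD _ _] _] := KKQ_tensor D q.
  have t0 u : kkq (0 : KK D q) u = 0 by apply: (addrI (kkq 0 u)); rewrite -tD !addr0.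
  exact: t0.
have Psi_d q z J I : Psi q.+1 (dKKQ D q z) J I = form_d (Psi q z) J I.
  have [k [x ->]] := KKQ_denominator z.
  rewrite dKKQE PsiE /form_d.
  have -> : coef I (phi q.+1 J (dKK D q x)) = \sum_(s < q.+1)
      (-1) ^+ s * ((I (J s)).+1%:R * coef (I + U_(J s))%MM (phi q (omitf s J) x)).
    apply/eqP; rewrite -subr_eq0; apply/eqP/(Rh_tf q`!); first exact: fact_gt0.
    rewrite mulrBr -coefM phi_d coefM -mulrBr raddf_sum -sumrB big1 ?mulr0 // => s _.
    by rewrite Sd_sign coef_lin (coef_der h hP) subrr.
  rewrite rmorph_sum mulr_suml; apply: eq_bigr => s _.
  rewrite !rmorphM rmorphXn rmorphN rmorph1 rmorph_nat /pderiv PsiE.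
  by rewrite -!mulrA.
have Psi_augm x J I : Psi 0%N (augmQ D x) J I = x * (I == 0%MM)%:R.
  have [k [a ka]] := loc_div (RhQ_loc D) x.
  apply: (Q_reg (k := k)); rewrite mulrA ka -natrX -PsiMn -raddfMn -(mulr_natl x) natrX ka.
  rewrite (augmE D a [ffun b => om (J b)] [ffun=> de]) PsiE mu1 mulr1.
  rewrite linearZ /= -[kk _ _]/(KK_base D om de J) phi_base.
  rewrite /kronecker_det det_mx00; rewrite -[_ *: _]/(_ * _) mulr1 coef_const.
  by rewrite rmorphM rmorph_nat.
exists Psi; split=> // [q z y J I|q a]; first by rewrite /Psi raddfB.
split=> [[a_alt a_ov]|[z za]]; last first.
  have [k [x zE]] := KKQ_denominator z.
  have xa J I : a J I = io (coef I (phi q J x)) * mu (p%:R ^+ k)^-1.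
    by rewrite -za zE PsiE.
  split=> [J s I|J].
    by rewrite !xa phi_alt Sd_sign coef_lin rmorphM rmorphXn rmorphN rmorph1 mulrA.
  have [m [F' [m0 FE]]] := (coef_im (fun I => coef I (phi q J x))).1
    (ex_intro _ (phi q J x : Sd S) (fun=> erefl)).
  exists k, m, F'; split=> // I; rewrite -FE xa mulrCA -!natrX mu_inv ?mulr1 //.
have fP J : {kf : nat * Sd S | forall I, p%:R ^+ kf.1 * a J I = io (coef I kf.2)}.
  apply: constructive_indefinite_description.
  have [k [m [a' [m0 aE]]]] := a_ov J.
  have [f fE] := (coef_im (fun I => Rh_root G m ^+ mdeg I * a' I)).2
    (ex_intro _ m (ex_intro _ a' (conj m0 (fun=> erefl)))).
  by exists (k, f) => I; rewrite /= fE aE.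
pose kf J := sval (fP J).
have kfE J I : io (coef I (kf J).2) = p%:R ^+ (kf J).1 * a J I := esym (svalP (fP J) I).
(* By alternation the sum over all tuples counts each component q! times; hence q! in the
   denominator, beside the power of p clearing [a J]. *)
exists (\sum_J kkq ((kf J).2 *: KK_base D om de J) (q`! * p ^ (kf J).1)%:R^-1) => J I.
have regQ n (x y : Q) : (0 < n)%N -> n%:R * x = n%:R * y -> x = y.
  move=> n0 /eqP; rewrite -subr_eq0 -mulrBr => /eqP/(Q_tf n0)/eqP.
  by rewrite subr_eq0 => /eqP.
apply: (regQ q`!); first exact: fact_gt0.
transitivity (\sum_J' a J' I * kronecker_det Q J J').
  rewrite /Psi raddf_sum mulr_sumr; apply: eq_bigr => J' _.
  rewrite -[sval (PsiP q J I) _]/(Psi q _ J I) PsiE linearZ /= phi_base.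
  have -> : coef I ((kf J').2 *: (kronecker_det (Sd S) J J' : (Sd S)^o)) =
      coef I (kf J').2 *~ kronecker_det int J J'.
    by rewrite -raddfMz -mulrzr -kronecker_det_intr.
  rewrite rmorphMz kfE -mulrzr -kronecker_det_intr.
  have := mu_inv (q`! * p ^ (kf J').1)%N; rewrite muln_gt0 fact_gt0 pn0 => /(_ isT).
  set u := mu _; rewrite natrM natrX => e.
  transitivity (q`!%:R * p%:R ^+ (kf J').1 * u * (a J' I * kronecker_det Q J J')).
    by rewrite -!mulrA; congr (_ * (_ * _)); rewrite mulrA mulrC.
  by rewrite e mul1r.
rewrite kronecker_det_sum (eq_bigr (fun=> a J I)) => [|s _].
  by rewrite sumr_const card_Sn mulr_natl.
by rewrite a_alt mulrA -exprD addnn -signr_odd odd_double mul1r.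
Qed.

End Coordinates.
End Resolution.

Theorem mainTheorem5 (p : nat) (p_prime : prime p) (B : base_field p)
    (X : log_chart B) (G : galois_cover X) (T : fontaine B) (S : higgs_tate G T)
    (D : dolbeault S) :
  is_resolution (dKKQ D) (augmQ D).
Proof.
have [d [om [com om_free]]] := Omega_free p_prime X.
have [de [cde de_free]] := xiD_free p_prime T.
(* If [Rh] is the zero ring all terms vanish; otherwise polynomial coordinates over it are
   available. *)
have [Rh0|/eqP Rh_nz] := eqVneq (1 : Rh G) 0.
  have KK0 i (x : KK D i) : x = 0.
    by rewrite -[x]scale1r -(rmorph1 (Rh_Sd S)) Rh0 rmorph0 scale0r.
  have KKQ0 i (z : KKQ D i) : z = 0.
    have [k [x ->]] := KKQ_denominator p_prime z; rewrite (KK0 i x).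
    have [[tD _ _] _] := KKQ_tensor D i.
    by apply: (addrI (kkq (0 : KK D i) (p%:R ^+ k)^-1)); rewrite -tD !addr0.
  have RhQ0 (x : RhQ D) : x = 0.
    by rewrite -[x]mul1r -(rmorph1 (Rh_RhQ D)) Rh0 rmorph0 mul0r.
  split=> [x y _|x|i x]; first by rewrite [x]RhQ0 [y]RhQ0.
    by split=> _; [exists 0; rewrite [RHS]KKQ0 raddf0 | apply: KKQ0].
  by split=> _; [exists 0; rewrite [RHS]KKQ0 raddf0 | apply: KKQ0].
have [Psi [PsiB Psi_inj Psi_d Psi_augm Psi_im]] := KKQ_forms p_prime D Rh_nz om_free de_free.
have Q_tf : nat_torsionfree (RhQ D).
  exact: (loc_nat_torsionfree p_prime (Rh_natr_unit p_prime G) (RhQ_loc D)).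
have Psi_eq i (x y : KKQ D i) : (forall J I, Psi i x J I = Psi i y J I) -> x = y.
  move=> xy; apply/eqP; rewrite -subr_eq0; apply/eqP/Psi_inj => J I.
  by rewrite PsiB xy subrr.
have Psi0 i J I : Psi i 0 J I = 0 by rewrite -(subrr 0) PsiB subrr.
pose J0 : {ffun 'I_0 -> 'I_d} := ffun0 (card_ord 0).
split=> [x y xy|z|i z].
- by have := congr1 (fun z => Psi 0%N z J0 0%MM) xy; rewrite !Psi_augm eqxx !mulr1.
- have J0E J : J = J0 by apply/ffunP => -[].
  split=> [dz|[x <-]]; last first.
    apply: Psi_eq => J I; rewrite Psi0 Psi_d; apply: big1 => s _.
    rewrite /pderiv Psi_augm (_ : (_ == _) = false) ?mulr0 //.
    by rewrite -mdeg_eq0 mdegD mdeg1 addn1.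
  (* A closed function equals its constant term: for I_k > 0, I_k times the coefficient at I is the
     coefficient of its k-th derivative at I - U_k. *)
  exists (Psi 0%N z J0 0%MM); apply: Psi_eq => J I; rewrite Psi_augm [J]J0E.
  have [->|I0] := eqVneq I 0%MM; first by rewrite mulr1.
  have [k Ik] : exists k, (0 < I k)%N.
    apply/existsP; apply: contraNT I0; rewrite negb_exists => /forallP I0.
    by apply/eqP/mnmP => k; have := I0 k; rewrite -eqn0Ngt mnm0E => /eqP.
  rewrite mulr0; symmetry; apply: (Q_tf (I k)) => //.
  have := Psi_d 0%N z [ffun=> k] (I - U_(k))%MM.
  rewrite dz Psi0 /form_d big_ord1 expr0 mul1r ffunE /pderiv [omitf _ _]J0E.
  by rewrite submK ?lep1mP -?lt0n // mnmBE mnm1E eqxx subn1 prednK.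
split=> [dz|[y <-]]; last first.
  apply: Psi_eq => J I; rewrite Psi0 Psi_d -(form_dd Q_tf (Psi i y) J I).
  by apply: eq_bigr => s _; rewrite /pderiv Psi_d.
have [z_alt z_ov] := (Psi_im i.+1 (Psi i.+1 z)).2 (ex_intro _ z (fun _ _ => erefl)).
(* The weight adds the degree i + 1 of the form to that of the monomial, so it is positive even at I
   = 0. *)
have gP J : {g | overconvergent p (Rh_root G) (Rh_RhQ D) g /\
    forall I, (mdeg I + i.+1)%:R * g I = Psi i.+1 z J I}.
  apply: constructive_indefinite_description.
  have [g g_ov gE] := overconvergent_div p_prime (Rh_natr_unit p_prime G)
    (@Rh_root_exp _ _ _ G) (@Rh_rootX _ _ _ G) (RhQ_loc D) (ltn0Sn i) (z_ov J).
  by exists g.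
pose g : ps_form d (RhQ D) i.+1 := fun J => sval (gP J).
have [|J I|b_alt db] := form_poincare Q_tf (g := g) z_alt.
- by move=> J I; rewrite -Psi_d dz Psi0.
- by have [_ ->] := svalP (gP J).
(* The primitive is a finite sum of families y_k g, hence overconvergent, so it comes from an
   element of the complex. *)
have [y yE] := (Psi_im i (form_euler g)).1 (conj b_alt (fun J =>
  overconvergent_sum (@Rh_rootX _ _ _ G) (fun k => overconvergent_mulX
    (@Rh_root_exp _ _ _ G) k (svalP (gP (consf k J))).1))).
exists y; apply: Psi_eq => J I; rewrite Psi_d -db.
by apply: eq_bigr => s _; rewrite /pderiv yE.
Qed.
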